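(* Let $n\ge 3$ and let $(\mathcal{P}^n,\mathfrak{p})$ be a connected photon surface with constant umbilicity factor $\lambda$ in a spacetime of Class $\mathfrak{H}$ with metric coefficient $h$ and fibre $(\mathcal{N},g_{\mathcal{N}})$, or in its generalized Kruskal--Szekeres extension. Assume further that, for $r$ in a dense set of radii in $(0,\infty)$, $$\frac{1}{2}h''(r)+\frac{n-3}{2r}h'(r)-\frac{n-2}{r^2}h(r)+r^{-2}\operatorname{Ric}_{g_{\mathcal{N}}}(X,X)\neq 0$$ for every unit tangent vector $X$ of $(\mathcal{N},g_{\mathcal{N}})$. Then $\mathcal{P}^n$ is either (rotationally) symmetric, or $\mathcal{P}^n$ is totally geodesic with parallel unit normal vector $\eta$ everywhere tangent to $\mathcal{N}$.
   Context: **Class $\mathfrak{H}$.** An $(n+1)$-dimensional spacetime $(\mathfrak{M},\mathfrak{g})$, $n\ge 3$, is of Class $\mathfrak{H}$ with metric coefficient $h$ and fibre $\mathcal{N}$ if $\mathfrak{M}=\mathbb{R}\times I\times\mathcal{N}$ with $I=(r_H,\infty)$, $r_H\ge 0$, $(\mathcal{N},g_{\mathcal{N}})$ a compact $(n-1)$-dimensional Riemannian manifold, and $\mathfrak{g}=-h(r)\,dt^2+\frac{1}{h(r)}dr^2+r^2g_{\mathcal{N}}$, where $h:(0,\infty)\to\mathbb{R}$ is smooth, strictly positive on $I$, and $h(r_H)=0$ if $r_H>0$. $\operatorname{Ric}_{g_{\mathcal{N}}}$ is the Ricci tensor of $(\mathcal{N},g_{\mathcal{N}})$. **Generalized Kruskal--Szekeres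 extension.** It is considered when $h$ has finitely many positive zeros $r_1<\dots<r_N=r_H$, all simple. Put $r_0=0$, $r_{N+1}=\infty$. For $1\le l\le N$ let $C_l=1/h'(r_l)$ and let $\Phi_l$ be the unique strictly increasing solution of $\Phi_l/\Phi_l'=C_l h$ on $(r_{l-1},r_{l+1})$ with $\Phi_l'(r_l)=1$. Let $\mathbb{P}_l=\{(u,v)\in\mathbb{R}^2: uv\in\operatorname{Im}\Phi_l\}$, $\rho=\Phi_l^{-1}(uv)$, $F_l=2C_l/\Phi_l'$, and equip $\mathbb{P}_l\times\mathcal{N}$ with the metric $(F_l\circ\rho)(du\otimes dv+dv\otimes du)+\rho^2 g_{\mathcal{N}}$. On each quadrant $\{u\ne 0,v\ne0\}$ one has coordinates $r=\rho$, $t=C_l\ln|v/u|$ in which the metric is $-h\,dt^2+h^{-1}dr^2+r^2g_{\mathcal{N}}$, and $(\mathfrak{M},\mathfrak{g})$ corresponds to $\{u,v>0\}\subset\mathbb{P}_N\times\mathcal{N}$. The extension is the spacetime obtained by gluing (copies of) these charts, charts with consecutive indices $l,l+1$ being identified along quadrants with $\rho\in(r_l,r_{l+1})$ via the coordinates $(t,r)$. **Photon surfaces.** A photon surface is a smooth, timelike, totally umbilic hypersurface $\mathcal{P}^n$: with induced metric $\mathfrak{p}$ and second fundamental form $\mathfrak{h}$ (with respect to the spacelike unit normal $\eta$) one has $\mathfrak{h}=\lambda\mathfrak{p}$ for a smooth function $\lambda$ on $\mathcal{P}^n$, the umbilicity factor. **Symmetric.** $\mathcal{P}^n$ is (rotationally)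 symmetric if at every $p\in\mathcal{P}^n$ the canonical lift of the tangent space of $\mathcal{N}$ at $p$ is a subspace of $T_p\mathcal{P}^n$, and the unit normal $\eta$ lies everywhere in the span of $\{\partial_t,\partial_r\}$ (respectively of $\{\partial_u,\partial_v\}$ in the extension). ''$\eta$ tangent to $\mathcal{N}$'' means that $\eta$ lies in the canonical lift of $T\mathcal{N}$. *)

(* Defs.v *)
From mathcomp Require Import all_boot all_order all_algebra.
From mathcomp Require Import all_classical all_reals all_analysis.

Set Implicit Arguments.
Unset Strict Implicit.
Unset Printing Implicit Defensive.

Import Order.TTheory GRing.Theory Num.Theory numFieldNormedType.Exports.

Local Open Scope classical_set_scope.
Local Open Scope ring_scope.

(* Everything is done in coordinates.  Tangent vectors are ROW vectors of       *)
(* components; 'J f p is the library's Jacobian, whose row a is the derivative  *)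
(* of f along the a-th coordinate direction, so that f pushes v to v *m 'J f p. *)

Section Smoothness.
Context {R : realType} {X V : normedModType R}.

(* C^k on an open subset U of a finite-dimensional space X: taking all          *)
(* directions v is the same as taking the partial derivatives.                  *)
Fixpoint Ck (k : nat) (U : set X) (f : X -> V) : Prop :=
  match k with
  | 0 => forall x, U x -> {for x, continuous f}
  | k'.+1 => (forall x, U x -> differentiable f x) /\
             (forall v, Ck k' U (fun x => 'D_v f x))
  end.

Definition smooth_on (U : set X) (f : X -> V) : Prop := forall k, Ck k U f.

End Smoothness.

(* Homeomorphism of the open set D onto an open subset of the codomain.         *)
Definition open_embedding (S T : topologicalType) (D : set S) (f : S -> T) :=
  [/\ open D, set_inj D f, (forall x, D x -> {for x, continuous f})
    & forall W, open W -> W `<=` D -> open (f @` W)].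

(* Coordinate data of an m-dimensional semi-Riemannian manifold on the union of *)
(* the sets  par c @` dom c : inverse charts  par c  defined on  dom c , and    *)
(* the matrix  met c x  of the metric in the chart c.  Values outside  dom c    *)
(* are irrelevant.                                                              *)
Record atlas (R : realType) (T : topologicalType) (m : nat) := Atlas {
  chart : Type;
  dom : chart -> set 'rV[R]_m;
  par : chart -> 'rV[R]_m -> T;
  met : chart -> 'rV[R]_m -> 'M[R]_m }.

Section Geometry.
Context {R : realType} {T : topologicalType} {m : nat} (A : atlas R T m).

Definition transition (c c' : chart A) (V : set 'rV[R]_m)
    (tau : 'rV[R]_m -> 'rV[R]_m) : Prop :=
  [/\ open V, V `<=` dom c, smooth_on V tau
    & forall x, V x -> dom c' (tau x) /\ par c' (tau x) = par c x].

Record compact_riemannian : Prop := CompactRiemannian {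
  cr_compact : compact [set: T];
  cr_hausdorff : hausdorff_space T;
  cr_chart : forall c : chart A, open_embedding (dom c) (par c);
  cr_cover : forall p : T, exists c : chart A, (par c @` dom c) p;
  cr_transition : forall (c c' : chart A) x x', dom c x -> dom c' x' ->
    par c x = par c' x' -> exists V tau, transition c c' V tau /\ V x;
  cr_smooth : forall c : chart A, smooth_on (dom c) (met c);
  cr_sym : forall (c : chart A) x, dom c x -> (met c x)^T = met c x;
  cr_pos : forall (c : chart A) x (v : 'rV[R]_m), dom c x -> v != 0 ->
    0 < (v *m met c x *m v^T) 0 0;
  cr_tensor : forall (c c' : chart A) V tau x, transition c c' V tau -> V x ->
    met c x = 'J tau x *m met c' (tau x) *m ('J tau x)^T }.

(* Gamma^k_(ij) *)
Definition christoffel (G : 'rV[R]_m -> 'M[R]_m) (k i j : 'I_m)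
    (x : 'rV[R]_m) : R :=
  2^-1 * \sum_(l < m) invmx (G x) k l *
    ('D_(delta_mx 0 i) (fun y => G y j l) x
     + 'D_(delta_mx 0 j) (fun y => G y i l) x
     - 'D_(delta_mx 0 l) (fun y => G y i j) x).

Definition ricci (G : 'rV[R]_m -> 'M[R]_m) (x : 'rV[R]_m) : 'M[R]_m :=
  \matrix_(j, k)
    (\sum_(l < m) ('D_(delta_mx 0 l) (christoffel G l j k) x
                   - 'D_(delta_mx 0 k) (christoffel G l j l) x)
     + \sum_(l < m) \sum_(p < m)
         (christoffel G l l p x * christoffel G p j k x
          - christoffel G l k p x * christoffel G p j l x)).

Definition lorentzian (q : nat) (S : 'M[R]_q) : Prop :=
  exists2 B : 'M[R]_q, B \in unitmx &
    B *m S *m B^T = diag_mx (\row_i (if (i : nat) == 0 then -1 else 1)).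

(* A vector field along a subset of T is given by its components                *)
(* eta c x  at the point  par c x , in each chart c.                            *)
Definition vfield := forall c : chart A, 'rV[R]_m -> 'rV[R]_m.

Section Submanifold.
Context (n : nat) (P : set T).

(* x is, in the chart c, a regular parametrization of an open piece of the      *)
(* embedded n-dimensional submanifold P.                                        *)
Record local_param (c : chart A) (V : set 'rV[R]_n)
    (x : 'rV[R]_n -> 'rV[R]_m) : Prop := LocalParam {
  lp_open : open V;
  lp_smooth : smooth_on V x;
  lp_dom : forall s, V s -> dom c (x s);
  lp_immersion : forall s, V s -> row_free ('J x s);
  lp_inj : set_inj V x;
  lp_homeo : forall V', open V' -> V' `<=` V ->
    exists2 W, open W & [set par c (x s) | s in V'] = P `&` W }.

Definition submanifold : Prop := forall p, P p ->
  exists c V x, local_param c V x /\ exists2 s, V s & par c (x s) = p.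

Definition induced (c : chart A) (x : 'rV[R]_n -> 'rV[R]_m) (s : 'rV[R]_n) :
    'M[R]_n := 'J x s *m met c (x s) *m ('J x s)^T.

Definition timelike : Prop := forall c V x, local_param c V x ->
  forall s, V s -> lorentzian (induced c x s).

Record unit_normal (eta : vfield) : Prop := UnitNormal {
  un_tensor : forall c c' V tau y, transition c c' V tau -> V y ->
    P (par c y) -> eta c' (tau y) = eta c y *m 'J tau y;
  un_smooth : forall c V x, local_param c V x ->
    smooth_on V (fun s => eta c (x s));
  un_unit : forall c V x, local_param c V x -> forall s, V s ->
    (eta c (x s) *m met c (x s) *m (eta c (x s))^T) 0 0 = 1;
  un_normal : forall c V x, local_param c V x -> forall s, V s ->
    eta c (x s) *m met c (x s) *m ('J x s)^T = 0 }.

(* Row a: components of the ambient covariant derivative of eta along P in the  *)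
(* direction of the a-th parameter.                                             *)
Definition covariant_derivative (eta : vfield) (c : chart A)
    (x : 'rV[R]_n -> 'rV[R]_m) (s : 'rV[R]_n) : 'M[R]_(n, m) :=
  \matrix_(a, k)
    ('D_(delta_mx 0 a) (fun s' => eta c (x s') 0 k) s
     + \sum_(i < m) \sum_(j < m)
         christoffel (met c) k i j (x s) * 'J x s a i * eta c (x s) 0 j).

(* (X, Y) |-> g(nabla_X eta, Y) *)
Definition second_fundamental_form (eta : vfield) (c : chart A)
    (x : 'rV[R]_n -> 'rV[R]_m) (s : 'rV[R]_n) : 'M[R]_n :=
  covariant_derivative eta c x s *m met c (x s) *m ('J x s)^T.

Definition umbilic (eta : vfield) (lambda : T -> R) : Prop :=
  forall c V x, local_param c V x ->
    smooth_on V (fun s => lambda (par c (x s))) /\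
    forall s, V s -> second_fundamental_form eta c x s =
                     lambda (par c (x s)) *: induced c x s.

Definition totally_geodesic (eta : vfield) : Prop :=
  forall c V x, local_param c V x -> forall s, V s ->
    second_fundamental_form eta c x s = 0.

Definition parallel (eta : vfield) : Prop :=
  forall c V x, local_param c V x -> forall s, V s ->
    covariant_derivative eta c x s = 0.

(* To be used with m = n.+1, where submanifolds are hypersurfaces.              *)
Record photon_surface (eta : vfield) (lambda : T -> R) : Prop :=
  PhotonSurface {
    ps_submanifold : submanifold;
    ps_timelike : timelike;
    ps_normal : unit_normal eta;
    ps_umbilic : umbilic eta lambda }.

End Submanifold.
End Geometry.

(* A space covered by pieces  B x N , B a domain of R^2, each with a metric     *)
(* bmet + brad^2 g_N .                                                          *)
Record warped (R : realType) (N : topologicalType) := Warped {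
  carrier : topologicalType;
  piece : Type;
  bdom : piece -> set 'rV[R]_2;
  bmet : piece -> 'rV[R]_2 -> 'M[R]_2;
  brad : piece -> 'rV[R]_2 -> R;
  emb : piece -> 'rV[R]_2 -> N -> carrier }.

Definition warped_atlas (R : realType) (N : topologicalType) (d : nat)
    (gN : atlas R N d) (S : warped R N) : atlas R (carrier S) (2 + d) :=
  {| chart := (piece S * chart gN)%type;
     dom := fun ac => [set x | bdom ac.1 (lsubmx x) /\ dom ac.2 (rsubmx x)];
     par := fun ac x => emb ac.1 (lsubmx x) (par ac.2 (rsubmx x));
     met := fun ac x => block_mx (bmet ac.1 (lsubmx x)) 0 0
              (brad ac.1 (lsubmx x) ^+ 2 *: met ac.2 (rsubmx x)) |}.

Section Adapted.
Context {R : realType} {N : topologicalType} {d : nat} (gN : atlas R N d).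
Context (S : warped R N) (n : nat) (P : set (carrier S)).
Context (eta : vfield (warped_atlas gN S)).

Definition rotationally_symmetric : Prop :=
  forall c V x, local_param (A := warped_atlas gN S) (n := n) P c V x ->
  forall s, V s ->
    (forall w : 'rV[R]_d, (row_mx (0 : 'rV[R]_2) w <= 'J x s)%MS) /\
    rsubmx (eta c (x s)) = 0.

Definition tangent_to_fibre : Prop :=
  forall c V x, local_param (A := warped_atlas gN S) (n := n) P c V x ->
  forall s, V s -> lsubmx (eta c (x s)) = 0.

End Adapted.

Section ClassH.
Context {R : realType} (h : R -> R) (rH : R).

Record class_H_coefficient : Prop := ClassHCoefficient {
  ch_radius : 0 <= rH;
  ch_smooth : smooth_on [set r : R | 0 < r] h;
  ch_pos : forall r, rH < r -> 0 < h r;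
  ch_horizon : 0 < rH -> h rH = 0 }.

(* Base coordinates (t, r). *)
Definition class_H_spacetime (N : topologicalType) : warped R N :=
  {| carrier := (R * R * N)%type : topologicalType;
     piece := unit;
     bdom := fun _ => [set x | rH < x 0 1];
     bmet := fun _ x => diag_mx (\row_(i < 2)
               (if i == 0 then - h (x 0 1) else (h (x 0 1))^-1));
     brad := fun _ x => x 0 1;
     emb := fun _ x p => (x 0 0, x 0 1, p) |}.

(* z 1 < ... < z k are the positive zeros of h; z 0 = 0 is a convention.        *)
Record simple_zeros (k : nat) (z : nat -> R) : Prop := SimpleZeros {
  sz_nonempty : (0 < k)%N;
  sz_zero : z 0%N = 0;
  sz_incr : forall l, (l < k)%N -> z l < z l.+1;
  sz_zeros : forall r, 0 < r ->
    (h r = 0 <-> exists2 l, (0 < l <= k)%N & r = z l);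
  sz_simple : forall l, (0 < l <= k)%N -> derive1 h (z l) != 0 }.

Section Kruskal.
Context (k : nat) (z : nat -> R) (Phi : nat -> R -> R).

(* ]z_(l-1), z_(l+1)[, where z_(k+1) = +oo *)
Definition KS_interval (l : nat) : set R :=
  [set r | z l.-1 < r /\ ((l < k)%N -> r < z l.+1)].

Definition KS_const (l : nat) : R := (derive1 h (z l))^-1.

Record KS_solution (l : nat) (phi : R -> R) : Prop := KSSolution {
  kss_smooth : smooth_on (KS_interval l) phi;
  kss_incr : forall r r', KS_interval l r -> KS_interval l r' ->
    r < r' -> phi r < phi r';
  kss_ode : forall r, KS_interval l r ->
    derive1 phi r != 0 /\ phi r / derive1 phi r = KS_const l * h r;
  kss_init : derive1 phi (z l) = 1 }.

(* Base coordinates (u, v). *)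
Definition KS_domain (l : nat) : set 'rV[R]_2 :=
  [set x | (Phi l @` KS_interval l) (x 0 0 * x 0 1)].

(* Phi_l^-1 (u v) *)
Definition KS_rho (l : nat) (x : 'rV[R]_2) : R :=
  xget 0 [set r | KS_interval l r /\ Phi l r = x 0 0 * x 0 1].

Definition KS_time (l : nat) (x : 'rV[R]_2) : R :=
  KS_const l * ln `|x 0 1 / x 0 0|.

Definition KS_metric (l : nat) (x : 'rV[R]_2) : 'M[R]_2 :=
  \matrix_(i, j) (if i == j then 0
                  else 2 * KS_const l / derive1 (Phi l) (KS_rho l x)).

(* The four open quadrants, indexed by the signs of u and v (true: positive).   *)
Definition quadrant (q : bool * bool) : set 'rV[R]_2 :=
  [set x | (if q.1 then 0 < x 0 0 else x 0 0 < 0) /\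
           (if q.2 then 0 < x 0 1 else x 0 1 < 0)].

Definition KS_glued (I : Type) (label : I -> nat)
    (glue : I -> bool * bool -> I -> bool * bool -> Prop)
    (a b : I) (x y : 'rV[R]_2) : Prop :=
  exists q q', [/\ glue a q b q', quadrant q x, quadrant q' y,
                   KS_rho (label a) x = KS_rho (label b) y
                 & KS_time (label a) x = KS_time (label b) y].

(* A spacetime glued from copies of the charts P_l x N.  A copy a of P_l and a  *)
(* copy b of P_(l+1) may be identified along a quadrant q of a with u v > 0 and *)
(* a quadrant q' of b with u v < 0 (the quadrants where rho lies in             *)
(* ]z_l, z_(l+1)[), recorded by  ks_glue a q b q' ; a quadrant is identified    *)
(* with at most one other.  The pattern of identifications is otherwise free.   *)
Record KS_extension (N : topologicalType) := KSExtension {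
  ks_space : topologicalType;
  ks_copy : Type;
  ks_label : ks_copy -> nat;
  ks_emb : ks_copy -> 'rV[R]_2 -> N -> ks_space;
  ks_glue : ks_copy -> bool * bool -> ks_copy -> bool * bool -> Prop;
  ks_label_range : forall a, (0 < ks_label a <= k)%N;
  ks_outer : exists a, ks_label a = k;
  ks_glue_label : forall a q b q', ks_glue a q b q' ->
    [/\ ks_label b = (ks_label a).+1, q.1 = q.2 & q'.1 != q'.2];
  ks_glue_fun : forall a q b1 q1 b2 q2, ks_glue a q b1 q1 ->
    ks_glue a q b2 q2 -> (b1, q1) = (b2, q2);
  ks_glue_inj : forall a1 q1 a2 q2 b q, ks_glue a1 q1 b q ->
    ks_glue a2 q2 b q -> (a1, q1) = (a2, q2);
  ks_open_embedding : forall a, open_embedding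
    [set xp : 'rV[R]_2 * N | KS_domain (ks_label a) xp.1]
    (fun xp => ks_emb a xp.1 xp.2);
  ks_cover : forall e, exists a x p,
    KS_domain (ks_label a) x /\ ks_emb a x p = e;
  ks_overlap : forall a b x y p p',
    KS_domain (ks_label a) x -> KS_domain (ks_label b) y ->
    (ks_emb a x p = ks_emb b y p' <->
     p = p' /\ [\/ a = b /\ x = y, KS_glued ks_label ks_glue a b x y
                 | KS_glued ks_label ks_glue b a y x]) }.

Definition KS_spacetime (N : topologicalType) (E : KS_extension N) :
    warped R N :=
  {| carrier := ks_space E;
     piece := ks_copy E;
     bdom := fun a => KS_domain (ks_label a);
     bmet := fun a => KS_metric (ks_label a);
     brad := fun a => KS_rho (ks_label a);
     emb := @ks_emb N E |}.

End Kruskal.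

Inductive class_H_or_extension (N : topologicalType) : warped R N -> Prop :=
| ClassH_itself : class_H_or_extension (class_H_spacetime N)
| ClassH_extension (k : nat) (z : nat -> R) (Phi : nat -> R -> R)
    (E : KS_extension k z Phi N) :
    simple_zeros k z -> z k = rH ->
    (forall l, (0 < l <= k)%N -> KS_solution k z l (Phi l)) ->
    class_H_or_extension (KS_spacetime E).

End ClassH.

(* Main.v *)
Require Import Defs.
From mathcomp Require Import all_boot all_order all_algebra.
From mathcomp Require Import all_classical all_reals all_analysis.
From mathcomp Require Import perm ring lra.
Import Order.TTheory GRing.Theory Num.Theory numFieldNormedType.Exports.
Local Open Scope classical_set_scope.
Local Open Scope ring_scope.

(** A point of the spacetime is written (y, z), with y in the two-dimensional
Lorentzian base and z in the fibre, and the unit normal is split accordingly as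
eta = (xi, zeta).  The heart of the matter is that xi and zeta cannot both be nonzero
at a point whose radius rho is generic.

Umbilicity with constant factor lam says that the covariant derivative of eta along
the surface is lam times the tangent map (umbilic_cov_along).  For a warped product
this splits into a base part and a fibre part (base_equation, fibre_equation).  With
om = rho zeta the fibre part reads D om = f dz, where f = lam rho - drho(xi).
Commuting second derivatives shows how the curvature of the fibre acts on om, and the
trace expresses Ric(om, om) through df (ricci_along); here the surface has to project
onto the fibre, which it does when xi is nonzero.

For the base part, near a point with h(rho) nonzero the base metric is
(h/2)(P M + M P) for closed one-forms P and M, the differentials of null coordinates,
and drho = (h/2)(P + M).  The null components p = P(xi) and m = M(xi) satisfy
D p = (lam - h' p / 2) P + th along the surface, where th = gN(dz, om), and the same
with M (null_component_equation).  Hence df = (rho h'/2 - h) th, and the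
integrability conditions of the equations for p and m give rho h'' = h'
(null_component_integrability).  These identities together make the expression in
the genericity hypothesis vanish in the direction of om (core_expression).

The radius is not constant on an open piece of the surface where zeta is nonzero
(rho_nonconstant), so near a point where both parts are nonzero there is one with
generic radius and h(rho) nonzero.  Hence xi = 0 or zeta = 0 at every point
(patch_dichotomy).  Both conditions are closed and they exclude each other.  They do
not depend on the chart, because transition maps are products of base and fibre maps;
for two glued charts of the extension the base map sends u and v to multiples of
powers of |u| and |v| (KS_gluing_map).  By connectedness one of the conditions holds
throughout (connected_normal_type).  If zeta = 0, the surface is symmetric.  If
xi = 0, the base directions are tangent to the surface, and the base part of the
umbilicity equation forces lam = 0 (fibre_normal_umbilicity), so that the covariant
derivative of eta vanishes. *)

Set Implicit Arguments.
Unset Strict Implicit.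
Unset Printing Implicit Defensive.

(** * Directional derivatives and Young's theorem *)

(** Not immediate: the differential is a chosen linear map, so it has to be
identified with the differential of the other function first. *)
Lemma differentiable_near (R : realType) (V W : normedModType R) (F G : V -> W) s :
  (\forall x \near s, F x = G x) ->
  differentiable F s -> differentiable G s.
Proof.
move=> FG dF; have FGs := nbhs_singleton FG.
have [cF eF] := (diff_locallyP _ _).1 dF.
have FG0 : \forall w \near (0 : V), F (w + s) = G (w + s).
  have cs : (fun w : V => w + s) @ (0 : V) --> s.
    rewrite -[X in _ --> X]add0r.
    by apply: (@cvgD _ _ _ _ _ id (fun=> s)); [exact: cvg_id|exact: cvg_cst].
  exact: cs _ FG.
have eG : G \o shift s = cst (G s) + 'd F s +o_ 0 id.
  apply/eqaddoP => _/posnumP[e].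
  move/eqaddoP : eF => /(_ e%:num (gt0 e)) eF.
  near=> w.
  have -> : ((G \o shift s) - (cst (G s) + 'd F s)) w =
            ((F \o shift s) - (cst (F s) + 'd F s)) w.
    by rewrite !fctE /= -FGs; congr (_ - _); apply/esym; near: w.
  by near: w.
have dGF := diff_unique cF eG.
apply/diff_locallyP; split; first by rewrite dGF.
by rewrite dGF.
Unshelve. all: by end_near. Qed.

Section HasDeriv.
Context {R : realType} {V : normedModType R}.
Implicit Types (F G : V -> R) (s v : V) (a b : R).

(** Differentiability is part of the notion because the chain rule and Young's
theorem need it; a directional derivative alone would not compose. *)
Definition has_deriv F s v a := differentiable F s /\ 'D_v F s = a.

Lemma has_deriv_is_derive F s v a : has_deriv F s v a -> is_derive s v F a.
Proof. by case=> dF <-; exact/derivableP/diff_derivable. Qed.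

Lemma has_derivP F s v : differentiable F s -> has_deriv F s v ('D_v F s).
Proof. by []. Qed.

Lemma has_deriv_eq F s v a b : has_deriv F s v a -> a = b -> has_deriv F s v b.
Proof. by move=> ? <-. Qed.

Lemma has_deriv_cst s v a : has_deriv (fun=> a) s v 0.
Proof.
by split; [exact: differentiable_cst | exact: derive_cst].
Qed.

Lemma has_derivD F G s v a b : has_deriv F s v a -> has_deriv G s v b ->
  has_deriv (fun x => F x + G x) s v (a + b).
Proof.
move=> hF hG; split; first by apply: differentiableD; [case: hF|case: hG].
have /= := is_deriveD (has_deriv_is_derive hF) (has_deriv_is_derive hG).
by case.
Qed.

Lemma has_derivN F s v a : has_deriv F s v a ->
  has_deriv (fun x => - F x) s v (- a).
Proof.
move=> hF; split; first by apply: differentiableN; case: hF.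
by have [] := is_deriveN (has_deriv_is_derive hF).
Qed.

Lemma has_derivB F G s v a b : has_deriv F s v a -> has_deriv G s v b ->
  has_deriv (fun x => F x - G x) s v (a - b).
Proof. by move=> hF hG; apply: has_derivD => //; exact: has_derivN. Qed.

Lemma has_derivM F G s v a b : has_deriv F s v a -> has_deriv G s v b ->
  has_deriv (fun x => F x * G x) s v (a * G s + F s * b).
Proof.
move=> hF hG; split; first by apply: differentiableM; [case: hF|case: hG].
have [_ ->] := is_deriveM (has_deriv_is_derive hF) (has_deriv_is_derive hG).
by rewrite /GRing.scale /= addrC [a * _]mulrC.
Qed.

Lemma has_derivZ F s v a c : has_deriv F s v a ->
  has_deriv (fun x => c * F x) s v (c * a).
Proof.
move=> /(has_derivM (has_deriv_cst s v c)); rewrite mul0r add0r; exact.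
Qed.

Lemma has_deriv_sum (I : Type) (r : seq I) (P : pred I) (F : I -> V -> R) s v
    (a : I -> R) : (forall i, P i -> has_deriv (F i) s v (a i)) ->
  has_deriv (fun x => \sum_(i <- r | P i) F i x) s v (\sum_(i <- r | P i) a i).
Proof.
move=> hF; elim: r => [|i r IH].
  under [X in has_deriv X]funext do rewrite big_nil.
  by rewrite big_nil; exact: has_deriv_cst.
under [X in has_deriv X]funext do rewrite big_cons.
rewrite big_cons; case: ifP => // Pi.
exact: has_derivD (hF _ Pi) IH.
Qed.

Lemma has_derivV F s v a : F s != 0 -> has_deriv F s v a ->
  has_deriv (fun x => (F x)^-1) s v (- a / F s ^+ 2).
Proof.
move=> F0 hF; split; first by apply: differentiableV => //; case: hF.
have := deriveV F0 (@ex_derive _ _ _ _ _ _ _ (has_deriv_is_derive hF)).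
by case: hF => _ -> ->; rewrite /GRing.scale /= mulNr mulNr mulrC.
Qed.

Lemma has_deriv_near F G s v a : (\forall x \near s, F x = G x) ->
  has_deriv F s v a -> has_deriv G s v a.
Proof.
move=> FG [dF <-]; split; first exact: differentiable_near dF.
by apply/esym/near_eq_derive.
Qed.

Lemma has_deriv_unique F s v a b :
  has_deriv F s v a -> has_deriv F s v b -> a = b.
Proof. by move=> [_ <-] [_ <-]. Qed.

End HasDeriv.

Section Chain.
Context {R : realType} {V : normedModType R}.

Lemma has_deriv_comp1 (h : R -> R) (F : V -> R) s v a : derivable h (F s) 1 ->
  has_deriv F s v a -> has_deriv (fun x => h (F x)) s v (derive1 h (F s) * a).
Proof.
move=> /derivable1_diffP dh [dF <-]; split; first exact: differentiable_comp.
rewrite deriveE; last exact: differentiable_comp.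
rewrite diff_comp //= deriveE // derive1E' //.
by rewrite -[in LHS](mulr1 ('d F s v)) [LHS]linearZ mulrC.
Qed.

Lemma differentiable_row m (X : V -> 'rV[R]_m) s :
  (forall i, differentiable (fun x => X x 0 i : R) s) -> differentiable X s.
Proof.
move=> dX.
have -> : X = \sum_(i < m) (fun x => X x 0 i *: (delta_mx 0 i : 'rV[R]_m)).
  apply/funext => x; rewrite fct_sumE [LHS]matrix_sum_delta big_ord1.
  by apply: eq_bigr.
by apply: differentiable_sum => i; apply: differentiableZl.
Qed.

Lemma derive_row_coord m (X : V -> 'rV[R]_m) s v i : differentiable X s ->
  'D_v X s 0 i = 'D_v (fun x => X x 0 i) s.
Proof. by move=> dX; rewrite derive_mx ?mxE //; exact: diff_derivable. Qed.

Lemma differentiable_entry m n (X : V -> 'M[R]_(m, n)) s i j :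
  differentiable X s -> differentiable (fun x => X x i j : R) s.
Proof.
move=> dX; exact: (differentiable_comp dX (differentiable_coord _ _ _)).
Qed.

Lemma has_deriv_chain m (F : 'rV[R]_m -> R) (X : V -> 'rV[R]_m) s v
    (dX : 'I_m -> R) :
  differentiable F (X s) -> (forall i, has_deriv (fun x => X x 0 i) s v (dX i)) ->
  has_deriv (fun x => F (X x)) s v
    (\sum_(i < m) 'D_(delta_mx 0 i) F (X s) * dX i).
Proof.
move=> dF hX.
have dXs : differentiable X s by apply: differentiable_row => i; case: (hX i).
split; first exact: differentiable_comp.
rewrite deriveE; last exact: differentiable_comp.
rewrite diff_comp //= -(deriveE v dXs).
rewrite ['D_v X s]row_sum_delta linear_sum; apply: eq_bigr => i _.
rewrite linearZ /= -deriveE // derive_row_coord //.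
by case: (hX i) => _ ->; rewrite mulrC.
Qed.

(** The two difference quotients coincide term by term. *)
Lemma derive_comp_linear (U W : normedModType R) (L : {linear V -> U})
    (F : U -> W) s v : 'D_v (fun x => F (L x)) s = 'D_(L v) F (L s).
Proof.
rewrite /derive; set g1 := (fun _ : R => _); set g2 := (fun _ : R => _).
suff -> : g1 = g2 by [].
apply/funext => t; rewrite /g1 /g2 /=.
by have -> : L (t *: v + s) = t *: L v + L s by rewrite linearP.
Qed.

End Chain.

Lemma has_deriv_row_entry {R : realType} m (A : 'I_m) (y v : 'rV[R]_m) :
  has_deriv (fun y : 'rV[R]_m => y 0 A) y v (v 0 A).
Proof.
split; first exact: differentiable_coord.
by rewrite -(derive_row_coord (X := id)) //; rewrite derive_id.
Qed.

Section Young.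
Context {R : realType} {V : normedModType R}.

Lemma is_derive_line (F : V -> R) (w a : V) (t : R) :
  differentiable F (t *: a + w) ->
  is_derive t (1 : R) (fun u : R => F (u *: a + w)) ('D_a F (t *: a + w)).
Proof.
move=> /(@diff_derivable _ _ _ _ _ a) dF.
have e : (fun k : R => k^-1 *: (((fun u : R => F (u *: a + w)) \o shift t) (k *: (1 : R))
      - F (t *: a + w))) =
    (fun k : R => k^-1 *: ((F \o shift (t *: a + w)) (k *: a) - F (t *: a + w))).
  by apply/funext => k /=; rewrite [k *: 1]mulr1 scalerDl addrA.
by split; [rewrite /derivable e|rewrite /derive e].
Qed.

(** The second difference of F over the parallelogram spanned by t a and t b:
the mean value theorem in the direction a turns it into t times an increment of
the derivative along a, which the differentiability of that derivative at s
controls. *)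
Lemma second_difference_derive (F : V -> R) (s a b : V) (e : R) : 0 < e ->
  (\forall x \near s, differentiable F x) -> differentiable ('D_a F) s ->
  \forall t \near 0^'+, `|F (t *: a + t *: b + s) - F (t *: a + s)
     - F (t *: b + s) + F s - t ^+ 2 * 'D_b ('D_a F) s| <= t ^+ 2 * e.
Proof.
move=> e0 dF dG; set G := 'D_a F in dG *.
pose K := 3 * `|a| + 2 * `|b| + 1.
have K0 : 0 < K by rewrite /K; have := normr_ge0 a; have := normr_ge0 b; lra.
have eK0 : 0 < e / K by rewrite divr_gt0.
have /eqaddoP /(_ (e / K) eK0) eG := diff_locally dG.
have hG : \forall w \near (0 : V),
    `|G (w + s) - G s - 'd G s w| <= e / K * `|w| /\ differentiable F (w + s).
  have cs : (fun w : V => w + s) @ (0 : V) --> s.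
    rewrite -[X in _ --> X]add0r.
    by apply: (@cvgD _ _ _ _ _ id (fun=> s)); [exact: cvg_id|exact: cvg_cst].
  near=> w; split; last first.
    by near: w; exact: cs _ dF.
  have : `|(G \o shift s - (cst (G s) + 'd G s)) w| <= e / K * `|w|.
    by near: w.
  by rewrite !fctE /= opprD addrA.
have /nbhs_normP [r /= r0 rP] := hG.
have rK0 : 0 < r / K by rewrite divr_gt0.
near=> t.
have t0 : 0 < t by [].
have tK : t * K < r by rewrite -ltr_pdivlMr //; near: t; exact: nbhs_right_lt.
have small u : 0 <= u -> u <= t -> `|u *: a| <= t * `|a|.
  by move=> u0 ut; rewrite normrZ ger0_norm // ler_wpM2r.
have ntb : `|t *: b| = t * `|b| by rewrite normrZ gtr0_norm.
have ballr w : `|w| < t * K -> `|G (w + s) - G s - 'd G s w| <= e / K * `|w| /\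
    differentiable F (w + s).
  by move=> wr; apply: rP => /=; rewrite /ball_ /= sub0r normrN (lt_trans wr).
have na : 0 <= t * `|a| by rewrite mulr_ge0 // ltW.
have nb : 0 <= t * `|b| by rewrite mulr_ge0 // ltW.
have tKE : t * K = 3 * (t * `|a|) + 2 * (t * `|b|) + t by rewrite /K; ring.
have in1 u : 0 <= u -> u <= t -> `|u *: a + t *: b| < t * K.
  move=> u0 ut; apply: (le_lt_trans (ler_normD _ _)); rewrite ntb.
  by have := small u u0 ut; rewrite tKE; lra.
have in2 u : 0 <= u -> u <= t -> `|u *: a| < t * K.
  by move=> u0 ut; have := small u u0 ut; rewrite tKE; lra.
pose phi u := F (u *: a + (t *: b + s)) - F (u *: a + s).
have dphi u : 0 <= u -> u <= t ->
    is_derive u (1 : R) phi (G (u *: a + (t *: b + s)) - G (u *: a + s)).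
  move=> u0 ut; apply: is_deriveB; apply: is_derive_line.
    by rewrite addrA; case: (ballr _ (in1 u u0 ut)).
  by case: (ballr _ (in2 u u0 ut)).
have [||c] := @MVT R phi (fun u => G (u *: a + (t *: b + s)) - G (u *: a + s)) 0 t t0.
- by move=> u; rewrite in_itv /= => /andP[u0 ut]; apply: dphi; exact: ltW.
- apply: derivable_within_continuous => u; rewrite in_itv /= => /andP[u0 ut].
  by case: (dphi u u0 ut).
rewrite in_itv /= => /andP[/ltW c0 /ltW ct].
rewrite subr0 /phi !scale0r !add0r => eD.
have -> : F (t *: a + t *: b + s) - F (t *: a + s) - F (t *: b + s) + F s =
    (G (c *: a + (t *: b + s)) - G (c *: a + s)) * t.
  by rewrite -eD !addrA; ring.
have [n1 _] := ballr _ (in1 c c0 ct); have [n2 _] := ballr _ (in2 c c0 ct).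
have e1 : 'd G s (c *: a + t *: b) = 'd G s (c *: a) + t * 'D_b G s.
  by rewrite linearD [X in _ + X]linearZ deriveE.
rewrite e1 in n1.
set A := G (c *: a + (t *: b + s)); set B := G (c *: a + s).
rewrite -[_ + _ + s]addrA -/A in n1; rewrite -/B in n2.
have -> : (A - B) * t - t ^+ 2 * 'D_b G s = t * ((A - G s - ('d G s (c *: a) + t * 'D_b G s))
     - (B - G s - 'd G s (c *: a))) by ring.
rewrite normrM gtr0_norm // expr2 -mulrA ler_pM2l //.
apply: (le_trans (ler_normB _ _)); apply: (le_trans (lerD n1 n2)).
rewrite -mulrDr mulrAC ler_pdivrMr // [t * e]mulrC -mulrA ler_pM2l //.
have := ler_normD (c *: a) (t *: b); rewrite ntb.
by have := small c c0 ct; rewrite tKE; lra.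
Unshelve. all: by end_near. Qed.

(** Both iterated derivatives are limits of the same symmetric second difference
divided by the square of the step. *)
Lemma young (F : V -> R) (s a b : V) : (\forall x \near s, differentiable F x) ->
  differentiable ('D_a F) s -> differentiable ('D_b F) s ->
  'D_b ('D_a F) s = 'D_a ('D_b F) s.
Proof.
move=> dF dA dB; apply/eqP; rewrite -subr_eq0 -normr_le0.
apply/ler_addgt0Pr => e e0; rewrite add0r.
have e20 : 0 < e / 2 by rewrite divr_gt0.
pose Q c d : set R := [set t | `|F (t *: c + t *: d + s) - F (t *: c + s)
     - F (t *: d + s) + F s - t ^+ 2 * 'D_d ('D_c F) s| <= t ^+ 2 * (e / 2)].
have hab : (0 : R)^'+ (Q a b) := second_difference_derive b e20 dF dA.
have hba : (0 : R)^'+ (Q b a) := second_difference_derive a e20 dF dB.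
have [t [t0 [h1 h2]]] := filter_ex (filterI (nbhs_right_gt (0 : R)) (filterI hab hba)).
rewrite /Q /= in h1 h2.
have t20 : 0 < t ^+ 2 by rewrite exprn_gt0.
rewrite -(ler_pM2l t20) -{1}(gtr0_norm t20) -normrM.
rewrite [t *: b + t *: a]addrC in h2.
set X := 'D_b _ _ in h1 *; set Y := 'D_a _ _ in h2 *.
set D := F _ - F _ - F _ + F s in h1; set D' := F _ - F _ - F _ + F s in h2.
have -> : t ^+ 2 * (X - Y) = (D' - t ^+ 2 * Y) - (D - t ^+ 2 * X).
  by rewrite /D /D'; ring.
apply: (le_trans (ler_normB _ _)); apply: (le_trans (lerD h2 h1)).
by rewrite -mulrDr -splitr.
Qed.

(** The form in which symmetry is used: two first derivatives known near s. *)
Lemma young_near (F A B : V -> R) (s a b : V) (da db : R) :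
  (\forall x \near s, has_deriv F x a (A x)) ->
  (\forall x \near s, has_deriv F x b (B x)) ->
  has_deriv A s b da -> has_deriv B s a db -> da = db.
Proof.
move=> hA hB dA dB.
have eA : \forall x \near s, A x = 'D_a F x.
  by apply: filterS hA => x [].
have eB : \forall x \near s, B x = 'D_b F x.
  by apply: filterS hB => x [].
have [dA' <-] := has_deriv_near eA dA; have [dB' <-] := has_deriv_near eB dB.
by apply: young => //; apply: filterS hA => x [].
Qed.

End Young.

(** * Hypersurfaces in a coordinate patch *)

Section SmoothFacts.
Context {R : realType}.

Lemma smooth_on_differentiable (X W : normedModType R) (U : set X) (f : X -> W) x :
  smooth_on U f -> U x -> differentiable f x.
Proof. by move=> /(_ 1%N)[+ _] => /[apply]. Qed.

Lemma smooth_on_derive (X W : normedModType R) (U : set X) (f : X -> W) v :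
  smooth_on U f -> smooth_on U ('D_v f).
Proof. by move=> sf k; case: (sf k.+1) => _; apply. Qed.

Variables (n m : nat) (V : set 'rV[R]_n) (x : 'rV[R]_n -> 'rV[R]_m).
Hypotheses (oV : open V) (sx : smooth_on V x).

Lemma jacobianE s a i : V s -> 'J x s a i = 'D_(delta_mx 0 a) x s 0 i.
Proof.
move=> Vs; have dx := smooth_on_differentiable sx Vs.
by rewrite deriveEjacobian // -rowE [RHS]mxE.
Qed.

Lemma has_deriv_coord s a i : V s ->
  has_deriv (fun t => x t 0 i) s (delta_mx 0 a) ('J x s a i).
Proof.
move=> Vs; have dx := smooth_on_differentiable sx Vs.
by split; [exact: differentiable_entry|rewrite jacobianE // derive_row_coord].
Qed.

Lemma differentiable_jacobian s a i : V s ->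
  differentiable (fun t => 'J x t a i) s.
Proof.
move=> Vs.
have dDx := smooth_on_differentiable (smooth_on_derive (delta_mx 0 a) sx) Vs.
apply: differentiable_near (differentiable_entry 0 i dDx).
by apply: filterS (open_nbhs_nbhs (conj oV Vs)) => t Vt; rewrite jacobianE.
Qed.

Lemma derive_jacobianC s a b i : V s ->
  'D_(delta_mx 0 b) (fun t => 'J x t a i) s =
  'D_(delta_mx 0 a) (fun t => 'J x t b i) s.
Proof.
move=> Vs; have nV := open_nbhs_nbhs (conj oV Vs).
apply: (@young_near _ _ (fun t => x t 0 i) _ _ s (delta_mx 0 a) (delta_mx 0 b)).
- by apply: filterS nV => t; exact: has_deriv_coord.
- by apply: filterS nV => t; exact: has_deriv_coord.
- exact/has_derivP/differentiable_jacobian.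
- exact/has_derivP/differentiable_jacobian.
Qed.

End SmoothFacts.

(** The tangent space together with the normal spans everything, and a covector
that vanishes on the tangent space is determined by its value on the normal. *)
Lemma hypersurface_conormal (F : fieldType) (m : nat) (J : 'M[F]_(m, m.+1))
    (e : 'rV[F]_m.+1) (g : 'M[F]_m.+1) (c : 'cV[F]_m.+1) :
  row_free J -> g^T = g -> (e *m g *m e^T) 0 0 = 1 -> e *m g *m J^T = 0 ->
  J *m c = 0 -> c = (e *m c) 0 0 *: (g *m e^T).
Proof.
move=> fJ sg e1 eJ Jc.
have Jg : J *m (g *m e^T) = 0.
  by have := congr1 trmx eJ; rewrite !trmx_mul trmxK sg trmx0.
pose M : 'M[F]_(m + 1, m.+1) := col_mx J e.
have e1' : e *m (g *m e^T) = 1%:M by rewrite mulmxA [LHS]mx11_scalar e1.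
have fM : row_free M.
  apply: inj_row_free => v; rewrite -[v]hsubmxK mul_row_col => vM.
  have r0 : rsubmx v = 0.
    have := congr1 (mulmx^~ (g *m e^T)) vM.
    by rewrite mulmxDl -!mulmxA Jg e1' mulmx0 add0r mulmx1 mul0mx.
  rewrite r0; move: vM; rewrite r0 mul0mx addr0 => /eqP.
  rewrite -(mul0mx _ J); move/eqP/(row_free_inj fJ) => ->.
  exact: row_mx0.
have /row_fullP[B BM] : row_full M.
  by rewrite /row_full; move/eqP: fM => ->; rewrite addn1.
have Mk : M *m (c - (e *m c) 0 0 *: (g *m e^T)) = 0.
  rewrite mul_col_mx !mulmxBr -!scalemxAr Jc Jg e1' scaler0 subr0.
  rewrite scalemx1 -mx11_scalar subrr.
  exact: col_mx0.
apply/eqP; rewrite -subr_eq0; apply/eqP.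
by rewrite -[LHS]mul1mx -BM -mulmxA Mk mulmx0.
Qed.

Section LoweredChristoffel.
Context {R : realType} {m : nat}.
Implicit Types G : 'rV[R]_m -> 'M[R]_m.

(** Christoffel symbols of the first kind: for a block metric these split without
inverting the metric. *)
Definition christoffel1 G (l i j : 'I_m) (x : 'rV[R]_m) : R :=
  2^-1 * ('D_(delta_mx 0 i) (fun y => G y j l) x
     + 'D_(delta_mx 0 j) (fun y => G y i l) x
     - 'D_(delta_mx 0 l) (fun y => G y i j) x).

Lemma lower_christoffel G l i j x : G x \in unitmx ->
  \sum_k G x l k * christoffel G k i j x = christoffel1 G l i j x.
Proof.
move=> Gu.
under eq_bigr do rewrite /christoffel mulrCA mulr_sumr.
rewrite -mulr_sumr exchange_big /= /christoffel1; congr (_ * _).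
under eq_bigr => p _ do under eq_bigr do rewrite mulrA.
under eq_bigr => p _ do rewrite -mulr_suml.
rewrite (bigD1 l) //= [X in _ + X]big1 ?addr0.
  have := congr1 (fun M : 'M[R]_m => M l l) (mulmxV Gu).
  by rewrite !mxE eqxx => ->; rewrite mul1r.
move=> p pl; have := congr1 (fun M : 'M[R]_m => M l p) (mulmxV Gu).
by rewrite !mxE eq_sym (negbTE pl) => ->; rewrite mul0r.
Qed.

Variables (n : nat) (G : 'rV[R]_m -> 'M[R]_m).
Variables (x eta : 'rV[R]_n -> 'rV[R]_m).

(** The components of the covariant derivative of a field along a map. *)
Definition cov_along (s : 'rV[R]_n) (a : 'I_n) (k : 'I_m) : R :=
  'D_(delta_mx 0 a) (fun t => eta t 0 k) s
  + \sum_i \sum_j christoffel G k i j (x s) * 'J x s a i * eta s 0 j.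

Lemma lower_cov_along s a l : G (x s) \in unitmx ->
  \sum_k G (x s) l k * cov_along s a k =
  \sum_k G (x s) l k * 'D_(delta_mx 0 a) (fun t => eta t 0 k) s
  + \sum_i \sum_j christoffel1 G l i j (x s) * 'J x s a i * eta s 0 j.
Proof.
move=> Gu; under eq_bigr do rewrite mulrDr.
rewrite big_split /=; congr (_ + _).
under eq_bigr do rewrite mulr_sumr.
rewrite exchange_big; apply: eq_bigr => i _.
under eq_bigr do rewrite mulr_sumr.
rewrite exchange_big; apply: eq_bigr => j _.
by rewrite -lower_christoffel // !mulr_suml; apply: eq_bigr => k _; ring.
Qed.

Variable s : 'rV[R]_n.
Hypotheses (dG : forall i j, differentiable (fun y => G y i j) (x s))
  (sG : (G (x s))^T = G (x s)) (uG : G (x s) \in unitmx)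
  (dx : differentiable x s) (de : differentiable eta s)
  (unit_eta : \forall t \near s, (eta t *m G (x t) *m (eta t)^T) 0 0 = 1).

Let sGE i j : G (x s) i j = G (x s) j i.
Proof. by rewrite -{1}sG mxE. Qed.

Lemma metric_entry_along i j a :
  has_deriv (fun t => G (x t) i j) s (delta_mx 0 a)
    (\sum_k 'D_(delta_mx 0 k) (fun y => G y i j) (x s) * 'J x s a k).
Proof.
apply: (@has_deriv_chain _ _ _ (fun y => G y i j) x) => // k; split.
  exact: differentiable_entry.
by rewrite -derive_row_coord // deriveEjacobian // -rowE [LHS]mxE.
Qed.

(** Metric compatibility, evaluated on a field of constant length. *)
Lemma unit_cov_along a :
  \sum_l (\sum_k G (x s) l k * cov_along s a k) * eta s 0 l = 0.
Proof.
have H : has_deriv (fun t => (eta t *m G (x t) *m (eta t)^T) 0 0) s (delta_mx 0 a) 0.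
  by apply: has_deriv_near (has_deriv_cst _ _ 1); apply: filterS unit_eta => t ->.
have de' k : has_deriv (fun t => eta t 0 k) s (delta_mx 0 a)
    ('D_(delta_mx 0 a) (fun t => eta t 0 k) s).
  exact/has_derivP/differentiable_entry.
set De := fun k => 'D_(delta_mx 0 a) (fun t => eta t 0 k) s.
pose DG k l := \sum_i 'D_(delta_mx 0 i) (fun y => G y k l) (x s) * 'J x s a i.
have H2 : has_deriv (fun t => (eta t *m G (x t) *m (eta t)^T) 0 0) s (delta_mx 0 a)
   (\sum_l ((\sum_k (De k * G (x s) k l + eta s 0 k * DG k l)) * eta s 0 l
     + (\sum_k eta s 0 k * G (x s) k l) * De l)).
  have -> : (fun t => (eta t *m G (x t) *m (eta t)^T) 0 0) =
      (fun t => \sum_l (\sum_k eta t 0 k * G (x t) k l) * eta t 0 l).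
    by apply/funext => t; rewrite mxE; apply: eq_bigr => l _; rewrite !mxE.
  apply: has_deriv_sum => l _; apply: has_derivM (de' _).
  apply: has_deriv_sum => k _; apply: has_derivM (de' _) _.
  exact: metric_entry_along.
have e := has_deriv_unique H2 H; move=> {H H2}.
pose Y := \sum_l \sum_k De k * G (x s) k l * eta s 0 l.
pose X := \sum_l \sum_k eta s 0 k * DG k l * eta s 0 l.
have eX : \sum_l (\sum_i \sum_j christoffel1 G l i j (x s) * 'J x s a i * eta s 0 j)
    * eta s 0 l = 2^-1 * X.
  transitivity (2^-1 * (\sum_l \sum_i \sum_j
     ('D_(delta_mx 0 i) (fun y => G y j l) (x s) * 'J x s a i * eta s 0 j * eta s 0 l)
    + (\sum_l \sum_i \sum_j
     ('D_(delta_mx 0 j) (fun y => G y i l) (x s) * 'J x s a i * eta s 0 j * eta s 0 l)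
    - \sum_l \sum_i \sum_j
     ('D_(delta_mx 0 l) (fun y => G y i j) (x s) * 'J x s a i * eta s 0 j * eta s 0 l)))).
    rewrite -sumrB -big_split mulr_sumr; apply: eq_bigr => l _.
    rewrite -sumrB -big_split mulr_sumr mulr_suml; apply: eq_bigr => i _.
    rewrite -sumrB -big_split mulr_sumr mulr_suml; apply: eq_bigr => j _.
    by rewrite /christoffel1 /=; ring.
  have -> : \sum_l \sum_i \sum_j
     ('D_(delta_mx 0 j) (fun y => G y i l) (x s) * 'J x s a i * eta s 0 j * eta s 0 l) =
     \sum_l \sum_i \sum_j
     ('D_(delta_mx 0 l) (fun y => G y i j) (x s) * 'J x s a i * eta s 0 j * eta s 0 l).
    rewrite exchange_big [RHS]exchange_big; apply: eq_bigr => i _.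
    rewrite [LHS]exchange_big; apply: eq_bigr => j _.
    by apply: eq_bigr => l _; ring.
  rewrite subrr addr0; congr (_ * _); apply: eq_bigr => l _.
  rewrite exchange_big; apply: eq_bigr => k _; rewrite /DG mulr_sumr mulr_suml.
  by apply: eq_bigr => i _; ring.
have eY : \sum_l (\sum_k G (x s) l k * De k) * eta s 0 l = Y.
  apply: eq_bigr => l _; rewrite mulr_suml.
  by apply: eq_bigr => k _; rewrite (sGE l k); ring.
have eY' : \sum_l (\sum_k eta s 0 k * G (x s) k l) * De l = Y.
  rewrite /Y exchange_big; apply: eq_bigr => l _; rewrite mulr_suml.
  by apply: eq_bigr => k _; rewrite (sGE k l); ring.
have eL : Y + X + Y = 0.
  rewrite -[RHS]e big_split /= eY'; congr (_ + _).
  rewrite -big_split; apply: eq_bigr => l _.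
  rewrite -big_split mulr_suml; apply: eq_bigr => k _ /=; ring.
transitivity (Y + 2^-1 * X).
  rewrite -eX -eY -big_split; apply: eq_bigr => l _.
  by rewrite lower_cov_along // mulrDl.
have -> : Y + 2^-1 * X = 2^-1 * (Y + X + Y) by field.
by rewrite eL mulr0.
Qed.

End LoweredChristoffel.

(** The derivative of a unit normal is tangent, so a multiple of the induced
metric as second fundamental form determines it completely. *)
Lemma umbilic_cov_along (R : realType) (m : nat) (G : 'rV[R]_m.+1 -> 'M[R]_m.+1)
    (x eta : 'rV[R]_m -> 'rV[R]_m.+1) (s : 'rV[R]_m) (lam : R) :
  (forall i j, differentiable (fun y => G y i j) (x s)) ->
  (G (x s))^T = G (x s) -> G (x s) \in unitmx ->
  differentiable x s -> differentiable eta s -> row_free ('J x s) ->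
  (\forall t \near s, (eta t *m G (x t) *m (eta t)^T) 0 0 = 1) ->
  eta s *m G (x s) *m ('J x s)^T = 0 ->
  (\matrix_(a, k) cov_along G x eta s a k) *m G (x s) *m ('J x s)^T =
    lam *: ('J x s *m G (x s) *m ('J x s)^T) ->
  forall a k, cov_along G x eta s a k = lam * 'J x s a k.
Proof.
move=> dG sG uG dx de fJ ueta neta umb.
set C := \matrix_(a, k) _ in umb.
pose J := 'J x s; pose g := G (x s); pose e := eta s.
have e1 : (e *m g *m e^T) 0 0 = 1 by exact: nbhs_singleton ueta.
have Ce : C *m (g *m e^T) = 0.
  apply/matrixP => a z; rewrite ord1 [RHS]mxE.
  rewrite -[RHS](unit_cov_along dG sG uG dx de ueta a) mxE.
  under eq_bigr => l _ do rewrite [(g *m _) _ _]mxE mulr_sumr.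
  rewrite exchange_big; apply: eq_bigr => l _; rewrite mulr_suml.
  apply: eq_bigr => k _.
  by rewrite /e /g -{1}sG !mxE; ring.
have CJ : (C - lam *: J) *m g *m J^T = 0.
  by rewrite !mulmxBl -!scalemxAl umb subrr.
have Je : J *m (g *m e^T) = 0.
  by have := congr1 trmx neta; rewrite !trmx_mul trmxK sG trmx0.
suff Ceq : C = lam *: J.
  by move=> a k; have := congr1 (fun M : 'M[R]_(m, m.+1) => M a k) Ceq; rewrite !mxE.
apply/eqP; rewrite -subr_eq0; apply/eqP/row_matrixP => a; rewrite row0.
set c := row a _.
have cJ : J *m (g *m c^T) = 0.
  have := congr1 (fun M : 'M[R]_m => (row a M)^T) CJ.
  rewrite !row_mul -/c linear0 trmx0 => H.
  by rewrite -[RHS]H !trmx_mul trmxK sG.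
have ce : e *m (g *m c^T) = 0.
  have H : c *m (g *m e^T) = 0.
    rewrite /c -row_mul mulmxBl -scalemxAl Ce Je scaler0 subrr.
    exact: linear0.
  by have := congr1 trmx H; rewrite !trmx_mul trmxK sG trmx0 mulmxA.
have gc : g *m c^T = 0.
  by rewrite (hypersurface_conormal fJ sG e1 neta cJ) ce mxE scale0r.
have /(congr1 trmx) : c^T = 0 by rewrite -[c^T](mulKmx uG) gc mulmx0.
by rewrite trmxK trmx0.
Qed.

(** * Splitting the umbilicity equation in a warped product *)

Section WarpedMetric.
Context {R : realType} {d : nat}.
Variables (bm : 'rV[R]_2 -> 'M[R]_2) (rho : 'rV[R]_2 -> R).
Variable gam : 'rV[R]_d -> 'M[R]_d.

Definition warped_metric (x : 'rV[R]_(2 + d)) : 'M[R]_(2 + d) :=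
  block_mx (bm (lsubmx x)) 0 0 (rho (lsubmx x) ^+ 2 *: gam (rsubmx x)).

Local Notation G := warped_metric.
Implicit Types (x : 'rV[R]_(2 + d)) (A B C : 'I_2) (i j k : 'I_d).

Lemma warped_ll x A B : G x (lshift d A) (lshift d B) = bm (lsubmx x) A B.
Proof. by rewrite block_mxEul. Qed.

Lemma warped_lr x A i : G x (lshift d A) (rshift 2 i) = 0.
Proof. by rewrite block_mxEur mxE. Qed.

Lemma warped_rl x A i : G x (rshift 2 i) (lshift d A) = 0.
Proof. by rewrite block_mxEdl mxE. Qed.

Lemma warped_rr x i j :
  G x (rshift 2 i) (rshift 2 j) = rho (lsubmx x) ^+ 2 * gam (rsubmx x) i j.
Proof. by rewrite block_mxEdr mxE. Qed.

Let lsub_l A : lsubmx (delta_mx 0 (lshift d A)) = delta_mx 0 A :> 'rV[R]_2.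
Proof. by apply/rowP => B; rewrite !mxE (inj_eq (@lshift_inj _ _)). Qed.

Let rsub_l A : rsubmx (delta_mx 0 (lshift d A)) = 0 :> 'rV[R]_d.
Proof. by apply/rowP => B; rewrite !mxE eq_rlshift. Qed.

Let lsub_r i : lsubmx (delta_mx 0 (rshift 2 i)) = 0 :> 'rV[R]_2.
Proof. by apply/rowP => B; rewrite !mxE eq_lrshift. Qed.

Let rsub_r i : rsubmx (delta_mx 0 (rshift 2 i)) = delta_mx 0 i :> 'rV[R]_d.
Proof. by apply/rowP => B; rewrite !mxE (inj_eq (@rshift_inj _ _)). Qed.

Lemma derive_base_l (F : 'rV[R]_2 -> R) x A :
  'D_(delta_mx 0 (lshift d A)) (fun y => F (lsubmx y)) x
    = 'D_(delta_mx 0 A) F (lsubmx x).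
Proof. by rewrite (derive_comp_linear (@lsubmx R 1 2 d)) /= lsub_l. Qed.

Lemma derive_base_r (F : 'rV[R]_2 -> R) x i :
  'D_(delta_mx 0 (rshift 2 i)) (fun y => F (lsubmx y)) x = 0.
Proof. by rewrite (derive_comp_linear (@lsubmx R 1 2 d)) /= lsub_r derive0. Qed.

Lemma derive_fibre_l (F : 'rV[R]_d -> R) x A :
  'D_(delta_mx 0 (lshift d A)) (fun y : 'rV[R]_(2 + d) => F (rsubmx y)) x = 0.
Proof. by rewrite (derive_comp_linear (@rsubmx R 1 2 d)) /= rsub_l derive0. Qed.

Lemma derive_fibre_r (F : 'rV[R]_d -> R) x i :
  'D_(delta_mx 0 (rshift 2 i)) (fun y : 'rV[R]_(2 + d) => F (rsubmx y)) x
    = 'D_(delta_mx 0 i) F (rsubmx x).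
Proof. by rewrite (derive_comp_linear (@rsubmx R 1 2 d)) /= rsub_r. Qed.

Section AtPoint.
Variable x : 'rV[R]_(2 + d).
Hypotheses (drho : differentiable rho (lsubmx x))
  (dbm : forall A B, differentiable (fun y => bm y A B) (lsubmx x))
  (dgam : forall i j, differentiable (fun z => gam z i j) (rsubmx x)).

Let dl (F : 'rV[R]_2 -> R) : differentiable F (lsubmx x) ->
  differentiable (fun y : 'rV[R]_(2 + d) => F (lsubmx y)) x.
Proof. exact: differentiable_comp (differentiable_lsubmx _). Qed.

Let dr (F : 'rV[R]_d -> R) : differentiable F (rsubmx x) ->
  differentiable (fun y : 'rV[R]_(2 + d) => F (rsubmx y)) x.
Proof. exact: differentiable_comp (differentiable_rsubmx _). Qed.

Lemma warped_metric_differentiable p q : differentiable (fun y => G y p q) x.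
Proof.
rewrite -(fintype.splitK p) -(fintype.splitK q).
case: (fintype.split p) => A; case: (fintype.split q) => B /=.
- suff : differentiable (fun y : 'rV[R]_(2 + d) => bm (lsubmx y) A B) x.
    by congr (differentiable _ _); apply/funext => y; rewrite warped_ll.
  exact: (@dl (fun y => bm y A B)).
- suff : differentiable (fun=> 0 : R) x.
    by congr (differentiable _ _); apply/funext => y; rewrite warped_lr.
  exact: differentiable_cst.
- suff : differentiable (fun=> 0 : R) x.
    by congr (differentiable _ _); apply/funext => y; rewrite warped_rl.
  exact: differentiable_cst.
suff : differentiable (fun y => rho (lsubmx y) * rho (lsubmx y) * gam (rsubmx y) A B) x.
  by congr (differentiable _ _); apply/funext => y; rewrite warped_rr expr2.
apply: differentiableM; last exact: (@dr (fun z => gam z A B)).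
by apply: differentiableM; exact: dl.
Qed.

Let Drr_l A i j : 'D_(delta_mx 0 (lshift d A)) (fun y => G y (rshift 2 i) (rshift 2 j)) x =
  2 * rho (lsubmx x) * 'D_(delta_mx 0 A) rho (lsubmx x) * gam (rsubmx x) i j.
Proof.
under [X in derive X]funext do rewrite warped_rr expr2.
have h1 := has_derivP (delta_mx 0 (lshift d A)) (dl drho).
have h2 := has_derivP (delta_mx 0 (lshift d A)) (dr (dgam i j)).
have [_ ->] := has_derivM (has_derivM h1 h1) h2.
by rewrite derive_base_l (derive_fibre_l (fun z => gam z i j)); ring.
Qed.

Let Drr_r k i j : 'D_(delta_mx 0 (rshift 2 k)) (fun y => G y (rshift 2 i) (rshift 2 j)) x =
  rho (lsubmx x) ^+ 2 * 'D_(delta_mx 0 k) (fun z => gam z i j) (rsubmx x).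
Proof.
under [X in derive X]funext do rewrite warped_rr expr2.
have h1 := has_derivP (delta_mx 0 (rshift 2 k)) (dl drho).
have h2 := has_derivP (delta_mx 0 (rshift 2 k)) (dr (dgam i j)).
have [_ ->] := has_derivM (has_derivM h1 h1) h2.
by rewrite derive_base_r (derive_fibre_r (fun z => gam z i j)); ring.
Qed.

Let D0 v p q : (forall y, G y p q = 0) -> 'D_v (fun y => G y p q) x = 0.
Proof. by move=> G0; under [X in derive X]funext do rewrite G0; exact: derive_cst. Qed.

Let Dll_l C A B : 'D_(delta_mx 0 (lshift d C)) (fun y => G y (lshift d A) (lshift d B)) x
  = 'D_(delta_mx 0 C) (fun y => bm y A B) (lsubmx x).
Proof.
by under [X in derive X]funext do rewrite warped_ll; rewrite (derive_base_l (fun y => bm y A B)).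
Qed.

Let Dll_r k A B : 'D_(delta_mx 0 (rshift 2 k)) (fun y => G y (lshift d A) (lshift d B)) x
  = 0.
Proof.
by under [X in derive X]funext do rewrite warped_ll; rewrite (derive_base_r (fun y => bm y A B)).
Qed.

Let Dlr v A i : 'D_v (fun y => G y (lshift d A) (rshift 2 i)) x = 0.
Proof. by apply: D0 => y; rewrite warped_lr. Qed.

Let Drl v A i : 'D_v (fun y => G y (rshift 2 i) (lshift d A)) x = 0.
Proof. by apply: D0 => y; rewrite warped_rl. Qed.

Lemma christoffel1_warped_lll C A B :
  christoffel1 G (lshift d C) (lshift d A) (lshift d B) x =
  christoffel1 bm C A B (lsubmx x).
Proof. by rewrite /christoffel1 !Dll_l. Qed.

Lemma christoffel1_warped_llr C A j :
  christoffel1 G (lshift d C) (lshift d A) (rshift 2 j) x = 0.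
Proof. by rewrite /christoffel1 Drl Dll_r Dlr !(add0r, subr0) mulr0. Qed.

Lemma christoffel1_warped_lrl C A j :
  christoffel1 G (lshift d C) (rshift 2 j) (lshift d A) x = 0.
Proof. by rewrite /christoffel1 Dll_r !Drl !(add0r, subr0) mulr0. Qed.

Lemma christoffel1_warped_lrr C i j :
  christoffel1 G (lshift d C) (rshift 2 i) (rshift 2 j) x =
  - (rho (lsubmx x) * 'D_(delta_mx 0 C) rho (lsubmx x) * gam (rsubmx x) i j).
Proof. by rewrite /christoffel1 !Drl Drr_l; field. Qed.

Lemma christoffel1_warped_rll k A B :
  christoffel1 G (rshift 2 k) (lshift d A) (lshift d B) x = 0.
Proof. by rewrite /christoffel1 !Dlr Dll_r !(add0r, subr0) mulr0. Qed.

Lemma christoffel1_warped_rlr k A j :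
  christoffel1 G (rshift 2 k) (lshift d A) (rshift 2 j) x =
  rho (lsubmx x) * 'D_(delta_mx 0 A) rho (lsubmx x) * gam (rsubmx x) j k.
Proof. by rewrite /christoffel1 Drr_l !Dlr; field. Qed.

Lemma christoffel1_warped_rrl k A j :
  christoffel1 G (rshift 2 k) (rshift 2 j) (lshift d A) x =
  rho (lsubmx x) * 'D_(delta_mx 0 A) rho (lsubmx x) * gam (rsubmx x) j k.
Proof. by rewrite /christoffel1 Drr_l Dlr Drl; field. Qed.

Lemma christoffel1_warped_rrr k i j :
  christoffel1 G (rshift 2 k) (rshift 2 i) (rshift 2 j) x =
  rho (lsubmx x) ^+ 2 * christoffel1 gam k i j (rsubmx x).
Proof. by rewrite /christoffel1 !Drr_r; ring. Qed.

End AtPoint.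

Lemma warped_metric_sym x : (bm (lsubmx x))^T = bm (lsubmx x) ->
  (gam (rsubmx x))^T = gam (rsubmx x) -> (G x)^T = G x.
Proof.
by move=> sb sg; rewrite /G tr_block_mx !trmx0 sb linearZ /= sg.
Qed.

Lemma warped_metric_unit x : bm (lsubmx x) \in unitmx ->
  gam (rsubmx x) \in unitmx -> rho (lsubmx x) != 0 -> G x \in unitmx.
Proof.
move=> ub ug r0; rewrite unitmxE det_ublock unitrM -!unitmxE ub /=.
by rewrite unitmxZ // unitfE expf_neq0.
Qed.

End WarpedMetric.

Section SplitEquation.
Context {R : realType} {n d : nat}.
Variables (bm : 'rV[R]_2 -> 'M[R]_2) (rho : 'rV[R]_2 -> R).
Variable gam : 'rV[R]_d -> 'M[R]_d.
Variables (x eta : 'rV[R]_n -> 'rV[R]_(2 + d)) (lam : R) (s : 'rV[R]_n).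
Local Notation G := (warped_metric bm rho gam).
Local Notation y := (lsubmx (x s)).
Local Notation z := (rsubmx (x s)).
Hypotheses (drho : differentiable rho y)
  (dgam : forall i j, differentiable (fun z => gam z i j) z)
  (sgam : (gam z)^T = gam z)
  (ub : bm y \in unitmx) (ug : gam z \in unitmx) (r0 : rho y != 0).
Hypothesis cov : forall a k, cov_along G x eta s a k = lam * 'J x s a k.

Local Notation xi A := (eta s 0 (lshift d A)).
Local Notation ze i := (eta s 0 (rshift 2 i)).
Local Notation ya a A := ('J x s a (lshift d A)).
Local Notation za a i := ('J x s a (rshift 2 i)).
Local Notation Dxi a A := ('D_(delta_mx 0 a) (fun t => eta t 0 (lshift d A)) s).
Local Notation Dze a i := ('D_(delta_mx 0 a) (fun t => eta t 0 (rshift 2 i)) s).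
Local Notation Dr A := ('D_(delta_mx 0 A) rho y).

Let low a l : \sum_k G (x s) l k * 'D_(delta_mx 0 a) (fun t => eta t 0 k) s
  + \sum_i \sum_j christoffel1 G l i j (x s) * 'J x s a i * eta s 0 j
  = lam * \sum_k G (x s) l k * 'J x s a k.
Proof.
rewrite -lower_cov_along; last exact: warped_metric_unit.
by under eq_bigr do rewrite cov mulrCA; rewrite mulr_sumr.
Qed.

(** The base part of D eta = lam dx, with lowered index.  The last term on the left
is the second fundamental form of the fibres, which points along grad rho. *)
Lemma base_equation a C :
  \sum_B bm y C B * Dxi a B + \sum_A \sum_B christoffel1 bm C A B y * ya a A * xi B
   - rho y * Dr C * \sum_i \sum_j gam z i j * za a i * ze j
  = lam * \sum_B bm y C B * ya a B.
Proof.
have := low a (lshift d C); rewrite !big_split_ord /=.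
under [X in _ + X + _ = _]eq_bigr do rewrite warped_lr mul0r.
under [X in lam * (_ + X)]eq_bigr do rewrite warped_lr mul0r.
rewrite !sumr_const !mul0rn !addr0.
under [X in X + _ = _]eq_bigr do rewrite warped_ll.
under [X in lam * X]eq_bigr do rewrite warped_ll.
move=> <-; rewrite -addrA; congr (_ + (_ + _)).
  apply: eq_bigr => A _; rewrite big_split_ord /=.
  under eq_bigr do rewrite -(christoffel1_warped_lll bm rho gam).
  by rewrite [X in _ + X]big1 ?addr0 // => j _; rewrite christoffel1_warped_llr ?mul0r.
rewrite mulr_sumr -sumrN; apply: eq_bigr => i _; rewrite big_split_ord /=.
rewrite [X in _ = X + _]big1 ?add0r => [|B _]; last by rewrite christoffel1_warped_lrl ?mul0r.
rewrite mulr_sumr -sumrN; apply: eq_bigr => j _.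
by rewrite christoffel1_warped_lrr //; ring.
Qed.

(** The fibre part of D eta = lam dx.  The cross terms are the logarithmic
derivatives of rho along xi and along the surface; they are absorbed when eta is
rescaled by rho. *)
Lemma fibre_equation a k :
  Dze a k + \sum_i \sum_j christoffel gam k i j z * za a i * ze j =
  (lam - (\sum_A Dr A * xi A) / rho y) * za a k
   - (\sum_A Dr A * ya a A) / rho y * ze k.
Proof.
pose W k := Dze a k + \sum_i \sum_j christoffel gam k i j z * za a i * ze j
  - (lam * za a k - (\sum_A Dr A * xi A) / rho y * za a k
   - (\sum_A Dr A * ya a A) / rho y * ze k).
(* The equation comes with a lowered index, so it is shown for all k at once and
   the fibre metric is inverted. *)
suff W0 : W k = 0 by apply/eqP; rewrite mulrBl -subr_eq0 -[_ - _]/(W k) W0.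
pose Wc : 'cV[R]_d := \col_k W k.
suff gW : gam z *m Wc = 0.
  have : Wc = 0 by rewrite -[Wc](mulKmx ug) gW mulmx0.
  by move/(congr1 (fun M : 'cV[R]_d => M k 0)); rewrite !mxE.
apply/matrixP => l o; rewrite !mxE.
under eq_bigr do rewrite mxE.
have r20 : rho y ^+ 2 != 0 by rewrite expf_neq0.
apply: (mulfI r20); rewrite mulr0.
have := low a (rshift 2 l); rewrite !big_split_ord /=.
under [X in X + _ + _ = _]eq_bigr do rewrite warped_rl mul0r.
under [X in lam * (X + _)]eq_bigr do rewrite warped_rl mul0r.
rewrite !sumr_const !mul0rn !add0r.
under [X in X + _ = _]eq_bigr do rewrite warped_rr -mulrA.
under [X in lam * X]eq_bigr do rewrite warped_rr -mulrA.
rewrite -!mulr_sumr.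
have -> : \sum_A \sum_j christoffel1 G (rshift 2 l) (lshift d A) j (x s) * ya a A * eta s 0 j
  = rho y * (\sum_A Dr A * ya a A) * \sum_j gam z l j * ze j.
  rewrite [rho y * _]mulr_sumr mulr_suml; apply: eq_bigr => A _; rewrite big_split_ord /=.
  rewrite big1 ?add0r => [|B _]; last by rewrite christoffel1_warped_rll ?mul0r.
  rewrite mulr_sumr; apply: eq_bigr => j _.
  by rewrite christoffel1_warped_rlr // -{1}sgam mxE; ring.
have -> : \sum_i \sum_j christoffel1 G (rshift 2 l) (rshift 2 i) j (x s) * za a i * eta s 0 j
  = rho y * (\sum_A Dr A * xi A) * (\sum_j gam z l j * za a j)
  + rho y ^+ 2 * \sum_k gam z l k * \sum_i \sum_j christoffel gam k i j z * za a i * ze j.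
  have -> : \sum_k gam z l k * \sum_i \sum_j christoffel gam k i j z * za a i * ze j =
      \sum_i \sum_j christoffel1 gam l i j z * za a i * ze j.
    under eq_bigr do rewrite mulr_sumr.
    rewrite exchange_big; apply: eq_bigr => i _.
    under eq_bigr do rewrite mulr_sumr.
    rewrite exchange_big; apply: eq_bigr => j _.
    by rewrite -lower_christoffel // !mulr_suml; apply: eq_bigr => p _; ring.
  rewrite !mulr_sumr -big_split; apply: eq_bigr => i _; rewrite big_split_ord /=.
  congr (_ + _).
    rewrite mulr_suml; apply: eq_bigr => A _.
    by rewrite christoffel1_warped_rrl // -{1}sgam mxE; ring.
  rewrite mulr_sumr; apply: eq_bigr => j _.
  by rewrite christoffel1_warped_rrr //; ring.
set P1 := \sum_A Dr A * ya a A; set P2 := \sum_A Dr A * xi A; set Gz := \sum_j gam z l j * za a j.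
set Ge := \sum_j gam z l j * ze j; set Gd := \sum_i gam z l i * Dze a i.
set Gc := \sum_k gam z l k * _ => e.
have -> : \sum_j gam z l j * W j = Gd + Gc - (lam * Gz - P2 / rho y * Gz - P1 / rho y * Ge).
  rewrite /Gd /Gc /Gz /Ge !mulr_sumr -!sumrB -big_split -sumrB.
by apply: eq_bigr => j _; rewrite /W -/P1 -/P2 /=; ring.
move/eqP: e; rewrite -subr_eq0 => /eqP e; rewrite -[RHS]e.
by field.
Qed.

End SplitEquation.

(** * Integrability conditions *)

Section ScalarIntegrability.
Context {R : realType} {n : nat}.
Variables (h : R -> R) (lam : R) (r p m : 'rV[R]_n -> R).
Variables (lp lm th : 'I_n -> 'rV[R]_n -> R) (s : 'rV[R]_n).
Local Notation "'h1'" := (derive1 h).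
Hypotheses (dh : derivable h (r s) 1) (dh1 : derivable h1 (r s) 1).
Hypothesis hr : forall a, has_deriv r s (delta_mx 0 a) (h (r s) / 2 * (lp a s + lm a s)).
Hypothesis tangent : forall a,
  h (r s) / 2 * (p s * lm a s + m s * lp a s) = - r s * th a s.

(** Commuting the derivatives of the null component p leaves h'' p times the
wedge of dr and lp, and h' times the wedge of th and lp; the tangency relation turns
the first into a multiple of the second. *)
Lemma null_component_integrability a b :
  (forall a, \forall t \near s, has_deriv p t (delta_mx 0 a)
    ((lam - h1 (r t) * p t / 2) * lp a t + th a t)) ->
  (forall a, differentiable (lp a) s) -> (forall a, differentiable (th a) s) ->
  (forall a b, 'D_(delta_mx 0 b) (lp a) s = 'D_(delta_mx 0 a) (lp b) s) ->
  (forall a b, 'D_(delta_mx 0 b) (th a) s = 'D_(delta_mx 0 a) (th b) s) ->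
  (r s * derive1 h1 (r s) - h1 (r s)) * (th b s * lp a s - th a s * lp b s) = 0.
Proof.
move=> hp dlp dth clp cth.
have second a' b' : has_deriv
    (fun t => (lam - h1 (r t) * p t / 2) * lp a' t + th a' t) s (delta_mx 0 b')
    ((0 - ((derive1 h1 (r s) * (h (r s) / 2 * (lp b' s + lm b' s))) * p s
       + h1 (r s) * ((lam - h1 (r s) * p s / 2) * lp b' s + th b' s)) / 2) * lp a' s
     + (lam - h1 (r s) * p s / 2) * 'D_(delta_mx 0 b') (lp a') s
     + 'D_(delta_mx 0 b') (th a') s).
  apply: has_derivD; last exact: has_derivP.
  apply: has_derivM; last exact: has_derivP.
  apply: has_derivB; first exact: has_deriv_cst.
  have -> : (fun t => h1 (r t) * p t / 2) = (fun t => 2^-1 * (h1 (r t) * p t)).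
    by apply/funext => t; rewrite mulrC.
  rewrite [X in has_deriv _ _ _ X]mulrC; apply: has_derivZ.
  apply: has_derivM; first exact: has_deriv_comp1.
  exact: nbhs_singleton (hp b').
have := young_near (hp a) (hp b) (second a b) (second b a).
rewrite (clp a b) (cth a b) => e.
move: e (tangent a) (tangent b).
move: (r s) (p s) (m s) (lp a s) (lp b s) (lm a s) (lm b s) (th a s) (th b s)
  ('D_(delta_mx 0 a) (lp b) s : R) ('D_(delta_mx 0 a) (th b) s : R)
  (derive1 h1 (r s) : R) (h1 (r s) : R) (h (r s))
  => r0 p0 m0 pa pb ma mb ta tb dl dt h'' h' hr0.
move=> e /(congr1 (fun x => h'' * pb * x)) ea /(congr1 (fun x => h'' * pa * x)) eb.
rewrite /= in ea eb; lra.
Qed.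

(** The function f = lam r - drho(xi) varies only along the fibre part of the
normal, by the factor rho h'/2 - h. *)
Lemma has_deriv_fibre_factor a :
  has_deriv p s (delta_mx 0 a) ((lam - h1 (r s) * p s / 2) * lp a s + th a s) ->
  has_deriv m s (delta_mx 0 a) ((lam - h1 (r s) * m s / 2) * lm a s + th a s) ->
  has_deriv (fun t => lam * r t - h (r t) / 2 * (p t + m t)) s (delta_mx 0 a)
    ((r s * h1 (r s) / 2 - h (r s)) * th a s).
Proof.
move=> hp hm.
have H : has_deriv (fun t => lam * r t - 2^-1 * h (r t) * (p t + m t)) s (delta_mx 0 a)
   (lam * (h (r s) / 2 * (lp a s + lm a s))
    - ((2^-1 * (h1 (r s) * (h (r s) / 2 * (lp a s + lm a s)))) * (p s + m s)
      + 2^-1 * h (r s) * (((lam - h1 (r s) * p s / 2) * lp a s + th a s)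
      + ((lam - h1 (r s) * m s / 2) * lm a s + th a s)))).
  apply: has_derivB; first exact: has_derivZ.
  apply: has_derivM; last exact: has_derivD.
  by apply: has_derivZ; apply: has_deriv_comp1.
have -> : (fun t => lam * r t - h (r t) / 2 * (p t + m t)) =
    (fun t => lam * r t - 2^-1 * h (r t) * (p t + m t)).
  by apply/funext => t; rewrite [h _ / 2]mulrC.
apply: has_deriv_eq H _; move: (tangent a).
move: (r s) (p s) (m s) (lp a s) (lm a s) (th a s) (h1 (r s) : R) (h (r s))
  => r0 p0 m0 pa ma ta h' hr0.
move=> /(congr1 (fun x => h' * x)) /= ea; lra.
Qed.

End ScalarIntegrability.

Section FibreIntegrability.
Context {R : realType} {n d : nat}.
Variables (gam : 'rV[R]_d -> 'M[R]_d) (dN : set 'rV[R]_d).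
Variables (z : 'rV[R]_n -> 'rV[R]_d).
Variables (za : 'I_n -> 'I_d -> 'rV[R]_n -> R) (om : 'I_d -> 'rV[R]_n -> R).
Variables (f : 'rV[R]_n -> R) (s : 'rV[R]_n) (kap : R).
Local Notation Gm := (christoffel gam).
Local Notation e_ i := (delta_mx 0 i).
Hypotheses (hz : forall a i, has_deriv (fun t => z t 0 i) s (e_ a) (za a i s))
  (dza : forall a i, differentiable (za a i) s)
  (cza : forall a b i, 'D_(e_ b) (za a i) s = 'D_(e_ a) (za b i) s)
  (oN : open dN) (zN : dN (z s)) (gam_symN : forall w, dN w -> (gam w)^T = gam w)
  (ugam : gam (z s) \in unitmx)
  (dgam : forall i j, differentiable (fun w => gam w i j) (z s)).
Hypothesis hom : forall a k, \forall t \near s, has_deriv (om k) t (e_ a)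
  (f t * za a k t - \sum_i \sum_j Gm k i j (z t) * za a i t * om j t).

Let hom_s a k := nbhs_singleton (hom a k).

Let Dgam_sym w l i j : dN w -> 'D_(e_ l) (fun w => gam w i j) w =
  'D_(e_ l) (fun w => gam w j i) w.
Proof.
move=> Nw; apply: near_eq_derive.
apply: filterS (open_nbhs_nbhs (conj oN Nw)) => w' Nw'.
by rewrite -{1}(gam_symN Nw') mxE.
Qed.

(** The one-form dual to om, pulled back to the hypersurface. *)
Definition fibre_form a t := \sum_i \sum_j gam (z t) i j * za a i t * om j t.

Let hza a b i : has_deriv (za a i) s (e_ b) ('D_(e_ b) (za a i) s).
Proof. exact: has_derivP. Qed.

Let has_deriv_form a b : has_deriv (fibre_form a) s (e_ b)
  (\sum_i \sum_j
    (((\sum_l 'D_(e_ l) (fun w => gam w i j) (z s) * za b l s) * za a i s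
     + gam (z s) i j * 'D_(e_ b) (za a i) s) * om j s
    + gam (z s) i j * za a i s *
      (f s * za b j s - \sum_p \sum_q Gm j p q (z s) * za b p s * om q s))).
Proof.
apply: has_deriv_sum => i _; apply: has_deriv_sum => j _.
apply: has_derivM (hom_s b j); apply: has_derivM (hza a b i).
by apply: (@has_deriv_chain _ _ _ (fun w => gam w i j) z).
Qed.

Lemma differentiable_fibre_form a : differentiable (fibre_form a) s.
Proof. by have [] := has_deriv_form a a. Qed.

Let gam_symE i j : gam (z s) i j = gam (z s) j i.
Proof. by rewrite -{1}(gam_symN zN) mxE. Qed.

(** The form dual to om is closed along the hypersurface: its differential is
the antisymmetric part of the covariant derivative of om, which is a multiple
of the identity. *)
Lemma derive_fibre_formC a b :
  'D_(e_ b) (fibre_form a) s = 'D_(e_ a) (fibre_form b) s.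
Proof.
have [_ ->] := has_deriv_form a b; have [_ ->] := has_deriv_form b a.
pose D l i j := 'D_(e_ l) (fun w => gam w i j) (z s).
have split_form u v : \sum_i \sum_j
    (((\sum_l D l i j * za v l s) * za u i s
     + gam (z s) i j * 'D_(e_ v) (za u i) s) * om j s
    + gam (z s) i j * za u i s *
      (f s * za v j s - \sum_p \sum_q Gm j p q (z s) * za v p s * om q s))
  = \sum_i \sum_l \sum_j D l i j * za v l s * za u i s * om j s
   + \sum_i \sum_j gam (z s) i j * 'D_(e_ v) (za u i) s * om j s
   + f s * \sum_i \sum_j gam (z s) i j * za u i s * za v j s
   - \sum_i \sum_l \sum_j christoffel1 gam i l j (z s) * za v l s * za u i s * om j s.
  rewrite mulr_sumr -!big_split -sumrB; apply: eq_bigr => i _ /=.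
  have -> : \sum_l \sum_j christoffel1 gam i l j (z s) * za v l s * za u i s * om j s =
     \sum_j gam (z s) i j * za u i s *
       \sum_p \sum_q Gm j p q (z s) * za v p s * om q s.
    under [RHS]eq_bigr do rewrite mulr_sumr.
    rewrite [RHS]exchange_big; apply: eq_bigr => p _ /=.
    under [RHS]eq_bigr do rewrite mulr_sumr.
    rewrite [RHS]exchange_big; apply: eq_bigr => q _ /=.
    by rewrite -lower_christoffel // !mulr_suml; apply: eq_bigr => j _; ring.
  rewrite mulr_sumr exchange_big -!big_split -sumrB; apply: eq_bigr => j _ /=.
  have -> : \sum_l D l i j * za v l s * za u i s * om j s =
     (\sum_l D l i j * za v l s) * za u i s * om j s by rewrite !mulr_suml.
  by ring.
rewrite !split_form.
have -> : \sum_i \sum_j gam (z s) i j * 'D_(e_ b) (za a i) s * om j s =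
   \sum_i \sum_j gam (z s) i j * 'D_(e_ a) (za b i) s * om j s.
  by apply: eq_bigr => i _; apply: eq_bigr => j _; rewrite cza.
have -> : \sum_i \sum_j gam (z s) i j * za a i s * za b j s =
   \sum_i \sum_j gam (z s) i j * za b i s * za a j s.
  rewrite exchange_big; apply: eq_bigr => i _; apply: eq_bigr => j _.
  by rewrite gam_symE; ring.
suff e : \sum_i \sum_l \sum_j D l i j * za b l s * za a i s * om j s
   - \sum_i \sum_l \sum_j christoffel1 gam i l j (z s) * za b l s * za a i s * om j s
  = \sum_i \sum_l \sum_j D l i j * za a l s * za b i s * om j s
   - \sum_i \sum_l \sum_j christoffel1 gam i l j (z s) * za a l s * za b i s * om j s.
  by lra.
have merge (X Y : 'I_d -> 'I_d -> 'I_d -> R) :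
    \sum_i \sum_l \sum_j X i l j - \sum_i \sum_l \sum_j Y i l j =
    \sum_i \sum_l \sum_j (X i l j - Y i l j).
  rewrite -sumrB; apply: eq_bigr => i _; rewrite -sumrB; apply: eq_bigr => l _.
  by rewrite -sumrB.
rewrite !merge exchange_big; apply: eq_bigr => i _; apply: eq_bigr => l _.
apply: eq_bigr => j _; rewrite /christoffel1 /D.
by rewrite (Dgam_sym i j l zN) (Dgam_sym l j i zN) (Dgam_sym j l i zN); field.
Qed.

Hypothesis dGm : forall k i j, differentiable (Gm k i j) (z s).
Hypothesis hf : forall a, has_deriv f s (e_ a) ('D_(e_ a) f s).

Let christoffel_sym k i j w : dN w -> Gm k i j w = Gm k j i w.
Proof.
move=> Nw; rewrite /christoffel; congr (_ * _); apply: eq_bigr => l _.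
by rewrite (Dgam_sym l i j Nw); ring.
Qed.

Let Dchristoffel_sym l k i j : 'D_(e_ l) (Gm k i j) (z s) = 'D_(e_ l) (Gm k j i) (z s).
Proof.
apply: near_eq_derive; apply: filterS (open_nbhs_nbhs (conj oN zN)) => w.
exact: christoffel_sym.
Qed.

(** The curvature tensor, as the obstruction to commuting second derivatives of
a field along a map. *)
Definition riemann k j l i := 'D_(e_ l) (Gm k i j) (z s) - 'D_(e_ i) (Gm k l j) (z s)
  + \sum_p (Gm k l p (z s) * Gm p i j (z s) - Gm k i p (z s) * Gm p l j (z s)).

Lemma riemann_along a b k :
  \sum_l \sum_i \sum_j riemann k j l i * za b l s * za a i s * om j s =
  'D_(e_ b) f s * za a k s - 'D_(e_ a) f s * za b k s.
Proof.
(* The equation for om, differentiated once more; symmetry in u and v of the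
   result is the claim. *)
have second u v : has_deriv
    (fun t => f t * za u k t - \sum_i \sum_j Gm k i j (z t) * za u i t * om j t) s (e_ v)
    ('D_(e_ v) f s * za u k s + f s * 'D_(e_ v) (za u k) s - \sum_i \sum_j
    (((\sum_l 'D_(e_ l) (Gm k i j) (z s) * za v l s) * za u i s
     + Gm k i j (z s) * 'D_(e_ v) (za u i) s) * om j s
    + Gm k i j (z s) * za u i s *
      (f s * za v j s - \sum_p \sum_q Gm j p q (z s) * za v p s * om q s))).
  apply: has_derivB; first exact: has_derivM.
  apply: has_deriv_sum => i _; apply: has_deriv_sum => j _.
  apply: has_derivM (hom_s v j); apply: has_derivM (hza u v i).
  by apply: (@has_deriv_chain _ _ _ (Gm k i j) z).
have := young_near (hom a k) (hom b k) (second a b) (second b a).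
pose D l i j := 'D_(e_ l) (Gm k i j) (z s).
pose Q i l j := \sum_p Gm k i p (z s) * Gm p l j (z s).
have split_form u v : \sum_i \sum_j
    (((\sum_l D l i j * za v l s) * za u i s
     + Gm k i j (z s) * 'D_(e_ v) (za u i) s) * om j s
    + Gm k i j (z s) * za u i s *
      (f s * za v j s - \sum_p \sum_q Gm j p q (z s) * za v p s * om q s))
  = \sum_i \sum_l \sum_j D l i j * za v l s * za u i s * om j s
   + \sum_i \sum_j Gm k i j (z s) * 'D_(e_ v) (za u i) s * om j s
   + f s * \sum_i \sum_j Gm k i j (z s) * za u i s * za v j s
   - \sum_i \sum_l \sum_j Q i l j * za v l s * za u i s * om j s.
  rewrite mulr_sumr -!big_split -sumrB; apply: eq_bigr => i _ /=.
  have -> : \sum_l \sum_j Q i l j * za v l s * za u i s * om j s =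
     \sum_j Gm k i j (z s) * za u i s *
       \sum_p \sum_q Gm j p q (z s) * za v p s * om q s.
    under [RHS]eq_bigr do rewrite mulr_sumr.
    rewrite [RHS]exchange_big; apply: eq_bigr => p _ /=.
    under [RHS]eq_bigr do rewrite mulr_sumr.
    rewrite [RHS]exchange_big; apply: eq_bigr => q _ /=.
    by rewrite /Q !mulr_suml; apply: eq_bigr => j _; ring.
  rewrite mulr_sumr exchange_big -!big_split -sumrB; apply: eq_bigr => j _ /=.
  have -> : \sum_l D l i j * za v l s * za u i s * om j s =
     (\sum_l D l i j * za v l s) * za u i s * om j s by rewrite !mulr_suml.
  by ring.
rewrite !split_form.
have -> : \sum_i \sum_j Gm k i j (z s) * 'D_(e_ b) (za a i) s * om j s =
   \sum_i \sum_j Gm k i j (z s) * 'D_(e_ a) (za b i) s * om j s.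
  by apply: eq_bigr => i _; apply: eq_bigr => j _; rewrite cza.
have -> : \sum_i \sum_j Gm k i j (z s) * za a i s * za b j s =
   \sum_i \sum_j Gm k i j (z s) * za b i s * za a j s.
  rewrite exchange_big; apply: eq_bigr => i _; apply: eq_bigr => j _.
  by rewrite (christoffel_sym k i j zN); ring.
rewrite (cza a b k) => e.
have -> : \sum_l \sum_i \sum_j riemann k j l i * za b l s * za a i s * om j s =
   (\sum_i \sum_l \sum_j D l i j * za b l s * za a i s * om j s
    - \sum_i \sum_l \sum_j Q i l j * za b l s * za a i s * om j s)
   - (\sum_i \sum_l \sum_j D l i j * za a l s * za b i s * om j s
    - \sum_i \sum_l \sum_j Q i l j * za a l s * za b i s * om j s).
  have merge (X Y : 'I_d -> 'I_d -> 'I_d -> R) :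
      \sum_i \sum_l \sum_j X i l j - \sum_i \sum_l \sum_j Y i l j =
      \sum_i \sum_l \sum_j (X i l j - Y i l j).
    rewrite -sumrB; apply: eq_bigr => i _; rewrite -sumrB; apply: eq_bigr => l _.
    by rewrite -sumrB.
  rewrite 2!merge [X in _ - X]exchange_big merge exchange_big.
  apply: eq_bigr => i _; apply: eq_bigr => l _; apply: eq_bigr => j _.
  have -> : riemann k j l i = D l i j - D i l j + (Q l i j - Q i l j).
    by rewrite /riemann sumrB.
  by move: (D l i j) (D i l j) (Q l i j) (Q i l j) => u v u1 v1; ring.
by lra.
Qed.

Hypothesis f_along : forall a, 'D_(e_ a) f s = kap * fibre_form a s.
Variable Y : 'I_d -> 'I_n -> R.
Hypothesis span : forall p i, \sum_a Y p a * za a i s = (p == i)%:R.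

(** Where the hypersurface projects onto the fibre, the curvature identity holds
for all fibre directions, and its trace is the Ricci curvature in the direction
of the field. *)
Lemma ricci_along :
  \sum_j \sum_k om j s * ricci gam (z s) j k * om k s =
  (1 - d%:R) * kap * \sum_i \sum_j gam (z s) i j * om i s * om j s.
Proof.
pose th i := \sum_j gam (z s) i j * om j s.
have full k p q : \sum_j riemann k j p q * om j s =
    kap * (th p * (q == k)%:R - th q * (p == k)%:R).
  have formE a : fibre_form a s = \sum_i za a i s * th i.
    apply: eq_bigr => i _; rewrite /th mulr_sumr; apply: eq_bigr => j _; ring.
  have sp i (W : 'I_d -> R) : \sum_a Y i a * \sum_l za a l s * W l = W i.
    under eq_bigr do rewrite mulr_sumr.
    rewrite exchange_big /= (bigD1 i) //= [X in _ + X]big1 ?addr0.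
      under eq_bigr do rewrite mulrA; rewrite -mulr_suml span eqxx mul1r //.
    move=> l li; under eq_bigr do rewrite mulrA; rewrite -mulr_suml span.
    by rewrite eq_sym (negbTE li) mul0r.
  have eS b a : \sum_i za a i s * (\sum_l za b l s * \sum_j riemann k j l i * om j s) =
      kap * (fibre_form b s * za a k s - fibre_form a s * za b k s).
    rewrite mulrBr !mulrA -!f_along -riemann_along exchange_big; apply: eq_bigr => i _ /=.
    rewrite mulr_sumr; apply: eq_bigr => l _; rewrite !mulr_sumr.
    by apply: eq_bigr => j _; ring.
  have spf i : \sum_a Y i a * fibre_form a s = th i.
    by rewrite -[RHS]sp; apply: eq_bigr => a _; rewrite formE.
  rewrite -[LHS](sp p (fun l => \sum_j riemann k j l q * om j s)).
  transitivity (\sum_b Y p b * \sum_a Y q a *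
      (kap * (fibre_form b s * za a k s - fibre_form a s * za b k s))).
    apply: eq_bigr => b _; congr (_ * _).
    by under [RHS]eq_bigr do rewrite -eS; rewrite sp.
  rewrite -(spf p) -(spf q) -!span.
  under eq_bigr => b _.
    have -> : \sum_a Y q a * (kap * (fibre_form b s * za a k s - fibre_form a s * za b k s)) =
       kap * (fibre_form b s * (\sum_a Y q a * za a k s)
              - (\sum_a Y q a * fibre_form a s) * za b k s).
      rewrite mulr_suml mulr_sumr -sumrB mulr_sumr.
      by apply: eq_bigr => a _; ring.
    over.
  move: (\sum_a Y q a * za a k s) (\sum_a Y q a * fibre_form a s) => u v.
  rewrite !mulr_suml mulr_sumr -sumrB mulr_sumr.
  by apply: eq_bigr => b _; ring.
pose th_om := \sum_i \sum_j gam (z s) i j * om i s * om j s.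
have thE : \sum_i th i * om i s = th_om.
  by apply: eq_bigr => i _; rewrite mulr_suml; apply: eq_bigr => j _; ring.
rewrite -/th_om.
transitivity (\sum_l \sum_k om k s * \sum_j riemann l j l k * om j s).
  under [RHS]eq_bigr do under eq_bigr do rewrite mulr_sumr.
  rewrite [RHS]exchange_big [LHS]exchange_big; apply: eq_bigr => k _ /=.
  rewrite [RHS]exchange_big; apply: eq_bigr => j _ /=.
  rewrite /ricci mxE -big_split mulr_sumr mulr_suml; apply: eq_bigr => l _ /=.
  rewrite /riemann (Dchristoffel_sym l l j k) (Dchristoffel_sym k l j l).
  under [in LHS]eq_bigr do
    rewrite (christoffel_sym _ j k zN) (christoffel_sym _ j l zN).
  by rewrite -mulrA mulrCA [RHS]mulrCA [om j s * _]mulrC.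
transitivity (\sum_l (kap * (th l * om l s) - kap * th_om)).
  apply: eq_bigr => l _; under eq_bigr do rewrite full.
  rewrite -thE mulr_sumr -[X in X - _](_ : \sum_k kap * th l * om k s * (k == l)%:R = _).
    by rewrite -sumrB; apply: eq_bigr => k _; rewrite [l == l]eqxx mulr1n; ring.
  rewrite (bigD1 l) //= big1 ?addr0 ?eqxx ?mulr1n; first by ring.
  by move=> k /negbTE ->; rewrite mulr0n mulr0.
rewrite sumrB -mulr_sumr thE sumr_const card_ord -mulr_natl; ring.
Qed.

End FibreIntegrability.

(** * Null coframes *)

Lemma sum_ord2 (V : nmodType) (F : 'I_2 -> V) : \sum_(i < 2) F i = F 0 + F 1.
Proof.
rewrite !big_ord_recl big_ord0 addr0; congr (_ + F _).
exact: val_inj.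
Qed.

Section NullCoframe.
Context {R : realType}.
Variables (h : R -> R) (bm : 'rV[R]_2 -> 'M[R]_2) (rho : 'rV[R]_2 -> R).

(** A closed coframe in which the base metric is off-diagonal: the differentials
of two null coordinates.  For -h dt^2 + dr^2/h these are dr/h + dt, dr/h - dt. *)
Record null_coframe (U : set 'rV[R]_2) (P M : 'I_2 -> 'rV[R]_2 -> R) : Prop :=
  NullCoframe {
  nc_open : open U;
  nc_diffP : forall A y, U y -> differentiable (P A) y;
  nc_diffM : forall A y, U y -> differentiable (M A) y;
  nc_closedP : forall A B y, U y ->
    'D_(delta_mx 0 A) (P B) y = 'D_(delta_mx 0 B) (P A) y;
  nc_closedM : forall A B y, U y ->
    'D_(delta_mx 0 A) (M B) y = 'D_(delta_mx 0 B) (M A) y;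
  nc_indep : forall y, U y -> P 0 y * M 1 y - P 1 y * M 0 y != 0;
  nc_metric : forall A B y, U y ->
    bm y A B = h (rho y) / 2 * (P A y * M B y + M A y * P B y);
  nc_rho : forall A y, U y ->
    has_deriv rho y (delta_mx 0 A) (h (rho y) / 2 * (P A y + M A y));
  nc_h : forall y, U y -> h (rho y) != 0 /\ derivable h (rho y) 1 }.

(** What is shown for one null component thus holds for the other. *)
Lemma null_coframe_swap U P M : null_coframe U P M -> null_coframe U M P.
Proof.
case=> oU dP dM cP cM ind met hr hh; split=> //.
- move=> y Uy; have -> : M 0 y * P 1 y - M 1 y * P 0 y =
    - (P 0 y * M 1 y - P 1 y * M 0 y) by ring.
  by rewrite oppr_eq0 ind.
- by move=> A B y Uy; rewrite met // addrC.
- by move=> A y Uy; rewrite [M A y + _]addrC; exact: hr.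
Qed.

Section Component.
Variables (U : set 'rV[R]_2) (P M : 'I_2 -> 'rV[R]_2 -> R).
Hypothesis frame : null_coframe U P M.
Local Notation e_ i := (delta_mx 0 i).

Let has_deriv_metric y A B C : U y -> has_deriv (fun y => bm y A B) y (e_ C)
  ((derive1 h (rho y) * (h (rho y) / 2 * (P C y + M C y)) * 2^-1)
     * (P A y * M B y + M A y * P B y)
   + h (rho y) / 2 * (('D_(e_ C) (P A) y * M B y + P A y * 'D_(e_ C) (M B) y)
     + ('D_(e_ C) (M A) y * P B y + M A y * 'D_(e_ C) (P B) y))).
Proof.
move=> Uy; have [_ dh] := nc_h frame Uy.
have H : has_deriv (fun y => h (rho y) * 2^-1 * (P A y * M B y + M A y * P B y)) y (e_ C)
  ((derive1 h (rho y) * (h (rho y) / 2 * (P C y + M C y)) * 2^-1 + h (rho y) * 0)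
     * (P A y * M B y + M A y * P B y)
   + h (rho y) / 2 * (('D_(e_ C) (P A) y * M B y + P A y * 'D_(e_ C) (M B) y)
     + ('D_(e_ C) (M A) y * P B y + M A y * 'D_(e_ C) (P B) y))).
  have hP A' := has_derivP (e_ C) (nc_diffP frame A' Uy).
  have hM A' := has_derivP (e_ C) (nc_diffM frame A' Uy).
  apply: has_derivM; last by apply: has_derivD; exact: has_derivM.
  apply: has_derivM; last exact: has_deriv_cst.
  exact: has_deriv_comp1 (nc_rho frame C Uy).
rewrite mulr0 addr0 in H; apply: has_deriv_near H.
apply: filterS (open_nbhs_nbhs (conj (nc_open frame) Uy)) => w Uw.
by rewrite (nc_metric frame).
Qed.

Lemma nc_diff_metric y A B : U y -> differentiable (fun y => bm y A B) y.
Proof. by move=> Uy; have [] := has_deriv_metric A B 0 Uy. Qed.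

Let christoffel1_null y C A B : U y -> christoffel1 bm C A B y =
  h (rho y) / 2 *
   ((derive1 h (rho y) / 2 * P A y * P B y + 'D_(e_ A) (P B) y) * M C y
   + (derive1 h (rho y) / 2 * M A y * M B y + 'D_(e_ A) (M B) y) * P C y).
Proof.
move=> Uy; rewrite /christoffel1.
have [_ ->] := has_deriv_metric B C A Uy.
have [_ ->] := has_deriv_metric A C B Uy.
have [_ ->] := has_deriv_metric A B C Uy.
rewrite (nc_closedP frame B A Uy) (nc_closedP frame C A Uy) (nc_closedP frame C B Uy).
rewrite (nc_closedM frame B A Uy) (nc_closedM frame C A Uy) (nc_closedM frame C B Uy).
by field.
Qed.

(** In a null coframe the lowered base equation decouples into one equation for
each null component. *)
Lemma null_component_equation y (ya xi dxi : 'I_2 -> R) (lam S : R) : U y ->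
  (forall C, \sum_B bm y C B * dxi B
    + \sum_A \sum_B christoffel1 bm C A B y * ya A * xi B
    - rho y * 'D_(e_ C) rho y * S = lam * \sum_B bm y C B * ya B) ->
  \sum_A ((\sum_B 'D_(e_ B) (P A) y * ya B) * xi A + P A y * dxi A) =
  (lam - derive1 h (rho y) * (\sum_A P A y * xi A) / 2) * (\sum_A P A y * ya A)
    + rho y * S.
Proof.
move=> Uy base; have [h0 _] := nc_h frame Uy; have ind := nc_indep frame Uy.
pose eqn (Q : 'I_2 -> 'rV[R]_2 -> R) :=
  \sum_A ((\sum_B 'D_(e_ B) (Q A) y * ya B) * xi A + Q A y * dxi A) -
  ((lam - derive1 h (rho y) * (\sum_A Q A y * xi A) / 2) * (\sum_A Q A y * ya A)
    + rho y * S).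
have comb C : M C y * eqn P + P C y * eqn M = 0.
  apply: (mulfI h0); rewrite mulr0.
  have := base C; rewrite /eqn !sum_ord2 !christoffel1_null //.
  have [_ ->] := nc_rho frame C Uy; rewrite !(nc_metric frame) //.
  rewrite (nc_closedP frame 1 0 Uy) (nc_closedM frame 1 0 Uy).
  by move=> e; lra.
apply/eqP; rewrite -subr_eq0 -[X in X == 0]/(eqn P); apply/eqP.
apply: (mulfI ind); rewrite mulr0.
have := comb 0; have := comb 1; move: (eqn P) (eqn M) => u v c1 c0.
have -> : (P 0 y * M 1 y - P 1 y * M 0 y) * u =
   P 0 y * (M 1 y * u + P 1 y * v) - P 1 y * (M 0 y * u + P 0 y * v) by ring.
by rewrite c0 c1 !mulr0 subrr.
Qed.

End Component.
End NullCoframe.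

(** * Points where both parts of the normal are nonzero *)

(** Base and fibre parts of a conormal covector are proportional to those of the
lowered normal with the same factor: this is how the two parts of the normal are
played against each other. *)
Lemma warped_conormal (R : realType) (d : nat) (bm : 'rV[R]_2 -> 'M[R]_2)
    (rho : 'rV[R]_2 -> R) (gam : 'rV[R]_d -> 'M[R]_d) (w e : 'rV[R]_(2 + d))
    (J : 'M[R]_(d.+1, 2 + d)) (al : 'cV[R]_2) (be : 'cV[R]_d) :
  row_free J -> (warped_metric bm rho gam w)^T = warped_metric bm rho gam w ->
  (e *m warped_metric bm rho gam w *m e^T) 0 0 = 1 ->
  e *m warped_metric bm rho gam w *m J^T = 0 ->
  J *m col_mx al be = 0 ->
  exists mu, al = mu *: (bm (lsubmx w) *m (lsubmx e)^T) /\
    be = mu *: (rho (lsubmx w) ^+ 2 *: (gam (rsubmx w) *m (rsubmx e)^T)).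
Proof.
move=> fJ sG e1 eJ Jc.
have H : col_mx al be = (e *m col_mx al be) 0 0 *: (warped_metric bm rho gam w *m e^T).
  exact: (@hypersurface_conormal R d.+1 J e _ _ fJ sG e1 eJ Jc).
exists ((e *m col_mx al be) 0 0); move: (_ 0 0) H => mu H.
have : warped_metric bm rho gam w *m e^T = col_mx (bm (lsubmx w) *m (lsubmx e)^T)
    (rho (lsubmx w) ^+ 2 *: (gam (rsubmx w) *m (rsubmx e)^T)).
  rewrite -{1}[e]hsubmxK tr_row_mx /warped_metric mul_block_col !mul0mx.
  by rewrite addr0 add0r scalemxAl.
by move=> GE; move: H; rewrite GE scale_col_mx => /eq_col_mx [].
Qed.

(** What the argument uses of a photon surface, written in one chart. *)
Record umbilic_patch (R : realType) (d : nat) (bm : 'rV[R]_2 -> 'M[R]_2)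
    (rho : 'rV[R]_2 -> R) (gam : 'rV[R]_d -> 'M[R]_d) (V : set 'rV[R]_d.+1)
    (x eta : 'rV[R]_d.+1 -> 'rV[R]_(2 + d)) (lam : R) : Prop := UmbilicPatch {
  up_open : open V;
  up_x : smooth_on V x;
  up_eta : smooth_on V eta;
  up_free : forall s, V s -> row_free ('J x s);
  up_unit : forall s, V s ->
    (eta s *m warped_metric bm rho gam (x s) *m (eta s)^T) 0 0 = 1;
  up_normal : forall s, V s ->
    eta s *m warped_metric bm rho gam (x s) *m ('J x s)^T = 0;
  up_cov : forall s a k, V s ->
    cov_along (warped_metric bm rho gam) x eta s a k = lam * 'J x s a k }.

Record fibre_chart (R : realType) (d : nat) (gam : 'rV[R]_d -> 'M[R]_d)
    (dN : set 'rV[R]_d) : Prop := FibreChart {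
  fc_open : open dN;
  fc_diff : forall i j z, dN z -> differentiable (fun z => gam z i j) z;
  fc_christoffel : forall k i j z, dN z -> differentiable (christoffel gam k i j) z;
  fc_sym : forall z, dN z -> (gam z)^T = gam z;
  fc_pos : forall z (v : 'rV[R]_d), dN z -> v != 0 ->
    0 < (v *m gam z *m v^T) 0 0 }.

Lemma fc_unit (R : realType) (d : nat) (gam : 'rV[R]_d -> 'M[R]_d) dN z :
  fibre_chart gam dN -> dN z -> gam z \in unitmx.
Proof.
move=> fc Nz; rewrite -row_free_unit; apply: inj_row_free => v vg.
apply/eqP/negPn/negP => v0; have := fc_pos fc Nz v0.
by rewrite vg mul0mx mxE ltxx.
Qed.

Section Core.
Context {R : realType} {d : nat}.
Variables (h : R -> R) (bm : 'rV[R]_2 -> 'M[R]_2) (rho : 'rV[R]_2 -> R).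
Variables (U : set 'rV[R]_2) (P M : 'I_2 -> 'rV[R]_2 -> R).
Variables (gam : 'rV[R]_d -> 'M[R]_d) (dN : set 'rV[R]_d).
Variables (V : set 'rV[R]_d.+1) (x eta : 'rV[R]_d.+1 -> 'rV[R]_(2 + d)) (lam : R).
Hypotheses (frame : null_coframe h bm rho U P M) (fc : fibre_chart gam dN).
Hypotheses (rho_pos : forall y, U y -> 0 < rho y)
  (bm_unit : forall y, U y -> bm y \in unitmx)
  (dh : forall r, 0 < r -> derivable h r 1 /\ derivable (derive1 h) r 1).
Hypothesis patch : umbilic_patch bm rho gam V x eta lam.
Hypotheses (xU : forall s, V s -> U (lsubmx (x s)))
  (xN : forall s, V s -> dN (rsubmx (x s))).

Local Notation e_ i := (delta_mx 0 i).
Local Notation G := (warped_metric bm rho gam).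
Local Notation y t := (lsubmx (x t)).
Local Notation z t := (rsubmx (x t)).
Local Notation xi t A := (eta t 0 (lshift d A)).
Local Notation ze t i := (eta t 0 (rshift 2 i)).
Local Notation ya t a A := ('J x t a (lshift d A)).
Local Notation za t a i := ('J x t a (rshift 2 i)).

Let r t := rho (y t).
Let om i t := r t * ze t i.
Let form (Q : 'I_2 -> 'rV[R]_2 -> R) a t := \sum_A Q A (y t) * ya t a A.
Let comp (Q : 'I_2 -> 'rV[R]_2 -> R) t := \sum_A Q A (y t) * xi t A.
Let th a t := fibre_form gam (fun t => z t) (fun a i t => za t a i) om a t.

Let oV := up_open patch.
Let sx := up_x patch.
Let se := up_eta patch.

Let nbhsV s : V s -> nbhs s V.
Proof. by move=> Vs; apply: open_nbhs_nbhs. Qed.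

Let hy s a A : V s -> has_deriv (fun t => y t 0 A) s (e_ a) (ya s a A).
Proof.
move=> Vs; under [X in has_deriv X]funext do rewrite mxE.
exact: has_deriv_coord.
Qed.

Let hz s a i : V s -> has_deriv (fun t => z t 0 i) s (e_ a) (za s a i).
Proof.
move=> Vs; under [X in has_deriv X]funext do rewrite mxE.
exact: has_deriv_coord.
Qed.

Let he s a k : V s -> has_deriv (fun t => eta t 0 k) s (e_ a)
  ('D_(e_ a) (fun t => eta t 0 k) s).
Proof.
move=> Vs; apply/has_derivP/differentiable_entry.
exact: smooth_on_differentiable se Vs.
Qed.

Let drho s A : V s -> has_deriv rho (y s) (e_ A) (h (r s) / 2 * (P A (y s) + M A (y s))).
Proof. by move=> Vs; apply: (nc_rho frame); exact: xU. Qed.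

Let rho0 s : V s -> r s != 0.
Proof. by move=> Vs; rewrite gt_eqF // rho_pos //; exact: xU. Qed.

Let hr s a : V s ->
  has_deriv r s (e_ a) (h (r s) / 2 * (form P a s + form M a s)).
Proof.
move=> Vs; have [d0 _] := drho 0 Vs.
have H := has_deriv_chain (X := fun t => y t) d0 (fun A => hy a A Vs).
apply: has_deriv_eq H _; rewrite -big_split mulr_sumr; apply: eq_bigr => A _ /=.
by have [_ ->] := drho A Vs; ring.
Qed.

Let fibre_inner s : V s -> forall a,
  r s * (\sum_i \sum_j gam (z s) i j * za s a i * ze s j) = th a s.
Proof.
move=> Vs a; rewrite mulr_sumr; apply: eq_bigr => i _.
by rewrite mulr_sumr; apply: eq_bigr => j _; rewrite /om; ring.
Qed.

Let base s a C : V s -> \sum_B bm (y s) C B * 'D_(e_ a) (fun t => xi t B) s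
  + \sum_A \sum_B christoffel1 bm C A B (y s) * ya s a A * xi s B
  - rho (y s) * 'D_(e_ C) rho (y s) * \sum_i \sum_j gam (z s) i j * za s a i * ze s j
  = lam * \sum_B bm (y s) C B * ya s a B.
Proof.
move=> Vs; have [d0 _] := drho 0 Vs.
apply: base_equation => //.
- by move=> i j; apply: (fc_diff fc); exact: xN.
- by apply: bm_unit; exact: xU.
- by apply: (fc_unit fc); exact: xN.
- exact: rho0.
- by move=> b k; apply: (up_cov patch).
Qed.

Let hcomp Q Q' s a : null_coframe h bm rho U Q Q' -> V s ->
  has_deriv (comp Q) s (e_ a)
   ((lam - derive1 h (r s) * comp Q s / 2) * form Q a s + th a s).
Proof.
move=> fr Vs; rewrite -(fibre_inner Vs).
rewrite -(null_component_equation fr (xU Vs) (fun C => base a C Vs)).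
apply: has_deriv_sum => A _; apply: has_derivM (he _ _ Vs).
apply: (@has_deriv_chain _ _ _ (Q A) (fun t => y t)) => [|B]; last exact: hy.
by apply: (nc_diffP fr); exact: xU.
Qed.

Let form_second Q Q' s a b : null_coframe h bm rho U Q Q' -> V s ->
  has_deriv (form Q a) s (e_ b)
   (\sum_A ((\sum_B 'D_(e_ B) (Q A) (y s) * ya s b B) * ya s a A
     + Q A (y s) * 'D_(e_ b) (fun t => ya t a A) s)).
Proof.
move=> fr Vs; apply: has_deriv_sum => A _; apply: has_derivM.
  apply: (@has_deriv_chain _ _ _ (Q A) (fun t => y t)) => [|B]; last exact: hy.
  by apply: (nc_diffP fr); exact: xU.
exact/has_derivP/(differentiable_jacobian oV sx).
Qed.

Let form_closed Q Q' s a b : null_coframe h bm rho U Q Q' -> V s ->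
  'D_(e_ b) (form Q a) s = 'D_(e_ a) (form Q b) s.
Proof.
move=> fr Vs; have [_ ->] := form_second a b fr Vs.
have [_ ->] := form_second b a fr Vs.
rewrite !big_split; congr (_ + _); last first.
  by apply: eq_bigr => A _; rewrite (derive_jacobianC oV sx).
under eq_bigr do rewrite mulr_suml; under [RHS]eq_bigr do rewrite mulr_suml.
rewrite exchange_big; apply: eq_bigr => A _; apply: eq_bigr => B _.
by rewrite (nc_closedP fr A B (xU Vs)); ring.
Qed.

Let tangent s a : V s ->
  h (r s) / 2 * (comp P s * form M a s + comp M s * form P a s) = - r s * th a s.
Proof.
move=> Vs; rewrite -(fibre_inner Vs).
have H := congr1 (fun W : 'M[R]_(1, d.+1) => W 0 a) (up_normal patch Vs).
rewrite mxE [RHS]mxE big_split_ord /= in H.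
have eb : \sum_A (eta s *m G (x s)) 0 (lshift d A) * ('J x s)^T (lshift d A) a =
    h (r s) / 2 * (comp P s * form M a s + comp M s * form P a s).
  rewrite mulrDr /comp /form !sum_ord2 !mxE !big_split_ord /= !sum_ord2.
  rewrite !big1 ?addr0 => [|i _|i _]; rewrite ?warped_rl ?mulr0 //.
  by rewrite !warped_ll !(nc_metric frame _ _ (xU Vs)) /r; ring.
have ef : \sum_i (eta s *m G (x s)) 0 (rshift 2 i) * ('J x s)^T (rshift 2 i) a =
    r s * (r s * \sum_i \sum_j gam (z s) i j * za s a i * ze s j).
  rewrite !mulr_sumr; apply: eq_bigr => i _; rewrite !mxE big_split_ord /=.
  rewrite big1 ?add0r => [|A _]; last by rewrite warped_lr mulr0.
  rewrite !mulr_sumr mulr_suml; apply: eq_bigr => j _.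
  by rewrite warped_rr /r -{1}(fc_sym fc (xN Vs)) !mxE; ring.
by move: H; rewrite eb ef; lra.
Qed.

Let f t := lam * r t - h (r t) / 2 * (comp P t + comp M t).
Let kap s := r s * derive1 h (r s) / 2 - h (r s).

Let hf s a : V s -> has_deriv f s (e_ a) (kap s * th a s).
Proof.
move=> Vs; have [dh0 _] := dh (rho_pos (xU Vs)).
apply: (@has_deriv_fibre_factor _ _ _ _ _ _ _ (form P) (form M)) => //.
- by move=> b; exact: hr.
- by move=> b; exact: tangent.
- exact: (hcomp _ frame).
- exact: (hcomp _ (null_coframe_swap frame)).
Qed.

Let hom s a k : V s -> has_deriv (om k) s (e_ a)
  (f s * za s a k - \sum_i \sum_j christoffel gam k i j (z s) * za s a i * om j s).
Proof.
move=> Vs; have [d0 _] := drho 0 Vs.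
have H := has_derivM (hr a Vs) (he a (rshift 2 k) Vs).
have E : 'D_(e_ a) (fun t => ze t k) s
    + \sum_i \sum_j christoffel gam k i j (z s) * za s a i * ze s j =
  (lam - (\sum_A 'D_(e_ A) rho (y s) * xi s A) / rho (y s)) * za s a k
   - (\sum_A 'D_(e_ A) rho (y s) * ya s a A) / rho (y s) * ze s k.
  apply: fibre_equation => //.
  - by move=> i j; apply: (fc_diff fc); exact: xN.
  - by apply: (fc_sym fc); exact: xN.
  - by apply: bm_unit; exact: xU.
  - by apply: (fc_unit fc); exact: xN.
  - exact: rho0.
  - by move=> b l; apply: (up_cov patch).
have e1 : \sum_A 'D_(e_ A) rho (y s) * xi s A = h (r s) / 2 * (comp P s + comp M s).
  rewrite -big_split mulr_sumr; apply: eq_bigr => A _ /=.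
  by have [_ ->] := drho A Vs; ring.
have e2 : \sum_A 'D_(e_ A) rho (y s) * ya s a A = h (r s) / 2 * (form P a s + form M a s).
  rewrite -big_split mulr_sumr; apply: eq_bigr => A _ /=.
  by have [_ ->] := drho A Vs; ring.
rewrite e1 e2 in E.
apply: has_deriv_eq H _.
have -> : \sum_i \sum_j christoffel gam k i j (z s) * za s a i * om j s =
   r s * \sum_i \sum_j christoffel gam k i j (z s) * za s a i * ze s j.
  rewrite mulr_sumr; apply: eq_bigr => i _; rewrite mulr_sumr.
  by apply: eq_bigr => j _; rewrite /om; ring.
rewrite -[X in _ + _ * X](addrK (\sum_i \sum_j christoffel gam k i j (z s) * za s a i * ze s j)).
rewrite E -/(r s) /f; have := rho0 Vs; move: (r s) => r0 r00.
by field.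
Qed.

Section AtPoint.
Variable s : 'rV[R]_d.+1.
Hypotheses (Vs : V s) (xi0 : lsubmx (eta s) != 0) (ze0 : rsubmx (eta s) != 0).

Let conormal (al : 'I_2 -> R) (be : 'I_d -> R) :
  (forall a, \sum_A al A * ya s a A + \sum_i be i * za s a i = 0) ->
  exists mu, (forall A, al A = mu * \sum_B bm (y s) A B * xi s B) /\
    (forall i, be i = mu * \sum_j gam (z s) i j * (r s ^+ 2 * ze s j)).
Proof.
move=> H; have Us := xU Vs; have Ns := xN Vs.
have sG : (G (x s))^T = G (x s).
  apply: warped_metric_sym; last exact: (fc_sym fc).
  apply/matrixP => A B; rewrite mxE !(nc_metric frame) //; ring.
have Jc : 'J x s *m col_mx (\col_A al A) (\col_i be i) = 0.
  apply/matrixP => a o; rewrite mxE [RHS]mxE -[RHS](H a) big_split_ord /=.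
  congr (_ + _); apply: eq_bigr => k _; rewrite ?col_mxEu ?col_mxEd mxE; exact: mulrC.
have [mu [ea eb]] := warped_conormal (up_free patch Vs) sG (up_unit patch Vs)
  (up_normal patch Vs) Jc.
exists mu; split=> k.
  have := congr1 (fun W : 'cV[R]_2 => W k 0) ea; rewrite !mxE => ->.
  by congr (_ * _); apply: eq_bigr => B _; rewrite !mxE.
have := congr1 (fun W : 'cV[R]_d => W k 0) eb; rewrite !mxE => ->.
congr (_ * _); rewrite mulr_sumr; apply: eq_bigr => j _; rewrite !mxE /r; ring.
Qed.

Let base_normal_neq0 : exists A, \sum_B bm (y s) A B * xi s B != 0.
Proof.
apply/not_existsP => H.
have e0 : bm (y s) *m (lsubmx (eta s))^T = 0.
  apply/matrixP => A o; rewrite (ord1 o) !mxE.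
  have /negP/negPn/eqP e := H A; rewrite -[RHS]e.
  by apply: eq_bigr => B _; rewrite !mxE.
have et0 : (lsubmx (eta s))^T = 0.
  by rewrite -[LHS](mulKmx (bm_unit (xU Vs))) e0 mulmx0.
by move/negP: xi0; apply; rewrite -(trmxK (lsubmx _)) et0 trmx0.
Qed.

(** Since the normal has a base component, the hypersurface projects onto the
fibre. *)
Let fibre_form_inj (be : 'I_d -> R) :
  (forall a, \sum_i be i * za s a i = 0) -> forall i, be i = 0.
Proof.
move=> H i; have [a|mu [ea eb]] := @conormal (fun=> 0) be.
  by rewrite H addr0 big1 // => A _; rewrite mul0r.
have [A nA] := base_normal_neq0.
have := ea A => /esym/eqP; rewrite mulf_eq0 (negbTE nA) orbF => /eqP mu0.
by rewrite eb mu0 mul0r.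
Qed.

Let span : exists Y : 'I_d -> 'I_d.+1 -> R,
  forall p i, \sum_a Y p a * za s a i = (p == i)%:R.
Proof.
pose Z : 'M[R]_(d.+1, d) := \matrix_(a, i) za s a i.
have /row_fullP[Y YZ] : row_full Z.
  rewrite /row_full -mxrank_tr; apply: inj_row_free => v vZ.
  apply/rowP => i; rewrite [RHS]mxE; apply: (fibre_form_inj (be := fun i => v 0 i)) => a.
  have := congr1 (fun W : 'rV[R]_d.+1 => W 0 a) vZ; rewrite !mxE => e.
  by rewrite -[RHS]e; apply: eq_bigr => j _; rewrite !mxE.
exists (fun p a => Y p a) => p i.
have := congr1 (fun W : 'M[R]_d => W p i) YZ; rewrite !mxE => <-.
by apply: eq_bigr => a _; rewrite !mxE.
Qed.

Let wom : 'rV[R]_d := \row_i om i s.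

Let wom0 : wom != 0.
Proof.
have -> : wom = r s *: rsubmx (eta s) by apply/rowP => i; rewrite !mxE.
by rewrite scaler_eq0 negb_or rho0.
Qed.

Let th_neq0 : exists a, th a s != 0.
Proof.
apply/not_existsP => H.
have e0 i : (gam (z s) *m wom^T) i 0 = 0.
  apply: (fibre_form_inj (be := fun i => (gam (z s) *m wom^T) i 0)) => a.
  have /negP/negPn/eqP e := H a; rewrite -[RHS]e; apply: eq_bigr => j _.
  rewrite mxE mulr_suml; apply: eq_bigr => k _; rewrite !mxE; ring.
have := fc_pos fc (xN Vs) wom0; rewrite -mulmxA mxE big1 ?ltxx // => i _.
by rewrite e0 mulr0.
Qed.

Let hz' c i : has_deriv (fun t => z t 0 i) s (e_ c) (za s c i).
Proof. exact: hz. Qed.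

Let dza c i : differentiable (fun t => za t c i) s.
Proof. exact: (differentiable_jacobian oV sx). Qed.

Let cza c c' i : 'D_(e_ c') (fun t => za t c i) s = 'D_(e_ c) (fun t => za t c' i) s.
Proof. exact: (derive_jacobianC oV sx). Qed.

Let dg i j : differentiable (fun w => gam w i j) (z s).
Proof. by apply: (fc_diff fc); exact: xN. Qed.

Let homn c k : \forall t \near s, has_deriv (om k) t (e_ c)
  (f t * za t c k - \sum_i \sum_j christoffel gam k i j (z t) * za t c i * om j t).
Proof. by apply: filterS (nbhsV Vs) => t; exact: hom. Qed.

Let wedge Q Q' a b : null_coframe h bm rho U Q Q' ->
  (forall c, has_deriv r s (e_ c) (h (r s) / 2 * (form Q c s + form Q' c s))) ->
  (forall c, h (r s) / 2 * (comp Q s * form Q' c s + comp Q' s * form Q c s) = - r s * th c s) ->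
  (r s * derive1 (derive1 h) (r s) - derive1 h (r s)) *
    (th b s * form Q a s - th a s * form Q b s) = 0.
Proof.
move=> fr hrQ tg; have [dh0 dh1] := dh (rho_pos (xU Vs)).
apply: (@null_component_integrability _ _ h lam r (comp Q) (comp Q')
   (form Q) (form Q') th) => //.
- by move=> c; apply: filterS (nbhsV Vs) => t; exact: (hcomp _ fr).
- by move=> c; have [] := form_second c c fr Vs.
- by move=> c; apply: (differentiable_fibre_form (f := f)) => //.
- by move=> c c'; exact: (form_closed c c' fr Vs).
- move=> c c'; apply: (@derive_fibre_formC _ _ _ _ dN (fun t => z t)
    (fun a i t => za t a i) om f s) => //.
  + exact: (fc_open fc).
  + exact: xN.
  + exact: (fc_sym fc).
  + by apply: (fc_unit fc); exact: xN.
Qed.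

(** Otherwise integrability makes the restrictions of P and of M to the surface
proportional to th; then the base parts of two conormals are P and M, so P and M are
both proportional to the lowered xi, although they are independent. *)
Let kappa_stationary : r s * derive1 (derive1 h) (r s) = derive1 h (r s).
Proof.
apply/eqP/negPn/negP; rewrite -subr_eq0 => k0.
have [b thb] := th_neq0.
have proportional Q Q' : null_coframe h bm rho U Q Q' ->
    (forall c, has_deriv r s (e_ c) (h (r s) / 2 * (form Q c s + form Q' c s))) ->
    (forall c, h (r s) / 2 * (comp Q s * form Q' c s + comp Q' s * form Q c s) = - r s * th c s) ->
    exists mu, forall A, Q A (y s) = mu * \sum_B bm (y s) A B * xi s B.
  move=> fr hrQ tg; pose c := form Q b s / th b s.
  have [a|mu [ea _]] := @conormal (fun A => Q A (y s))
      (fun i => - c * (gam (z s) *m wom^T) i 0); last by exists mu.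
  have := wedge a b fr hrQ tg => /eqP; rewrite mulf_eq0 (negbTE k0) /= subr_eq0 => /eqP e.
  have -> : \sum_i - c * (gam (z s) *m wom^T) i 0 * za s a i = - c * th a s.
    rewrite mulr_sumr; apply: eq_bigr => i _.
    rewrite mxE -mulrA; congr (_ * _); rewrite mulr_suml.
    by apply: eq_bigr => j _; rewrite !mxE; ring.
  rewrite -/(form Q a s) /c.
  have -> : form Q a s = th a s * form Q b s / th b s by rewrite -e mulrAC divff ?mul1r.
  by ring.
have [mu emu] := proportional _ _ frame (fun c => hr c Vs) (fun c => tangent c Vs).
have [||nu enu] := proportional _ _ (null_coframe_swap frame).
- by move=> c; rewrite [form M c s + _]addrC; exact: hr.
- by move=> c; rewrite [comp M s * _ + _]addrC; exact: tangent.
have /eqP := nc_indep frame (xU Vs); apply.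
by rewrite !emu !enu; ring.
Qed.

Let ricci_wom : (wom *m ricci gam (z s) *m wom^T) 0 0 =
  (1 - d%:R) * kap s * (wom *m gam (z s) *m wom^T) 0 0.
Proof.
have [Y spanY] := span.
have := @ricci_along _ _ _ gam dN (fun t => z t) (fun a i t => za t a i) om f s (kap s)
  hz' dza cza (fc_open fc) (xN Vs) (fc_sym fc) homn.
have quadE (A : 'M[R]_d) : (wom *m A *m wom^T) 0 0 = \sum_j \sum_k om j s * A j k * om k s.
  rewrite exchange_big mxE; apply: eq_bigr => k _; rewrite !mxE mulr_suml.
  by apply: eq_bigr => j _; rewrite !mxE.
move=> H; rewrite !quadE (H _ _ _ Y spanY).
- by congr (_ * _); apply: eq_bigr => i _; apply: eq_bigr => j _; ring.
- by move=> k i j; apply: (fc_christoffel fc); exact: xN.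
- by move=> a; have [df _] := hf a Vs.
- by move=> a; have [_ ->] := hf a Vs.
Qed.

(** Where both parts of the normal are nonzero, integrability in the base and in
the fibre determine h'' and the Ricci curvature in the direction of the fibre part.
Together these values cancel the expression of the genericity hypothesis. *)
Lemma core_expression : exists X : 'rV[R]_d,
  (X *m gam (z s) *m X^T) 0 0 = 1 /\
  r s * derive1 (derive1 h) (r s) = derive1 h (r s) /\
  (X *m ricci gam (z s) *m X^T) 0 0 = (1 - d%:R) * kap s.
Proof.
have q0 := fc_pos fc (xN Vs) wom0; set q := (_ 0 0) in q0.
have unit_q : (Num.sqrt q)^-1 * ((Num.sqrt q)^-1 * q) = 1.
  by rewrite mulrA -invfM -expr2 sqr_sqrtr ?mulVf ?gt_eqF // ltW.
have scaleE (A : 'M[R]_d) : ((Num.sqrt q)^-1 *: wom *m A *m ((Num.sqrt q)^-1 *: wom)^T) 0 0 =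
   (Num.sqrt q)^-1 * ((Num.sqrt q)^-1 * (wom *m A *m wom^T) 0 0).
  by rewrite linearZ /= -scalemxAr -!scalemxAl !mxE.
exists ((Num.sqrt q)^-1 *: wom); rewrite !scaleE ricci_wom -/q unit_q.
split; first by []; split; first exact: kappa_stationary.
by rewrite [_ * q]mulrC !mulrA -[_ * _ * q]mulrA unit_q mul1r.
Qed.

End AtPoint.
End Core.

(** * Regularity of the fibre and of the base *)

Section FibreChart.
Context {R : realType} {V : normedModType R}.

Lemma differentiable_prod (I : Type) (r : seq I) (P : pred I) (F : I -> V -> R) s :
  (forall i, differentiable (F i) s) ->
  differentiable (fun x => \prod_(i <- r | P i) F i x) s.
Proof.
move=> dF; elim: r => [|i r IH].
  have -> : (fun x => \prod_(i <- [::] | P i) F i x) = cst 1.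
    by apply/funext => x; rewrite big_nil.
  exact: differentiable_cst.
have [Pi|Pi] := boolP (P i); last first.
  have -> // : (fun x => \prod_(j <- i :: r | P j) F j x) =
      (fun x => \prod_(j <- r | P j) F j x).
  by apply/funext => x; rewrite big_cons (negbTE Pi).
have -> // : (fun x => \prod_(j <- i :: r | P j) F j x) =
    (fun x => F i x * \prod_(j <- r | P j) F j x).
  by apply/funext => x; rewrite big_cons Pi.
exact: differentiableM.
Qed.

Lemma differentiable_det m (M : V -> 'M[R]_m) s :
  (forall i j, differentiable (fun x => M x i j) s) ->
  differentiable (fun x => \det (M x)) s.
Proof.
move=> dM; rewrite /determinant.
have [] // : has_deriv (fun x => \sum_(t : 'S_m) (-1) ^+ t * \prod_i M x i (t i)) s 0
  (\sum_(t : 'S_m) (-1) ^+ t * 'D_0 (fun x => \prod_i M x i (t i)) s).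
apply: has_deriv_sum => t _; apply: has_derivZ; apply: has_derivP.
by apply: differentiable_prod.
Qed.

Lemma differentiable_invmx m (M : V -> 'M[R]_m) s k l :
  (forall i j, differentiable (fun x => M x i j) s) ->
  (\forall x \near s, M x \in unitmx) ->
  differentiable (fun x => invmx (M x) k l) s.
Proof.
move=> dM uM; have d0 := nbhs_singleton uM.
have : differentiable (fun x => (\det (M x))^-1 * ((-1) ^+ (l + k) *
   \det (row' l (col' k (M x))))) s.
  apply: differentiableM.
    apply: differentiableV; first exact: differentiable_det.
    by rewrite -unitfE -unitmxE.
  apply: differentiableM; first exact: differentiable_cst.
  apply: differentiable_det => i j.
  have -> // : (fun x => row' l (col' k (M x)) i j) =
      (fun x => M x (lift l i) (lift k j)).
  by apply/funext => x; rewrite !mxE.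
apply: differentiable_near; apply: filterS uM => x ux.
by rewrite /invmx ux !mxE.
Qed.
End FibreChart.

Lemma fibre_chart_riemannian (R : realType) (N : topologicalType) (d : nat)
    (gN : atlas R N d) (c : chart gN) :
  compact_riemannian gN -> fibre_chart (met c) (dom c).
Proof.
move=> hN; have [oc _ _ _] := cr_chart hN c.
have sm := cr_smooth hN c.
have dm i j z : dom c z -> differentiable (fun z => met c z i j) z.
  by move=> cz; apply: differentiable_entry; exact: smooth_on_differentiable sm cz.
have pos z (v : 'rV[R]_d) : dom c z -> v != 0 -> 0 < (v *m met c z *m v^T) 0 0.
  exact: (cr_pos hN).
have um z : dom c z -> met c z \in unitmx.
  move=> cz; rewrite -row_free_unit; apply: inj_row_free => v vg.
  apply/eqP/negPn/negP => v0; have := pos z v cz v0.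
  by rewrite vg mul0mx mxE ltxx.
split=> //; last by move=> z cz; exact: (cr_sym hN).
move=> k i j z cz.
have nz : nbhs z (dom c) by apply: open_nbhs_nbhs.
have dDm a p q : differentiable ('D_(delta_mx 0 a) (fun y => met c y p q)) z.
  have := differentiable_entry p q (smooth_on_differentiable
    (smooth_on_derive (delta_mx 0 a) sm) cz).
  apply: differentiable_near; apply: filterS nz => w cw.
  rewrite derive_mx ?mxE //; apply: diff_derivable.
  exact: smooth_on_differentiable sm cw.
have [] // : has_deriv (christoffel (met c) k i j) z 0
  ('D_0 (christoffel (met c) k i j) z).
have [] := _ : exists e, has_deriv (christoffel (met c) k i j) z 0 e; last first.
  by move=> e [he _]; exact: has_derivP.
eexists; rewrite /christoffel; apply: has_derivZ; apply: has_deriv_sum => l _.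
apply: has_derivM.
  apply: has_derivP; apply: differentiable_invmx => [p q|]; first exact: dm.
  by apply: filterS nz => w; exact: um.
apply: has_derivB; last exact: has_derivP.
by apply: has_derivD; exact: has_derivP.
Qed.

Section BasePiece.
Context {R : realType}.

(** What the argument uses of the Lorentzian base: near a point where h does not
vanish there are null coordinates; elsewhere only regularity matters. *)
Record base_piece (h : R -> R) (bd : set 'rV[R]_2) (bm : 'rV[R]_2 -> 'M[R]_2)
    (rho : 'rV[R]_2 -> R) : Prop := BasePiece {
  bp_diff_rho : forall y, bd y -> differentiable rho y;
  bp_diff_bm : forall A B y, bd y -> differentiable (fun y => bm y A B) y;
  bp_sym : forall y, bd y -> (bm y)^T = bm y;
  bp_unit : forall y, bd y -> bm y \in unitmx;
  bp_pos : forall y, bd y -> 0 < rho y;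
  bp_critical : exists yc, forall y, bd y ->
    (forall A, 'D_(delta_mx 0 A) rho y = 0) -> y = yc;
  bp_horizon : exists zc, forall y, bd y -> h (rho y) = 0 -> rho y = zc;
  bp_frame : forall y, bd y -> h (rho y) != 0 ->
    exists U P M, [/\ null_coframe h bm rho U P M, U y & U `<=` bd] }.

End BasePiece.

Section Patch.
Context {R : realType} {d : nat}.

Lemma Ck_sub (X W : normedModType R) (U U' : set X) k (f : X -> W) :
  U' `<=` U -> Ck k U f -> Ck k U' f.
Proof.
move=> sU; elim: k f => [|k IH] f /=; first by move=> cf x /sU; exact: cf.
by case=> df cf; split=> [x /sU|v]; [exact: df|apply: IH; exact: cf].
Qed.

Lemma smooth_on_sub (X W : normedModType R) (U U' : set X) (f : X -> W) :
  U' `<=` U -> smooth_on U f -> smooth_on U' f.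
Proof. by move=> sU sf k; exact: Ck_sub (sf k). Qed.

Lemma umbilic_patch_sub bm rho gam V V' x eta lam :
  open V' -> V' `<=` V -> @umbilic_patch R d bm rho gam V x eta lam ->
  umbilic_patch bm rho gam V' x eta lam.
Proof.
move=> oV' sV [oV sx se fr un no co]; split=> //.
- exact: smooth_on_sub sx.
- exact: smooth_on_sub se.
- by move=> s /sV; exact: fr.
- by move=> s /sV; exact: un.
- by move=> s /sV; exact: no.
- by move=> s a k /sV; exact: co.
Qed.

End Patch.

(** * Analysis of one patch *)

Section PatchDichotomy.
Context {R : realType} {d : nat}.
Variables (h : R -> R) (bd : set 'rV[R]_2).
Variables (bm : 'rV[R]_2 -> 'M[R]_2) (rho : 'rV[R]_2 -> R).
Variables (gam : 'rV[R]_d -> 'M[R]_d) (dN : set 'rV[R]_d).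
Variables (V : set 'rV[R]_d.+1) (x eta : 'rV[R]_d.+1 -> 'rV[R]_(2 + d)) (lam : R).
Hypotheses (base : base_piece h bd bm rho) (fc : fibre_chart gam dN).
Hypothesis patch : umbilic_patch bm rho gam V x eta lam.
Hypotheses (xB : forall s, V s -> bd (lsubmx (x s)))
  (xN : forall s, V s -> dN (rsubmx (x s))).

Local Notation e_ i := (delta_mx 0 i).
Local Notation G := (warped_metric bm rho gam).
Local Notation y t := (lsubmx (x t)).
Local Notation z t := (rsubmx (x t)).

Let oV := up_open patch.
Let sx := up_x patch.
Let se := up_eta patch.

Let rho0 s : V s -> rho (y s) != 0.
Proof. by move=> Vs; rewrite gt_eqF // (bp_pos base) //; exact: xB. Qed.

Let hy s a A : V s -> has_deriv (fun t => y t 0 A) s (e_ a) ('J x s a (lshift d A)).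
Proof.
move=> Vs; under [X in has_deriv X]funext do rewrite mxE.
exact: has_deriv_coord.
Qed.

(** A base covector that vanishes on the hypersurface is conormal, so it is zero
where the normal has a fibre component. *)
Lemma base_form_inj s (al : 'I_2 -> R) : V s -> rsubmx (eta s) != 0 ->
  (forall a, \sum_A al A * 'J x s a (lshift d A) = 0) -> forall A, al A = 0.
Proof.
move=> Vs ze0 H; have Bs := xB Vs; have Ns := xN Vs.
have sG : (G (x s))^T = G (x s).
  by apply: warped_metric_sym; [exact: (bp_sym base)|exact: (fc_sym fc)].
have Jc : 'J x s *m col_mx (\col_A al A) (0 : 'cV[R]_d) = 0.
  apply/matrixP => a o; rewrite mxE [RHS]mxE -[RHS](H a) big_split_ord /=.
  rewrite [X in _ + X]big1 => [|k _]; last by rewrite col_mxEd [X in _ * X]mxE mulr0.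
  by rewrite addr0; apply: eq_bigr => k _; rewrite col_mxEu [X in _ * X]mxE mulrC.
have [mu [ea eb]] := warped_conormal (up_free patch Vs) sG (up_unit patch Vs)
  (up_normal patch Vs) Jc.
have mu0 : mu = 0.
  apply/eqP/negPn/negP => mu0; move/eqP: eb; rewrite eq_sym scaler_eq0 (negbTE mu0) /=.
  rewrite scaler_eq0 expf_eq0 (negbTE (rho0 Vs)) /= => /eqP gz.
  have et0 : (rsubmx (eta s))^T = 0.
    by rewrite -[LHS](mulKmx (fc_unit fc Ns)) gz mulmx0.
  by move/negP: ze0; apply; rewrite -(trmxK (rsubmx _)) et0 trmx0.
move=> A; have := congr1 (fun W : 'cV[R]_2 => W A 0) ea.
by rewrite mu0 scale0r !mxE.
Qed.

(** A hypersurface cannot lie in a level of rho where its normal has a fibre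
component: the gradient of rho would be normal, and on the critical set, which
projects to one point of the base, the base coordinates would be constant. *)
Lemma rho_nonconstant s e : V s -> 0 < e -> ball s e `<=` V ->
  (forall t, ball s e t -> rsubmx (eta t) != 0) ->
  exists2 t, ball s e t & rho (y t) != rho (y s).
Proof.
move=> Vs e0 sV ze0; apply: contrapT => H.
have const t : ball s e t -> rho (y t) = rho (y s).
  by move=> bt; apply/eqP/negPn/negP => n; apply: H; exists t.
have nb t : ball s e t -> nbhs t (ball s e).
  move=> bt; apply: open_nbhs_nbhs; split => //.
  exact: ball_open.
have [yc critical] := bp_critical base.
have yE t : ball s e t -> y t = yc.
  move=> bt; have Vt := sV _ bt; apply: critical; first exact: xB.
  apply: (base_form_inj Vt (ze0 _ bt)) => a.
  have drho := bp_diff_rho base (xB Vt).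
  have H1 := has_deriv_chain (X := fun t => y t) drho (fun A => hy a A Vt).
  apply: has_deriv_unique H1 _.
  apply: has_deriv_near (has_deriv_cst _ _ (rho (y s))).
  by apply: filterS (nb t bt) => w bw; rewrite const.
have b0 : ball s e s by exact: ballxx.
have one0 : (1 : R) = 0.
  apply: (@base_form_inj s (fun=> 1) Vs (ze0 s b0) _ 0) => a.
  rewrite big1 // => A _; rewrite mul1r.
  apply: has_deriv_unique (hy a A Vs) _.
  apply: has_deriv_near (has_deriv_cst _ _ (yc 0 A)).
  by apply: filterS (nb s b0) => w bw; rewrite yE.
by move/eqP: one0; rewrite oner_eq0.
Qed.

(** All base directions are then tangent.  Moving along the base, a fibre field
stays in the fibre, so the second fundamental form vanishes on them, whereas the
induced metric does not. *)
Lemma fibre_normal_umbilicity s : V s -> (forall t, V t -> lsubmx (eta t) = 0) ->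
  lam = 0.
Proof.
move=> Vs xi0; have Bs := xB Vs; have Ns := xN Vs.
have xi0E t A : V t -> eta t 0 (lshift d A) = 0.
  by move=> Vt; have := congr1 (fun w : 'rV[R]_2 => w 0 A) (xi0 t Vt); rewrite !mxE.
have ze0 : rsubmx (eta s) != 0.
  apply/eqP => ze0; have := up_unit patch Vs.
  rewrite -[eta s]hsubmxK xi0 // ze0 row_mx0 !mul0mx mxE => /eqP.
  by rewrite eq_sym oner_eq0.
pose S a := \sum_i \sum_j gam (z s) i j * 'J x s a (rshift 2 i) * eta s 0 (rshift 2 j).
have S0 a : S a = 0.
  have := congr1 (fun W : 'M[R]_(1, d.+1) => W 0 a) (up_normal patch Vs).
  rewrite mxE [RHS]mxE big_split_ord /=.
  rewrite big1 ?add0r => [|A _]; last first.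
    rewrite mxE big_split_ord /= !big1 ?addr0 ?mul0r // => i _.
      by rewrite warped_rl mulr0.
    by rewrite xi0E ?mul0r.
  move=> e; apply: (mulfI (expf_neq0 2 (rho0 Vs))); rewrite mulr0 -[RHS]e.
  rewrite mulr_sumr; apply: eq_bigr => i _; rewrite [X in _ = X * _]mxE big_split_ord /=.
  rewrite [X in _ = (X + _) * _]big1 ?add0r => [|A _]; last by rewrite warped_lr mulr0.
  rewrite mulr_sumr mulr_suml; apply: eq_bigr => j _.
  by rewrite warped_rr -{1}(fc_sym fc Ns) mxE [X in _ = _ * X]mxE; ring.
apply/eqP/negPn/negP => lam0.
have ya0 a B : 'J x s a (lshift d B) = 0.
  pose W : 'cV[R]_2 := \col_A 'J x s a (lshift d A).
  have e0 : bm (y s) *m W = 0.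
    apply/matrixP => C o; rewrite [RHS]mxE (ord1 o).
    have := @base_equation R d.+1 d bm rho gam x eta lam s
      (bp_diff_rho base Bs) (fun i j => fc_diff fc i j Ns)
      (bp_unit base Bs) (fc_unit fc Ns) (rho0 Vs)
      (fun a k => up_cov patch a k Vs) a C.
    rewrite -/(S a) S0 mulr0 subr0.
    rewrite big1 ?add0r => [|A _]; last first.
      have [_ ->] : has_deriv (fun t => eta t 0 (lshift d A)) s (delta_mx 0 a) 0.
        apply: has_deriv_near (has_deriv_cst _ _ 0).
        by apply: filterS (open_nbhs_nbhs (conj oV Vs)) => t Vt; rewrite xi0E.
      by rewrite mulr0.
    rewrite big1 => [|A _]; last by rewrite big1 // => A' _; rewrite xi0E // mulr0.
    move/esym/eqP; rewrite mulf_eq0 (negbTE lam0) /= => /eqP e.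
    by rewrite -[RHS]e mxE; apply: eq_bigr => A _; rewrite [X in _ * X]mxE.
  have W0 : W = 0 by rewrite -[W](mulKmx (bp_unit base Bs)) e0 mulmx0.
  by have := congr1 (fun M : 'cV[R]_2 => M B 0) W0; rewrite [X in X = _]mxE [RHS]mxE.
have one0 : (1 : R) = 0.
  apply: (@base_form_inj s (fun=> 1) Vs ze0 _ 0) => a.
  by rewrite big1 // => A _; rewrite mul1r ya0.
by move/eqP: one0; rewrite oner_eq0.
Qed.

(** The tangent space is the annihilator of the conormal, which has no fibre part
here. *)
Lemma base_normal_contains_fibre s (w : 'rV[R]_d) : V s -> rsubmx (eta s) = 0 ->
  (row_mx (0 : 'rV[R]_2) w <= 'J x s)%MS.
Proof.
move=> Vs ze0; have Bs := xB Vs; have Ns := xN Vs.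
have sG : (G (x s))^T = G (x s).
  by apply: warped_metric_sym; [exact: (bp_sym base)|exact: (fc_sym fc)].
rewrite submxE; apply/eqP/matrixP => o k; rewrite (ord1 o) [RHS]mxE.
pose c : 'cV[R]_(2 + d) := col k (cokermx ('J x s)).
have Jc : 'J x s *m col_mx (usubmx c) (dsubmx c) = 0.
  by rewrite vsubmxK /c colE mulmxA mulmx_coker mul0mx.
have [mu [_ eb]] := warped_conormal (up_free patch Vs) sG (up_unit patch Vs)
  (up_normal patch Vs) Jc.
have : (row_mx 0 w *m c) 0 0 = 0.
  by rewrite -[c]vsubmxK mul_row_col mul0mx add0r eb ze0 trmx0 !(mulmx0, scaler0) mxE.
by rewrite /c colE mulmxA -colE mxE.
Qed.

Hypothesis dh : forall r, 0 < r -> derivable h r 1 /\ derivable (derive1 h) r 1.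
Variable D : set R.
Hypothesis dense : [set r : R | 0 < r] `<=` closure D.
Hypothesis generic : forall r z (X : 'rV[R]_d), D r -> dN z ->
  (X *m gam z *m X^T) 0 0 = 1 -> 0 < r ->
  r * derive1 (derive1 h) r = derive1 h r ->
  (X *m ricci gam z *m X^T) 0 0 != (1 - d%:R) * (r * derive1 h r / 2 - h r).

(** If both parts were nonzero at s, they would be so nearby, where rho takes all
values of an interval; one of these is generic and not a zero of h, and there the
identities of the null coframe contradict genericity. *)
Lemma patch_dichotomy s : V s -> lsubmx (eta s) = 0 \/ rsubmx (eta s) = 0.
Proof.
move=> Vs; apply: contrapT => /not_orP[/eqP xi0 /eqP ze0].
have de := smooth_on_differentiable se Vs.
have near_xi : \forall t \near s, lsubmx (eta t) != 0.
  have dl : differentiable (fun t => lsubmx (eta t)) s.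
    exact: differentiable_comp de (differentiable_lsubmx _).
  exact: cvgr_neq0 (differentiable_continuous dl) xi0.
have near_ze : \forall t \near s, rsubmx (eta t) != 0.
  have dr : differentiable (fun t => rsubmx (eta t)) s.
    exact: differentiable_comp de (differentiable_rsubmx _).
  exact: cvgr_neq0 (differentiable_continuous dr) ze0.
have nV : nbhs s V by apply: open_nbhs_nbhs.
have [e /= e0 he] := (nbhs_ballP _ _).1 (filterI nV (filterI near_xi near_ze)).
have [t bt rts] := rho_nonconstant Vs e0 (fun w bw => (he w bw).1)
  (fun w bw => (he w bw).2.2).
(* The values of rho along the segment from s to t fill an interval. *)
pose seg (u : R) := s + u *: (t - s).
have bseg u : 0 <= u -> u <= 1 -> ball s e (seg u).
  move=> u0 u1; move: bt; rewrite -!ball_normE /= /seg opprD addNKr normrN normrZ ger0_norm //.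
  rewrite distrC => bt; apply: le_lt_trans bt.
  by rewrite -[leRHS]mul1r ler_wpM2r.
pose g u := rho (y (seg u)).
have dg u : 0 <= u -> u <= 1 -> derivable g u 1.
  move=> u0 u1; have Vu := (he _ (bseg u u0 u1)).1.
  apply/derivable1_diffP.
  have dseg : differentiable seg u.
    apply: differentiableD; first exact: differentiable_cst.
    by apply: differentiableZl.
  have dxu := smooth_on_differentiable sx Vu.
  have dy : differentiable (fun w => y w) (seg u).
    exact: differentiable_comp dxu (differentiable_lsubmx _).
  have drho : differentiable rho (y (seg u)) by apply: (bp_diff_rho base); exact: xB.
  exact: differentiable_comp (differentiable_comp dseg dy) drho.
have cg : {within `[0, 1], continuous g}.
  apply: derivable_within_continuous => u; rewrite in_itv /= => /andP[u0 u1].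
  exact: dg.
have g0 : g 0 = rho (y s) by rewrite /g /seg scale0r addr0.
have g1 : g 1 = rho (y t) by rewrite /g /seg scale1r addrC subrK.
have posg u : 0 <= u -> u <= 1 -> 0 < g u.
  by move=> u0 u1; apply: (bp_pos base); apply: xB; exact: (he _ (bseg u u0 u1)).1.
set a := Num.min (g 0) (g 1); set b := Num.max (g 0) (g 1).
have a0 : 0 < a by rewrite /a lt_min !posg.
have ab : a < b.
  by rewrite /a /b gt_min !lt_max !ltxx /= g0 g1 orbF -neq_lt eq_sym.
have [zc horizon] := bp_horizon base.
(* Shrink the interval so that it avoids the only possible zero of h. *)
have [a' [b' [aa' bb' ab' zc']]] : exists a' b', [/\ a <= a', b' <= b, a' < b' &
    forall r, a' < r -> r < b' -> r != zc].
  have [zab|nzab] := boolP ((a < zc) && (zc < b)).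
    case/andP: zab => az zb; exists zc, b; split=> //; first exact: ltW.
    by move=> r zr _; rewrite gt_eqF.
  exists a, b; split=> // r ar rb; apply: contra nzab => /eqP <-.
  by rewrite ar rb.
have m0 : 0 < (a' + b') / 2.
  by rewrite divr_gt0 // addr_gt0 // ?(lt_le_trans a0) // (le_trans aa') // ltW.
have [r [Dr /=]] : (D `&` `]a', b'[) !=set0.
  apply: (dense m0); apply: open_nbhs_nbhs; split; first exact: itv_open.
  by rewrite /= in_itv /= !(midf_lt ab').
rewrite in_itv /= => /andP[ar rb].
have [|c] := @IVT R g 0 1 r ler01 cg.
  by rewrite -/a -/b (le_trans aa' (ltW ar)) (le_trans (ltW rb) bb').
rewrite in_itv /= => /andP[c0 c1] gc.
have [Vw [xiw zew]] := he _ (bseg c c0 c1).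
have {gc} : rho (y (seg c)) = r by [].
move: (seg c) Vw xiw zew => w Vw xiw zew gc.
have hr0 : h (rho (y w)) != 0.
  apply/negP => /eqP hw; have e1 := horizon _ (xB Vw) hw.
  by have := zc' r ar rb; rewrite -gc e1 eqxx.
have [U [Pf [Mf [frame Uw UB]]]] := bp_frame base (xB Vw) hr0.
pose V1 := V `&` [set v | U (y v)].
have oV1 : open V1.
  rewrite openE => v [Vv Uv]; apply: filterI; first exact: open_nbhs_nbhs.
  have dxv := smooth_on_differentiable sx Vv.
  have dy : differentiable (fun w => y w) v.
    exact: differentiable_comp dxv (differentiable_lsubmx _).
  apply: (differentiable_continuous dy).
  by apply: open_nbhs_nbhs; split => //; exact: (nc_open frame).
have [||||X [X1 [stat ric]]] := core_expression frame fc _ _ dh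
    (umbilic_patch_sub oV1 (@subIsetl _ _ _) patch) _ _ (conj Vw Uw) xiw zew.
- by move=> v /UB; exact: (bp_pos base).
- by move=> v /UB; exact: (bp_unit base).
- by move=> v [].
- by move=> v [Vv _]; exact: xN.
rewrite gc in stat ric.
have r0 : 0 < r by apply: lt_trans ar; exact: lt_le_trans aa'.
by have := generic Dr (xN Vw) X1 r0 stat; rewrite ric eqxx.
Qed.

End PatchDichotomy.

(** * Base pieces: class H *)

Lemma ord2_cases (A : 'I_2) : A = 0 \/ A = 1.
Proof. by case: A => [[|[|//]] lt]; [left|right]; exact: val_inj. Qed.

Lemma smooth_derivable (R : realType) (U : set R) (f : R -> R) r : open U -> smooth_on U f ->
  U r -> derivable f r 1 /\ derivable (derive1 f) r 1.
Proof.
move=> oU sf Ur; split.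
  by apply: diff_derivable; exact: smooth_on_differentiable sf Ur.
have -> : derive1 f = 'D_1 f by apply/funext => u; rewrite derive1E.
apply: diff_derivable.
exact: (smooth_on_differentiable (smooth_on_derive (1 : R) sf) Ur).
Qed.

Section Pieces.
Context {R : realType}.
Variables (h : R -> R) (rH : R).
Hypothesis hh : class_H_coefficient h rH.

Lemma class_H_derivable r : 0 < r -> derivable h r 1 /\ derivable (derive1 h) r 1.
Proof. exact: (smooth_derivable (@open_gt R 0) (ch_smooth hh)). Qed.

Let e_coord (A B : 'I_2) : (delta_mx 0 A : 'rV[R]_2) 0 B = (B == A)%:R.
Proof. by rewrite mxE. Qed.

Let bd := [set y : 'rV[R]_2 | rH < y 0 1].
Let bm (y : 'rV[R]_2) : 'M[R]_2 :=
  diag_mx (\row_(i < 2) (if i == 0 then - h (y 0 1) else (h (y 0 1))^-1)).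
Let rho (y : 'rV[R]_2) := y 0 1.

Let bmE y : [/\ bm y 0 0 = - h (y 0 1), bm y 0 1 = 0, bm y 1 0 = 0 &
  bm y 1 1 = (h (y 0 1))^-1].
Proof. by rewrite /bm !mxE. Qed.

Let open_bd : open bd.
Proof.
rewrite openE => y By.
have cy : {for y, continuous (fun y : 'rV[R]_2 => y 0 1)}.
  exact: differentiable_continuous (has_deriv_row_entry 1 y 0).1.
by apply: (cy [set r | rH < r]); apply: open_nbhs_nbhs; split => //; exact: open_gt.
Qed.

Let rho_gt0 y : bd y -> 0 < rho y.
Proof. by move=> By; exact: le_lt_trans (ch_radius hh) By. Qed.

Let h_neq0 y : bd y -> h (rho y) != 0.
Proof. by move=> By; rewrite gt_eqF // (ch_pos hh). Qed.

Let hh1 y v : bd y -> has_deriv (fun y : 'rV[R]_2 => h (y 0 1)) y v (derive1 h (y 0 1) * v 0 1).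
Proof.
move=> By; apply: (@has_deriv_comp1 _ _ h (fun y : 'rV[R]_2 => y 0 1)); last exact: has_deriv_row_entry.
by have [] := class_H_derivable (rho_gt0 By).
Qed.

Let P A (y : 'rV[R]_2) : R := if A == 0 :> 'I_2 then 1 else (h (y 0 1))^-1.
Let M A (y : 'rV[R]_2) : R := if A == 0 :> 'I_2 then -1 else (h (y 0 1))^-1.

Let has_deriv_P y v : bd y ->
  has_deriv (P 1) y v (- (derive1 h (y 0 1) * v 0 1) / h (y 0 1) ^+ 2).
Proof.
move=> By; apply: has_derivV; [exact: h_neq0|exact: hh1].
Qed.

(** The differentials of r* + t and r* - t, where r* is a primitive of 1/h. *)
Lemma class_H_frame : null_coframe h bm rho bd P M.
Proof.
have dP A y : bd y -> differentiable (P A) y.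
  move=> By; case: (ord2_cases A) => ->; first exact: differentiable_cst.
  by case: (has_deriv_P 0 By).
have dM A y : bd y -> differentiable (M A) y.
  move=> By; case: (ord2_cases A) => ->; first exact: differentiable_cst.
  by case: (has_deriv_P 0 By).
have D0 y v (c : R) : 'D_v (fun=> c) y = 0 :> R by exact: derive_cst.
have D1 y A : bd y -> A = 0 -> 'D_(delta_mx 0 A) (P 1) y = 0.
  move=> By ->; have [_ ->] := has_deriv_P (delta_mx 0 0) By.
  by rewrite e_coord mulr0 oppr0 mul0r.
split=> //.
- move=> A B y By; case: (ord2_cases A) => ->; case: (ord2_cases B) => -> //.
    by rewrite D1 // D0.
  by rewrite D1 // D0.
- move=> A B y By; case: (ord2_cases A) => ->; case: (ord2_cases B) => -> //.
    by rewrite [LHS]D1 // D0.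
  by rewrite [RHS]D1 // D0.
- move=> y By; rewrite /P /M /= mul1r mulrN1 opprK.
  have H : 0 < (h (y 0 1))^-1 by rewrite invr_gt0; exact: (ch_pos hh).
  by rewrite gt_eqF // addr_gt0.
- move=> A B y By; have [e00 e01 e10 e11] := bmE y; have h0 := h_neq0 By.
  case: (ord2_cases A) => ->; case: (ord2_cases B) => ->; rewrite ?e00 ?e01 ?e10 ?e11 /P /M /=.
  + by field.
  + by ring.
  + by ring.
  + by rewrite /rho in h0 *; field.
- move=> A y By; have h0 := h_neq0 By; apply: has_deriv_eq (has_deriv_row_entry 1 y _) _.
  rewrite e_coord; case: (ord2_cases A) => ->; rewrite /P /M /=.
    by rewrite subrr mulr0.
  by rewrite /rho in h0 *; field.
- move=> y By; split; first exact: h_neq0.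
  by have [] := class_H_derivable (rho_gt0 By).
Qed.

Lemma class_H_base_piece : base_piece h bd bm rho.
Proof.
split.
- by move=> y By; exact: differentiable_coord.
- by move=> A B y By; exact: (nc_diff_metric class_H_frame).
- by move=> y By; rewrite /bm tr_diag_mx.
- move=> y By; rewrite unitmxE det_diag unitfE; apply/prodf_neq0 => i _.
  rewrite mxE; case: ifP => _; first by rewrite oppr_eq0 h_neq0.
  by rewrite invr_eq0 h_neq0.
- exact: rho_gt0.
- exists 0 => y By /(_ 1).
  have [_ ->] := has_deriv_row_entry 1 y (delta_mx 0 1); rewrite e_coord => /eqP.
  by rewrite oner_eq0.
- by exists 0 => y By e; have := h_neq0 By; rewrite e eqxx.
- by move=> y By _; exists bd, P, M; split=> //; exact: class_H_frame.
Qed.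

End Pieces.

(** * Base pieces: Kruskal-Szekeres charts *)

Section KSPiece.
Context {R : realType}.
Variables (h : R -> R) (rH : R) (k : nat) (z : nat -> R) (Phi : nat -> R -> R).
Hypotheses (hh : class_H_coefficient h rH) (hz : simple_zeros h k z).
Hypothesis hPhi : forall l, (0 < l <= k)%N -> KS_solution h k z l (Phi l).

Lemma zeros_lt i j : (i < j)%N -> (j <= k)%N -> z i < z j.
Proof.
elim: j => // j IH; rewrite ltnS leq_eqVlt => /predU1P[->|ij] jk.
  exact: (sz_incr hz).
by apply: lt_trans (IH ij (ltnW jk)) _; exact: (sz_incr hz).
Qed.

Lemma zeros_le i j : (i <= j)%N -> (j <= k)%N -> z i <= z j.
Proof.
rewrite leq_eqVlt => /predU1P[->//|ij] jk; apply: ltW; exact: zeros_lt.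
Qed.

Section OneChart.
Variable l : nat.
Hypothesis hl : (0 < l <= k)%N.
Local Notation I := (KS_interval k z l).
Local Notation phi := (Phi l).
Local Notation phi' := (derive1 (Phi l)).
Local Notation C := (KS_const h z l).

Lemma KS_interval_gt0 r : I r -> 0 < r.
Proof.
case=> zr _; apply: le_lt_trans zr; rewrite -(sz_zero hz); apply: zeros_le => //.
by case/andP: hl => _; apply: leq_trans; exact: leq_pred.
Qed.

(** Each chart meets only one horizon. *)
Lemma KS_interval_zero r : I r -> h r = 0 -> r = z l.
Proof.
move=> Ir h0; have [j /andP[j0 jk] rj] := (sz_zeros hz (KS_interval_gt0 Ir)).1 h0.
case: Ir; rewrite rj => zl zr; have /andP[l0 lk] := hl.
have lj : (l <= j)%N.
  rewrite -(prednK l0) ltnNge; apply/negP => jl.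
  by move: zl; rewrite ltNge zeros_le // (leq_trans (leq_pred _) lk).
move: lj; rewrite leq_eqVlt => /predU1P[->//|lj].
have := zr (leq_trans lj jk); rewrite ltNge zeros_le //.
Qed.

Lemma KS_const_neq0 : C != 0.
Proof. by rewrite /KS_const invr_eq0; exact: (sz_simple hz). Qed.

Lemma open_KS_interval : open I.
Proof.
have [lk|lk] := boolP (l < k)%N.
  have -> : I = `]z l.-1, z l.+1[%classic.
    apply/seteqP; split=> r /=; rewrite in_itv /=.
      by case=> -> ->.
    by case/andP=> *; split.
  exact: itv_open.
have -> : I = [set r | z l.-1 < r].
  by apply/seteqP; split=> r /= => [[]//|zr]; split=> // lk'; rewrite lk' in lk.
exact: open_gt.
Qed.

Let sol := hPhi hl.

Lemma KS_solution_derivable r : I r -> is_derive r (1 : R) phi (phi' r).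
Proof.
move=> Ir; rewrite derive1E; apply/derivableP.
by have [] := smooth_derivable open_KS_interval (kss_smooth sol) Ir.
Qed.

Lemma KS_solution_neq0 r : I r -> phi' r != 0.
Proof. by case/(kss_ode sol). Qed.

Lemma KS_solutionE r : I r -> phi r = C * h r * phi' r.
Proof.
by move=> Ir; have [n e] := kss_ode sol Ir; rewrite -e divfK.
Qed.

Lemma KS_solution_inj r r' : I r -> I r' -> phi r = phi r' -> r = r'.
Proof.
move=> Ir Ir' e; have [lt|lt|//] := ltgtP r r'.
  by have := kss_incr sol Ir Ir' lt; rewrite e ltxx.
by have := kss_incr sol Ir' Ir lt; rewrite e ltxx.
Qed.

Let psi (w : R) : R := xget 0 [set r | I r /\ phi r = w].

Let psiK r : I r -> psi (phi r) = r.
Proof.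
move=> Ir; have [Ip pp] : [set r' | I r' /\ phi r' = phi r] (psi (phi r)).
  by apply: xgetPex; exists r.
exact: KS_solution_inj pp.
Qed.

Let near_I r : I r -> nbhs r I.
Proof. by move=> Ir; apply: open_nbhs_nbhs; split => //; exact: open_KS_interval. Qed.

Let near_can r : I r -> {near r, cancel phi psi}.
Proof. by move=> Ir; apply: filterS (near_I Ir) => w; exact: psiK. Qed.

Let near_cont r : I r -> {near r, continuous phi}.
Proof.
move=> Ir; apply: filterS (near_I Ir) => w Iw.
apply: differentiable_continuous; apply/derivable1_diffP.
by case: (KS_solution_derivable Iw).
Qed.

Let is_derive_psi r : I r -> is_derive (phi r) (1 : R) psi (phi' r)^-1.
Proof.
move=> Ir; apply: is_derive_inverse (near_can Ir) (near_cont Ir) _ _.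
  exact: KS_solution_derivable.
exact: KS_solution_neq0.
Qed.

Local Notation bd := (KS_domain k z Phi l).
Local Notation rho := (KS_rho k z Phi l).
Local Notation bm := (KS_metric h k z Phi l).

Lemma KS_rhoP (y : 'rV[R]_2) : bd y -> I (rho y) /\ phi (rho y) = y 0 0 * y 0 1.
Proof.
case=> r Ir e; apply: (@xgetPex _ 0 [set r | I r /\ phi r = y 0 0 * y 0 1]).
by exists r.
Qed.

Lemma KS_rho_eq (y : 'rV[R]_2) r : I r -> phi r = y 0 0 * y 0 1 -> bd y /\ rho y = r.
Proof.
move=> Ir e; split; first by exists r.
by rewrite /KS_rho -e; exact: psiK.
Qed.

Lemma KS_rho_gt0 y : bd y -> 0 < rho y.
Proof. by case/KS_rhoP => Ir _; exact: KS_interval_gt0. Qed.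

Let uv (y v : 'rV[R]_2) : has_deriv (fun y : 'rV[R]_2 => y 0 0 * y 0 1) y v
  (v 0 0 * y 0 1 + y 0 0 * v 0 1).
Proof. exact: has_derivM (has_deriv_row_entry 0 y v) (has_deriv_row_entry 1 y v). Qed.

Lemma has_deriv_KS_rho y v : bd y ->
  has_deriv rho y v ((phi' (rho y))^-1 * (v 0 0 * y 0 1 + y 0 0 * v 0 1)).
Proof.
move=> By; have [Ir e] := KS_rhoP By.
have [dpsi vpsi] := is_derive_psi Ir; rewrite e in dpsi vpsi.
have := @has_deriv_comp1 _ _ psi (fun y : 'rV[R]_2 => y 0 0 * y 0 1) _ _ _ dpsi (uv y v).
by rewrite derive1E vpsi.
Qed.

Lemma open_KS_domain : open bd.
Proof.
rewrite openE => y By; have [Ir e] := KS_rhoP By.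
have [_ nc] := near_can_continuousAcan_sym (near_can Ir) (near_cont Ir).
have [dpsi _] := is_derive_psi Ir.
have cpsi : {for phi (rho y), continuous psi}.
  exact/differentiable_continuous/derivable1_diffP.
have nI : \forall w \near phi (rho y), I (psi w).
  by apply: cpsi; rewrite psiK //; exact: near_I.
have nd : \forall w \near phi (rho y), (phi @` I) w.
  by apply: filterS2 nc nI => w cw Iw; exists (psi w).
have cuv : {for y, continuous (fun y : 'rV[R]_2 => y 0 0 * y 0 1)}.
  exact: differentiable_continuous (uv y 0).1.
by rewrite e in nd; exact: (cuv (phi @` I) nd).
Qed.

Let bmE y : [/\ bm y 0 0 = 0, bm y 0 1 = 2 * C / phi' (rho y),
  bm y 1 0 = 2 * C / phi' (rho y) & bm y 1 1 = 0].
Proof. by rewrite /KS_metric !mxE. Qed.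

Let diff_bm01 y : bd y -> differentiable (fun y => 2 * C / phi' (rho y)) y.
Proof.
move=> By; have [Ir e] := KS_rhoP By.
apply: differentiableM; first exact: differentiable_cst.
apply: differentiableV; last exact: KS_solution_neq0.
have [drho _] := has_deriv_KS_rho 0 By.
apply: (@differentiable_comp _ _ _ _ rho phi') => //.
apply/derivable1_diffP.
by have [] := smooth_derivable open_KS_interval (kss_smooth sol) Ir.
Qed.

Let U : set 'rV[R]_2 := [set y | bd y /\ y 0 0 * y 0 1 != 0].
Let P A (y : 'rV[R]_2) : R := if A == 0 :> 'I_2 then 2 * C / y 0 0 else 0.
Let M A (y : 'rV[R]_2) : R := if A == 0 :> 'I_2 then 0 else 2 * C / y 0 1.

Let U0 y : U y -> y 0 0 != 0 /\ y 0 1 != 0.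
Proof. by case=> _; rewrite mulf_eq0 negb_or => /andP[]. Qed.

Let hP y v : U y -> has_deriv (P 0) y v (2 * C * (- v 0 0 / y 0 0 ^+ 2)).
Proof.
case/U0 => u0 _; apply: has_derivZ.
by apply: has_derivV (has_deriv_row_entry 0 y v).
Qed.

Let hM y v : U y -> has_deriv (M 1) y v (2 * C * (- v 0 1 / y 0 1 ^+ 2)).
Proof.
case/U0 => _ v0; apply: has_derivZ.
by apply: has_derivV (has_deriv_row_entry 1 y v).
Qed.

(** Off the axes u v = 0, the differentials of 2 C ln |u| and 2 C ln |v|. *)
Lemma KS_frame : null_coframe h bm rho U P M.
Proof.
have D0 y v : 'D_v (fun=> 0) y = 0 :> R by exact: derive_cst.
have C0 := KS_const_neq0.
have hE y : U y -> h (rho y) = y 0 0 * y 0 1 / (C * phi' (rho y)).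
  case=> By _; have [Ir e] := KS_rhoP By; have n := KS_solution_neq0 Ir.
  by rewrite -e KS_solutionE //; field; rewrite C0 n.
have n0 y : U y -> phi' (rho y) != 0.
  by case=> By _; apply: KS_solution_neq0; case: (KS_rhoP By).
split.
- rewrite openE => y [By uv0]; apply: filterI.
    by apply: open_nbhs_nbhs; split => //; exact: open_KS_domain.
  exact: cvgr_neq0 (differentiable_continuous (uv y 0).1) uv0.
- move=> A y Uy; case: (ord2_cases A) => ->; last exact: differentiable_cst.
  by case: (hP 0 Uy).
- move=> A y Uy; case: (ord2_cases A) => ->; first exact: differentiable_cst.
  by case: (hM 0 Uy).
- move=> A B y Uy; case: (ord2_cases A) => ->; case: (ord2_cases B) => -> //.
    by rewrite [LHS]D0; have [_ ->] := hP (delta_mx 0 1) Uy; rewrite mxE oppr0 mul0r mulr0.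
  by rewrite [RHS]D0; have [_ ->] := hP (delta_mx 0 1) Uy; rewrite mxE oppr0 mul0r mulr0.
- move=> A B y Uy; case: (ord2_cases A) => ->; case: (ord2_cases B) => -> //.
    by rewrite [RHS]D0; have [_ ->] := hM (delta_mx 0 0) Uy; rewrite mxE oppr0 mul0r mulr0.
  by rewrite [LHS]D0; have [_ ->] := hM (delta_mx 0 0) Uy; rewrite mxE oppr0 mul0r mulr0.
- move=> y Uy; have [u0 v0] := U0 Uy; rewrite /P /M /= mul0r subr0.
  move: C0; move: (C) => c c0.
  by rewrite !(mulf_eq0, invr_eq0, pnatr_eq0) (negbTE c0) (negbTE u0) (negbTE v0).
- move=> A B y Uy; have [u0 v0] := U0 Uy; have [e00 e01 e10 e11] := bmE y.
  have np := n0 y Uy; rewrite (hE y Uy).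
  case: (ord2_cases A) => ->; case: (ord2_cases B) => ->;
    rewrite ?e00 ?e01 ?e10 ?e11 /P /M /=.
  + by ring.
  + by field; rewrite C0 np u0 v0.
  + by field; rewrite C0 np u0 v0.
  + by ring.
- move=> A y Uy; have [u0 v0] := U0 Uy; have np := n0 y Uy.
  apply: has_deriv_eq (has_deriv_KS_rho (delta_mx 0 A) Uy.1) _; rewrite (hE y Uy).
  case: (ord2_cases A) => ->; rewrite /P /M !mxE /=.
  + by field; rewrite C0 np u0.
  + by field; rewrite C0 np v0.
- move=> y Uy; split; last first.
    by have [] := class_H_derivable hh (KS_rho_gt0 Uy.1).
  rewrite (hE y Uy); have [u0 v0] := U0 Uy.
  move: C0; move: (C) => c c0.
  by rewrite !(mulf_eq0, invr_eq0) (negbTE c0) (negbTE u0) (negbTE v0) (negbTE (n0 y Uy)).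
Qed.

Lemma KS_base_piece : base_piece h bd bm rho.
Proof.
have b0 y : bd y -> 2 * C / phi' (rho y) != 0.
  move=> By; move: KS_const_neq0; move: (C) => c c0.
  rewrite !(mulf_eq0, invr_eq0, pnatr_eq0) (negbTE c0) /=.
  by apply: KS_solution_neq0; case: (KS_rhoP By).
split.
- by move=> y By; case: (has_deriv_KS_rho 0 By).
- move=> A B y By.
  have -> : (fun y => bm y A B) = (fun y => if A == B then 0 else 2 * C / phi' (rho y)).
    by apply/funext => w; rewrite mxE.
  by case: eqP => _; [exact: differentiable_cst|exact: diff_bm01].
- by move=> y By; apply/matrixP => A B; rewrite !mxE eq_sym.
- move=> y By; have [e00 e01 e10 e11] := bmE y.
  rewrite -row_free_unit; apply: inj_row_free => v vb.
  have := congr1 (fun w : 'rV[R]_2 => w 0 0) vb; have := congr1 (fun w : 'rV[R]_2 => w 0 1) vb.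
  rewrite mxE [RHS]mxE sum_ord2 e01 e11 mulr0 addr0 => /eqP.
  rewrite mulf_eq0 (negbTE (b0 _ By)) orbF => /eqP v0.
  rewrite mxE [RHS]mxE sum_ord2 e00 e10 mulr0 add0r => /eqP.
  rewrite mulf_eq0 (negbTE (b0 _ By)) orbF => /eqP v1.
  by apply/rowP => A; rewrite [RHS]mxE; case: (ord2_cases A) => ->.
- exact: KS_rho_gt0.
- exists 0 => y By crit; have [Ir _] := KS_rhoP By; have n := KS_solution_neq0 Ir.
  apply/rowP => A; rewrite [RHS]mxE; have := crit 0; have := crit 1.
  have [_ ->] := has_deriv_KS_rho (delta_mx 0 1) By.
  have [_ ->] := has_deriv_KS_rho (delta_mx 0 0) By.
  rewrite !mxE /= => /eqP; rewrite mulf_eq0 invr_eq0 (negbTE n) /= => /eqP e1.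
  move=> /eqP; rewrite mulf_eq0 invr_eq0 (negbTE n) /= => /eqP e0.
  by case: (ord2_cases A) => ->; lra.
- exists (z l) => y By h0; apply: KS_interval_zero => //.
  by case: (KS_rhoP By).
- move=> y By h0; exists U, P, M; split; [exact: KS_frame| |by move=> w []].
  split => //; have [Ir <-] := KS_rhoP By; rewrite KS_solutionE //.
  by move: KS_const_neq0 => c0; rewrite !mulf_eq0 (negbTE c0) (negbTE h0) /= KS_solution_neq0.
Qed.

End OneChart.
End KSPiece.

(** * Closure properties of smooth maps *)

Section CkClosure.
Context {R : realType}.

Lemma Ck_ext (X W : normedModType R) (U : set X) k (f g : X -> W) : open U ->
  (forall x, U x -> f x = g x) -> Ck k U f -> Ck k U g.
Proof.
move=> oU; elim: k f g => [|k IH] f g fg /=.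
  move=> cf x Ux; have nU := open_nbhs_nbhs (conj oU Ux).
  rewrite /prop_for /continuous_at -(fg x Ux); apply: cvg_trans (cf x Ux).
  by apply: near_eq_cvg; apply: filterS nU => w; exact: fg.
case=> df cf; split=> [x Ux|v].
  have nU := open_nbhs_nbhs (conj oU Ux).
  by apply: differentiable_near (df x Ux); apply: filterS nU => w; exact: fg.
apply: IH (cf v) => x Ux; have nU := open_nbhs_nbhs (conj oU Ux).
by apply: near_eq_derive; apply: filterS nU => w; exact: fg.
Qed.

Lemma smooth_on_coord (X : normedModType R) (U : set X) m (f : X -> 'rV[R]_m) i :
  open U -> smooth_on U f -> smooth_on U (fun x => f x 0 i : R).
Proof.
move=> oU sf k; move: (sf k.+1) => {sf}; elim: k f => [|k IH] f [df cf] /=.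
  by move=> x Ux; apply/differentiable_continuous/differentiable_entry; exact: df.
split=> [x Ux|v]; first by apply: differentiable_entry; exact: df.
apply: (@Ck_ext _ _ U k (fun x => 'D_v f x 0 i)) => //.
  by move=> x Ux; rewrite derive_row_coord //; exact: df.
exact: IH.
Qed.

(** One order is lost: continuity of f comes from differentiability of its
components, which is enough for smoothness. *)
Lemma smooth_on_row (X : normedModType R) (U : set X) m (f : X -> 'rV[R]_m) :
  open U -> (forall i, smooth_on U (fun x => f x 0 i : R)) -> smooth_on U f.
Proof.
move=> oU sf k; have {sf} : forall i, Ck k.+1 U (fun x => f x 0 i : R) by move=> i; exact: sf.
elim: k f => [|k IH] f sf.
  move=> x Ux; apply/differentiable_continuous/differentiable_row => i.
  by case: (sf i) => + _; apply.
have df x : U x -> differentiable f x.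
  by move=> Ux; apply: differentiable_row => i; case: (sf i) => + _; apply.
split=> // v; apply: IH => i; have sfv : Ck k.+1 U ('D_v (fun x => f x 0 i)).
  by case: (sf i) => _ /(_ v).
apply: (Ck_ext oU _ sfv) => x Ux.
by rewrite derive_row_coord //; exact: df.
Qed.

Lemma smooth_on_comp_linear (X Y W : normedModType R) (U : set Y) (f : Y -> W)
    (L : {linear X -> Y}) :
  continuous L -> smooth_on U f -> smooth_on (L @^-1` U) (fun x => f (L x)).
Proof.
move=> cL sf k; move: (sf k) => {sf}; elim: k f => [|k IH] f /=.
  move=> cf x Ux; apply: (@continuous_comp _ _ _ L f); [exact: cL|exact: cf].
case=> df cf; split=> [x Ux|v].
  apply: (@differentiable_comp _ _ _ _ L f); last exact: df.
  exact: linear_differentiable.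
have -> : 'D_v (fun x => f (L x)) = (fun x => 'D_(L v) f (L x)).
  by apply/funext => x; rewrite derive_comp_linear.
exact: (IH ('D_(L v) f) (cf (L v))).
Qed.

(** The powers K (s u)^g of one coordinate are closed under differentiation, so
one induction covers all orders. *)
Lemma smooth_on_power m (A : 'I_m) (s K g : R) :
  smooth_on [set y : 'rV[R]_m | 0 < s * y 0 A]
    (fun y : 'rV[R]_m => K * expR (g * ln (s * y 0 A))).
Proof.
set U := [set y | _].
have coord (y v : 'rV[R]_m) : has_deriv (fun y : 'rV[R]_m => s * y 0 A) y v (s * v 0 A).
  by apply: has_derivZ; exact: has_deriv_row_entry.
have oU : open U.
  rewrite openE => y Uy.
  have cy : {for y, continuous (fun y : 'rV[R]_m => s * y 0 A)}.
    exact: differentiable_continuous (coord y 0).1.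
  by apply: (cy [set r | 0 < r]); apply: open_nbhs_nbhs; split => //; exact: open_gt.
have D K' g' y v : U y -> has_deriv (fun y : 'rV[R]_m => K' * expR (g' * ln (s * y 0 A))) y v
    (K' * g' * (s * v 0 A) * expR ((g' - 1) * ln (s * y 0 A))).
  move=> Uy; have dl : is_derive (s * y 0 A) (1 : R) (@ln R) (s * y 0 A)^-1.
    exact: is_derive1_ln.
  have hl := @has_deriv_comp1 _ _ (@ln R) (fun y : 'rV[R]_m => s * y 0 A) y v _
    (@ex_derive _ _ _ _ _ _ _ dl) (coord y v).
  have he := has_derivZ K' (@has_deriv_comp1 _ _ (@expR R) _ y v _
     (@derivable_expR R _) (has_derivZ g' hl)).
  apply: has_deriv_eq he _.
  have [_ el] := dl; have [_ ee] := is_derive_expR (g' * ln (s * y 0 A)).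
  rewrite !derive1E el ee.
  rewrite mulrBl mul1r expRB lnK //; by ring.
move=> k; elim: k K g => [|k IH] K g.
  by move=> y Uy; apply: differentiable_continuous; case: (D K g y 0 Uy).
split=> [y Uy|v]; first by case: (D K g y 0 Uy).
apply: (@Ck_ext _ _ U k
  (fun y : 'rV[R]_m => K * g * (s * v 0 A) * expR ((g - 1) * ln (s * y 0 A)))) => //.
by move=> y Uy; have [_ ->] := D K g y v Uy.
Qed.

End CkClosure.

(** * Transition maps of warped products *)

Section WarpedTransition.
Context {R : realType} {N : topologicalType} {d : nat} (gN : atlas R N d).
Variables (S : warped R N).

Definition base_transition (a b : piece S) (y y' : 'rV[R]_2) : Prop :=
  exists VB tauB, [/\ open VB, VB y, tauB y = y', smooth_on VB tauB &
    forall w, VB w -> [/\ bdom a w, bdom b (tauB w) &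
      forall p, emb b (tauB w) p = emb a w p]].

Section Product.
Variables (a b : piece S) (c c' : chart gN).
Variables (VB : set 'rV[R]_2) (tauB : 'rV[R]_2 -> 'rV[R]_2).
Variables (VN : set 'rV[R]_d) (tauN : 'rV[R]_d -> 'rV[R]_d).
Hypotheses (oVB : open VB) (sB : smooth_on VB tauB)
  (hB : forall w, VB w -> [/\ bdom a w, bdom b (tauB w) &
      forall p, emb b (tauB w) p = emb a w p])
  (hN : transition c c' VN tauN).

Let tau (x : 'rV[R]_(2 + d)) : 'rV[R]_(2 + d) :=
  row_mx (tauB (lsubmx x)) (tauN (rsubmx x)).
Let V : set 'rV[R]_(2 + d) := [set x | VB (lsubmx x) /\ VN (rsubmx x)].

Let oVN : open VN. Proof. by case: hN. Qed.
Let sN : smooth_on VN tauN. Proof. by case: hN. Qed.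

Let oV : open V.
Proof.
rewrite openE => x [Bx Nx]; apply: filterI.
  exact: (@continuous_lsubmx R 1 2 d x VB (open_nbhs_nbhs (conj oVB Bx))).
exact: (@continuous_rsubmx R 1 2 d x VN (open_nbhs_nbhs (conj oVN Nx))).
Qed.

Let sV : smooth_on V tau.
Proof.
apply: smooth_on_row => // i; rewrite -(fintype.splitK i).
case: (fintype.split i) => A /=.
  have -> : (fun x => tau x 0 (lshift d A)) = (fun x => tauB (lsubmx x) 0 A).
    by apply/funext => x; rewrite row_mxEl.
  have := @smooth_on_comp_linear R _ _ _ VB (fun y => tauB y 0 A : R)
    (@lsubmx R 1 2 d) (@continuous_lsubmx R 1 2 d) (smooth_on_coord A oVB sB).
  by apply: smooth_on_sub => x [].
have -> : (fun x => tau x 0 (rshift 2 A)) = (fun x => tauN (rsubmx x) 0 A).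
  by apply/funext => x; rewrite row_mxEr.
have := @smooth_on_comp_linear R _ _ _ VN (fun y => tauN y 0 A : R)
  (@rsubmx R 1 2 d) (@continuous_rsubmx R 1 2 d) (smooth_on_coord A oVN sN).
by apply: smooth_on_sub => x [].
Qed.

Lemma warped_transition : transition (A := warped_atlas gN S) (a, c) (b, c') V tau.
Proof.
have [_ VNd _ hNt] := hN; split=> //.
  by move=> x [/hB[Ba _ _] /VNd Nd]; split.
move=> x [/hB[_ Bb eB] /hNt[Nd eN]]; rewrite /= /tau row_mxKl row_mxKr.
by split; [split|rewrite eN eB].
Qed.

Variable P : set (carrier S).
Variables (n : nat) (eta : vfield (warped_atlas gN S)).
Hypothesis hn : unit_normal n P eta.

Lemma normal_transition x : VB (lsubmx x) -> VN (rsubmx x) ->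
  P (par (a := warped_atlas gN S) (a, c) x) ->
  (lsubmx (eta (a, c) x) = 0 -> lsubmx (eta (b, c') (tau x)) = 0) /\
  (rsubmx (eta (a, c) x) = 0 -> rsubmx (eta (b, c') (tau x)) = 0).
Proof.
move=> Bx Nx Px; have Vx : V x by [].
have := un_tensor hn warped_transition Vx Px.
set v := eta (a, c) x; have dt := smooth_on_differentiable sV Vx.
rewrite -deriveEjacobian // => ->.
split=> v0; apply/rowP => A; rewrite !mxE derive_row_coord //.
  have -> : (fun x => tau x 0 (lshift d A)) = (fun x => tauB (lsubmx x) 0 A).
    by apply/funext => w; rewrite row_mxEl.
  by rewrite (derive_comp_linear (@lsubmx R 1 2 d) (fun y => tauB y 0 A)) /= v0 derive0.
have -> : (fun x => tau x 0 (rshift 2 A)) = (fun x => tauN (rsubmx x) 0 A).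
  by apply/funext => w; rewrite row_mxEr.
by rewrite (derive_comp_linear (@rsubmx R 1 2 d) (fun y => tauN y 0 A)) /= v0 derive0.
Qed.

End Product.

(** Transition maps of a warped product are products, so their Jacobians preserve
the splitting of vectors into base and fibre parts. *)
Lemma normal_type_transition (hN : compact_riemannian gN) n (P : set (carrier S))
    (eta : vfield (warped_atlas gN S)) (hn : unit_normal n P eta)
    (a b : piece S) (c c' : chart gN) (x x' : 'rV[R]_(2 + d)) :
  base_transition a b (lsubmx x) (lsubmx x') ->
  dom c (rsubmx x) -> dom c' (rsubmx x') ->
  par c (rsubmx x) = par c' (rsubmx x') ->
  P (par (a := warped_atlas gN S) (a, c) x) ->
  (lsubmx (eta (a, c) x) = 0 -> lsubmx (eta (b, c') x') = 0) /\
  (rsubmx (eta (a, c) x) = 0 -> rsubmx (eta (b, c') x') = 0).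
Proof.
move=> [VB [tauB [oVB Bx eB sB hB]]] Nx Nx' eN Px.
have [VN [tauN [trN VNx]]] := cr_transition hN Nx Nx' eN.
have eN' : tauN (rsubmx x) = rsubmx x'.
  have [_ injc' _ _] := cr_chart hN c'.
  have [_ _ _ /(_ _ VNx)[Nt pt]] := trN.
  by apply: injc'; rewrite ?inE // pt.
have := normal_transition oVB sB hB trN hn Bx VNx Px.
by rewrite eB eN' hsubmxK.
Qed.

End WarpedTransition.

(** * Gluing maps *)

Lemma smooth_on_cst (R : realType) (X W : normedModType R) (U : set X) (c : W) :
  smooth_on U (fun=> c).
Proof.
move=> k; elim: k c => [|k IH] c /=; first by move=> x _; exact: cvg_cst.
split=> [x _|v]; first exact: differentiable_cst.
have -> : 'D_v (fun=> c : W) = (fun=> 0) by apply/funext => x; exact: derive_cst.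
exact: IH.
Qed.

Lemma smooth_on_id (R : realType) (X : normedModType R) (U : set X) :
  smooth_on U (@id X).
Proof.
case=> [|k] /=; first by move=> x _; exact: cvg_id.
split=> // v; have -> : 'D_v (@id X) = (fun=> v) by apply/funext => x; exact: derive_id.
exact: smooth_on_cst.
Qed.

Lemma class_H_overlap (R : realType) (N : topologicalType) (h : R -> R) (rH : R)
    (y y' : 'rV[R]_2) (p p' : N) (S := class_H_spacetime h rH N) :
  bdom (w := S) tt y -> emb (w := S) tt y p = emb (w := S) tt y' p' ->
  p = p' /\ base_transition (S := S) tt tt y y'.
Proof.
move=> By [e0 e1 ep]; split=> //.
have ey : y = y'.
  by apply/rowP => A; case: (ord2_cases A) => ->.
exists [set y : 'rV[R]_2 | rH < y 0 1], id; split=> //.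
- rewrite openE => w Bw.
  have cy : {for w, continuous (fun y : 'rV[R]_2 => y 0 1)}.
    exact/differentiable_continuous/differentiable_coord.
  by apply: (cy [set r | rH < r]); apply: open_nbhs_nbhs; split => //; exact: open_gt.
- exact: smooth_on_id.
Qed.

Section Signs.
Context {R : realType}.

Definition sign_of (b : bool) : R := if b then 1 else -1.

Lemma sign_of_sqr b : sign_of b * sign_of b = 1.
Proof. by case: b; rewrite /sign_of ?mulr1 // mulrNN mulr1. Qed.

(** On a quadrant, time and any primitive of 1/h are linear in the logarithms of
|u| and |v|, so that the gluing maps become affine in these. *)
Definition log_u (q : bool * bool) (y : 'rV[R]_2) := ln (sign_of q.1 * y 0 0).
Definition log_v (q : bool * bool) (y : 'rV[R]_2) := ln (sign_of q.2 * y 0 1).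

Lemma quadrantE q (y : 'rV[R]_2) :
  quadrant q y <-> 0 < sign_of q.1 * y 0 0 /\ 0 < sign_of q.2 * y 0 1.
Proof.
by rewrite /quadrant /sign_of /=; case: q => [[] []] /=; rewrite ?mul1r ?mulN1r ?oppr_gt0.
Qed.

Lemma quadrant_uE q (y : 'rV[R]_2) : quadrant q y ->
  y 0 0 = sign_of q.1 * expR (log_u q y).
Proof. by case/quadrantE => u _; rewrite /log_u lnK // mulrA sign_of_sqr mul1r. Qed.

Lemma quadrant_vE q (y : 'rV[R]_2) : quadrant q y ->
  y 0 1 = sign_of q.2 * expR (log_v q y).
Proof. by case/quadrantE => _ v; rewrite /log_v lnK // mulrA sign_of_sqr mul1r. Qed.

Lemma quadrant_uvE q (y : 'rV[R]_2) : quadrant q y ->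
  y 0 0 * y 0 1 = (if q.1 == q.2 then 1 else -1) * expR (log_u q y + log_v q y).
Proof.
move=> qy; rewrite (quadrant_uE qy) (quadrant_vE qy) mulrACA -expRD; congr (_ * _).
by case: q {qy} => [[] []]; rewrite /sign_of /= ?mulr1 ?mul1r ?mulrNN ?mulr1.
Qed.

Lemma KS_timeE h z l q (y : 'rV[R]_2) : quadrant q y ->
  KS_time h z l y = KS_const h z l * (log_v q y - log_u q y).
Proof.
move=> qy; rewrite /KS_time; congr (_ * _).
rewrite (quadrant_uE qy) (quadrant_vE qy) invfM mulrACA normrM -expRN -expRD.
have n1 b : `|sign_of b| = 1 by case: b; rewrite /sign_of ?normrN normr1.
rewrite [`|_ / _|]normrM normfV !n1 invr1 !mul1r.
by rewrite ger0_norm ?expR_ge0 // expRK.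
Qed.

End Signs.

Section Gluing.
Context {R : realType}.
Variables (h : R -> R) (k : nat) (z : nat -> R) (Phi : nat -> R -> R).
Hypothesis hz : simple_zeros h k z.
Hypothesis hPhi : forall l, (0 < l <= k)%N -> KS_solution h k z l (Phi l).

Section Overlap.
Variable l : nat.
Hypotheses (l0 : (0 < l)%N) (lk : (l < k)%N).

Let hl : (0 < l <= k)%N. Proof. by rewrite l0 ltnW. Qed.
Let hl1 : (0 < l.+1 <= k)%N. Proof. by []. Qed.

Let region := [set r | z l < r < z l.+1].

Let region_l r : region r -> KS_interval k z l r.
Proof.
case/andP=> zr rz; split=> //; apply: le_lt_trans zr.
by apply: (zeros_le hz) (leq_pred _) (ltnW lk).
Qed.

Let region_l1 r : region r -> KS_interval k z l.+1 r.
Proof.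
case/andP=> zr rz; split=> // lk1; apply: lt_trans rz _.
exact: (sz_incr hz).
Qed.

Let zeroE j : (0 < j <= k)%N -> KS_interval k z j (z j) /\ Phi j (z j) = 0.
Proof.
move=> hj; have /andP[j0 jk] := hj.
have Ij : KS_interval k z j (z j).
  split=> [|jk']; last exact: (sz_incr hz).
  by rewrite -[X in _ < z X](prednK j0); apply: (sz_incr hz); rewrite prednK.
split=> //; rewrite (KS_solutionE hPhi hj Ij).
have zj0 := KS_interval_gt0 hz hj Ij.
by rewrite ((sz_zeros hz zj0).2 _) ?mulr0 ?mul0r //; exists j.
Qed.

Let inner_gt0 r : region r -> 0 < Phi l r.
Proof.
move=> Rr; have [Iz <-] := zeroE hl.
by apply: (kss_incr (hPhi hl)) => //; [exact: region_l|case/andP: Rr].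
Qed.

Let outer_lt0 r : region r -> Phi l.+1 r < 0.
Proof.
move=> Rr; have [Iz <-] := zeroE hl1.
by apply: (kss_incr (hPhi hl1)) => //; [exact: region_l1|case/andP: Rr].
Qed.

Definition glue_exponent : R := KS_const h z l / KS_const h z l.+1.
Local Notation g := glue_exponent.

Let log_ratio r := ln (- Phi l.+1 r) - g * ln (Phi l r).

(** Both logarithms are multiples of a primitive of 1/h. *)
Let is_derive_log_ratio r : region r -> is_derive r (1 : R) log_ratio 0.
Proof.
move=> Rr; have I1 := region_l Rr; have I2 := region_l1 Rr.
have hasPhi j : (0 < j <= k)%N -> KS_interval k z j r ->
    has_deriv (Phi j) r (1 : R) (derive1 (Phi j) r).
  move=> hj Ij; have [dP <-] := KS_solution_derivable hPhi hj Ij.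
  by apply: has_derivP; exact/derivable1_diffP.
have dln u : 0 < u -> derivable (@ln R) u 1 /\ derive1 (@ln R) u = u^-1.
  by move=> u0; have [dl el] := is_derive1_ln u0; rewrite derive1E.
have p1 := inner_gt0 Rr; have n2 : 0 < - Phi l.+1 r by rewrite oppr_gt0 outer_lt0.
have [dl1 el1] := dln _ p1; have [dl2 el2] := dln _ n2.
have H1 := @has_deriv_comp1 _ _ (@ln R) _ r _ _ dl1 (hasPhi _ hl I1).
have H2 := @has_deriv_comp1 _ _ (@ln R) _ r _ _ dl2 (has_derivN (hasPhi _ hl1 I2)).
have H := has_derivB H2 (has_derivZ g H1).
apply: has_deriv_is_derive; apply: has_deriv_eq H _.
rewrite el1 el2 (KS_solutionE hPhi hl I1) (KS_solutionE hPhi hl1 I2).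
have n1' := KS_solution_neq0 hPhi hl I1; have n2' := KS_solution_neq0 hPhi hl1 I2.
have h0 : h r != 0.
  apply/eqP => h0; have := inner_gt0 Rr.
  by rewrite (KS_solutionE hPhi hl I1) h0 mulr0 mul0r ltxx.
rewrite /g; have := KS_const_neq0 hz hl; have := KS_const_neq0 hz hl1.
move: (KS_const h z l) (KS_const h z l.+1) => c1 c2 c20 c10.
by field; rewrite n1' n2' h0 c10 c20.
Qed.

Let log_ratio_le r r0 : region r -> region r0 -> r0 <= r -> log_ratio r = log_ratio r0.
Proof.
move=> Rr Rr0 r0r.
have sub w : r0 <= w -> w <= r -> region w.
  case/andP: Rr => _ r2; case/andP: Rr0 => r1 _ w1 w2.
  by apply/andP; split; [exact: lt_le_trans w1|exact: le_lt_trans r2].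
have [||c _] := @MVT_segment R log_ratio (fun=> 0) r0 r r0r.
- move=> w; rewrite in_itv /= => /andP[w1 w2].
  by apply: is_derive_log_ratio; apply: sub; exact: ltW.
- apply: derivable_within_continuous => w; rewrite in_itv /= => /andP[w1 w2].
  by case: (is_derive_log_ratio (sub _ w1 w2)).
by rewrite mul0r => /eqP; rewrite subr_eq0 => /eqP.
Qed.

Let log_ratio_cst r r0 : region r -> region r0 -> log_ratio r = log_ratio r0.
Proof.
move=> Rr Rr0; have [r0r|/ltW rr0] := leP r0 r; first exact: log_ratio_le.
by apply/esym; exact: log_ratio_le.
Qed.

Variables (q q' : bool * bool).
Hypotheses (hq : q.1 = q.2) (hq' : q'.1 != q'.2).
Variables (y y' : 'rV[R]_2).
Hypotheses (By : KS_domain k z Phi l y) (qy : quadrant q y).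
Hypotheses (By' : KS_domain k z Phi l.+1 y') (qy' : quadrant q' y').
Hypotheses (er : KS_rho k z Phi l y = KS_rho k z Phi l.+1 y')
  (et : KS_time h z l y = KS_time h z l.+1 y').

Let quadrant_region w : KS_domain k z Phi l w -> quadrant q w ->
  region (KS_rho k z Phi l w) /\ ln (Phi l (KS_rho k z Phi l w)) = log_u q w + log_v q w.
Proof.
move=> Bw qw; have [Ir e] := KS_rhoP Bw.
have e1 : Phi l (KS_rho k z Phi l w) = expR (log_u q w + log_v q w).
  by rewrite e (quadrant_uvE qw) hq eqxx mul1r.
split; last by rewrite e1 expRK.
apply/andP; split; last by case: Ir => _; apply.
rewrite ltNge; apply/negP => rz; have [Iz z0] := zeroE hl.
have : 0 < Phi l (KS_rho k z Phi l w) by rewrite e1 expR_gt0.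
move: rz; rewrite le_eqVlt => /predU1P[->|rz]; first by rewrite z0 ltxx.
by have := kss_incr (hPhi hl) Ir Iz rz; rewrite z0 => /lt_trans H /H; rewrite ltxx.
Qed.

Let r0 := KS_rho k z Phi l y.
Let del := log_ratio r0 / 2.
Let VB : set 'rV[R]_2 := [set w | KS_domain k z Phi l w /\ quadrant q w].
Let tauB (w : 'rV[R]_2) : 'rV[R]_2 := \row_A (if A == 0
  then (sign_of q'.1 * expR del) * expR (g * ln (sign_of q.1 * w 0 0))
  else (sign_of q'.2 * expR del) * expR (g * ln (sign_of q.2 * w 0 1))).

Let tauB0 w : tauB w 0 0 = sign_of q'.1 * expR (g * log_u q w + del).
Proof. by rewrite mxE /= -mulrA -expRD addrC. Qed.

Let tauB1 w : tauB w 0 1 = sign_of q'.2 * expR (g * log_v q w + del).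
Proof. by rewrite mxE /= -mulrA -expRD addrC. Qed.

Let quadrant_tauB w : [/\ quadrant q' (tauB w), log_u q' (tauB w) = g * log_u q w + del &
  log_v q' (tauB w) = g * log_v q w + del].
Proof.
rewrite /log_u /log_v tauB0 tauB1 !mulrA !sign_of_sqr !mul1r !expRK; split=> //.
by apply/quadrantE; rewrite tauB0 tauB1 !mulrA !sign_of_sqr !mul1r !expR_gt0.
Qed.

Let tauB_rho w : VB w -> KS_domain k z Phi l.+1 (tauB w) /\
  KS_rho k z Phi l.+1 (tauB w) = KS_rho k z Phi l w.
Proof.
case=> Bw qw; have [Rw elog] := quadrant_region Bw qw.
have [qt eu ev] := quadrant_tauB w.
apply: (KS_rho_eq hPhi hl1); first exact: region_l1.
rewrite (quadrant_uvE qt) (negbTE hq') eu ev mulN1r.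
have [Ry _] := quadrant_region By qy.
have := log_ratio_cst Rw Ry; rewrite /log_ratio elog -/(log_ratio r0) => e.
have -> : g * log_u q w + del + (g * log_v q w + del) =
    ln (- Phi l.+1 (KS_rho k z Phi l w)).
  have -> : ln (- Phi l.+1 (KS_rho k z Phi l w)) =
     log_ratio r0 + g * (log_u q w + log_v q w) by rewrite -e subrK.
  by rewrite /del; field.
by rewrite lnK ?opprK // posrE oppr_gt0 outer_lt0.
Qed.

Let tauB_time w : quadrant q w -> KS_time h z l.+1 (tauB w) = KS_time h z l w.
Proof.
move=> qw; have [qt eu ev] := quadrant_tauB w.
rewrite (KS_timeE _ _ _ qt) (KS_timeE _ _ _ qw) eu ev /g.
have := KS_const_neq0 hz hl1; move: (KS_const h z l) (KS_const h z l.+1) => c1 c2 c20.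
by field.
Qed.

(** The radius fixes log u + log v and the time fixes log v - log u. *)
Let tauBy : tauB y = y'.
Proof.
have [qt eu ev] := quadrant_tauB y.
have [Bt rt] := tauB_rho (conj By qy).
have [_ e1] := KS_rhoP Bt; have [_ e2] := KS_rhoP By'.
have sum : log_u q' (tauB y) + log_v q' (tauB y) = log_u q' y' + log_v q' y'.
  have := quadrant_uvE qt; have := quadrant_uvE qy'.
  rewrite -e1 -e2 -er rt (negbTE hq') !mulN1r => -> /oppr_inj /expR_inj //.
have diff : log_v q' (tauB y) - log_u q' (tauB y) = log_v q' y' - log_u q' y'.
  apply: (mulfI (KS_const_neq0 hz hl1)).
  by rewrite -(KS_timeE _ _ _ qt) -(KS_timeE _ _ _ qy') tauB_time.
have lu : log_u q' (tauB y) = log_u q' y' by lra.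
have lv : log_v q' (tauB y) = log_v q' y' by lra.
apply/rowP => A; case: (ord2_cases A) => ->.
  by rewrite (quadrant_uE qt) (quadrant_uE qy') lu.
by rewrite (quadrant_vE qt) (quadrant_vE qy') lv.
Qed.

Let VBE : VB = KS_domain k z Phi l `&` ([set w : 'rV[R]_2 | 0 < sign_of q.1 * w 0 0]
   `&` [set w : 'rV[R]_2 | 0 < sign_of q.2 * w 0 1]).
Proof.
by apply/seteqP; split=> w /= [Bw /quadrantE].
Qed.

Let oVB : open VB.
Proof.
have oc (A : 'I_2) (c : R) : open [set w : 'rV[R]_2 | 0 < c * w 0 A].
  rewrite openE => w Bw.
  have cy : {for w, continuous (fun w : 'rV[R]_2 => c * w 0 A)}.
    apply: differentiable_continuous; apply: differentiableM.
      exact: differentiable_cst.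
    exact: differentiable_coord.
  by apply: (cy [set r | 0 < r]); apply: open_nbhs_nbhs; split => //; exact: open_gt.
by rewrite VBE; apply: openI; [exact: (open_KS_domain hPhi hl)|apply: openI].
Qed.

(** The gluing of two charts multiplies ln |u| and ln |v| by the same factor and
adds the same constant: it maps u and v to constant multiples of powers of |u| and |v|. *)
Lemma KS_gluing_map : exists VB tauB, [/\ open VB, VB y, tauB y = y', smooth_on VB tauB &
  forall w, VB w -> [/\ KS_domain k z Phi l w, KS_domain k z Phi l.+1 (tauB w),
     quadrant q w, quadrant q' (tauB w) &
     KS_rho k z Phi l w = KS_rho k z Phi l.+1 (tauB w) /\
     KS_time h z l w = KS_time h z l.+1 (tauB w)]].
Proof.
exists VB, tauB; split=> //.
  apply: smooth_on_row => // A.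
  have [->|->] := ord2_cases A.
    have -> : (fun w => tauB w 0 0) =
      (fun w : 'rV[R]_2 => (sign_of q'.1 * expR del) * expR (g * ln (sign_of q.1 * w 0 0))).
      by apply/funext => w; rewrite mxE.
    by apply: smooth_on_sub (smooth_on_power _ _ _ _) => w /=; rewrite VBE => -[_ []].
  have -> : (fun w => tauB w 0 1) =
      (fun w : 'rV[R]_2 => (sign_of q'.2 * expR del) * expR (g * ln (sign_of q.2 * w 0 1))).
    by apply/funext => w; rewrite mxE.
  by apply: smooth_on_sub (smooth_on_power _ _ _ _) => w /=; rewrite VBE => -[_ []].
move=> w [Bw qw]; have [Bt rt] := tauB_rho (conj Bw qw).
have [qt _ _] := quadrant_tauB w.
by split=> //; rewrite rt tauB_time.
Qed.

End Overlap.
End Gluing.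

(** * From patches to the whole surface *)

(** The interface between the spacetimes at hand and the argument: every base
piece carries null coordinates, and overlapping pieces are related by smooth
maps of the bases. *)
Definition admissible_base (R : realType) (N : topologicalType) (h : R -> R)
    (S : warped R N) : Prop :=
  (forall a : piece S, base_piece h (bdom a) (bmet a) (brad a)) /\
  (forall (a b : piece S) y y' p p', bdom a y -> bdom b y' ->
     emb a y p = emb b y' p' ->
     p = p' /\ (base_transition a b y y' \/ base_transition b a y' y)).

Section Extension.
Context {R : realType} {N : topologicalType}.
Variables (h : R -> R) (rH : R) (k : nat) (z : nat -> R) (Phi : nat -> R -> R).
Hypotheses (hh : class_H_coefficient h rH) (hz : simple_zeros h k z).
Hypothesis hPhi : forall l, (0 < l <= k)%N -> KS_solution h k z l (Phi l).
Variable E : KS_extension h k z Phi N.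

Lemma KS_glued_transition (a b : ks_copy E) y y' :
  KS_domain k z Phi (ks_label a) y -> KS_domain k z Phi (ks_label b) y' ->
  KS_glued h k z Phi (@ks_label _ _ _ _ _ _ E) (@ks_glue _ _ _ _ _ _ E) a b y y' ->
  base_transition (S := KS_spacetime E) a b y y'.
Proof.
move=> By By' [q [q' [glue qy qy' er et]]].
have [lb hq hq'] := ks_glue_label glue.
have /andP[l0 _] := ks_label_range a; have /andP[_ lk] := ks_label_range b.
rewrite lb in lk By' er et.
have [VB [tauB [oVB VBy ey sB hB]]] := KS_gluing_map hz hPhi l0 lk hq hq' By qy By' qy' er et.
exists VB, tauB; split=> // w /hB[Bw Bt qw qt [rt tt]].
have Bt' : KS_domain k z Phi (ks_label b) (tauB w) by rewrite lb.
split=> // p; apply/esym/(ks_overlap p p Bw Bt'); split=> //.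
by apply: Or32; exists q, q'; split=> //; rewrite lb.
Qed.

Lemma KS_admissible : admissible_base h (KS_spacetime E).
Proof.
split=> [a|a b y y' p p' By By' e].
  exact: (KS_base_piece hh hz hPhi (ks_label_range a)).
have [-> cases] := (ks_overlap p p' By By').1 e; split=> //.
case: cases => [[ab yy']|glued|glued].
- left; subst b y'; exists (KS_domain k z Phi (ks_label a)), id; split=> //.
    exact: (open_KS_domain hPhi (ks_label_range a)).
  exact: smooth_on_id.
- by left; exact: KS_glued_transition.
- by right; exact: KS_glued_transition.
Qed.

End Extension.

Lemma class_H_admissible (R : realType) (N : topologicalType) (h : R -> R) (rH : R)
    (S : warped R N) : class_H_coefficient h rH -> class_H_or_extension h rH S ->
  admissible_base h S.
Proof.
move=> hh []; last by move=> k z Phi E hz _ hPhi; exact: (KS_admissible hh hz hPhi).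
split=> [a|[] [] y y' p p' By By' e]; first exact: (class_H_base_piece hh).
by have [-> tr] := class_H_overlap By e; split=> //; left.
Qed.

Section PhotonSurface.
Context {R : realType} {d : nat} {N : topologicalType}.
Variables (gN : atlas R N d) (h : R -> R) (S : warped R N).
Variables (P : set (carrier S)) (eta : vfield (warped_atlas gN S)).
Variables (lambda : carrier S -> R) (l0 : R).
Hypotheses (hN : compact_riemannian gN) (adm : admissible_base h S).
Hypotheses (hP : photon_surface d.+1 P eta lambda)
  (lambdaE : forall p, P p -> lambda p = l0).
Local Notation A := (warped_atlas gN S).
Local Notation param := (local_param (A := A) (n := d.+1) P).

Lemma local_param_mem (c : chart A) V x s : param c V x -> V s -> P (par c (x s)).
Proof.
move=> lp Vs; have [W _ eW] := lp_homeo lp (lp_open lp) (@subset_refl _ V).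
have : [set par c (x s) | s in V] (par c (x s)) by exists s.
by rewrite eW => -[].
Qed.

Lemma photon_patch (c : chart A) V x : param c V x ->
  umbilic_patch (bmet c.1) (brad c.1) (met c.2) V x (fun s => eta c (x s)) l0.
Proof.
move=> lp; have [hb _] := adm; have base := hb c.1.
have fc := fibre_chart_riemannian c.2 hN.
have un := ps_normal hP.
split; [exact: lp_open lp|exact: lp_smooth lp|exact: (un_smooth un lp)|
  exact: lp_immersion lp|exact: (un_unit un lp)|exact: (un_normal un lp)|].
move=> s a k Vs; have [Bs Ns] := lp_dom lp Vs.
have nV : nbhs s V by apply: open_nbhs_nbhs; split=> //; exact: (lp_open lp).
have dx := smooth_on_differentiable (lp_smooth lp) Vs.
have de := smooth_on_differentiable (un_smooth un lp) Vs.
apply: (@umbilic_cov_along R d.+1 (met c) x (fun s => eta c (x s)) s l0) => //.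
- apply: warped_metric_differentiable.
  + exact: (bp_diff_rho base).
  + by move=> i j; apply: (bp_diff_bm base).
  + by move=> i j; apply: (fc_diff fc).
- by apply: warped_metric_sym; [exact: (bp_sym base)|exact: (fc_sym fc)].
- apply: warped_metric_unit; [exact: (bp_unit base)|exact: fc_unit fc _|].
  by rewrite gt_eqF // (bp_pos base).
- exact: (lp_immersion lp).
- by apply: filterS nV => t Vt; exact: (un_unit un lp).
- exact: (un_normal un lp).
have [_ /(_ s Vs)] := ps_umbilic hP lp.
by rewrite (lambdaE (local_param_mem lp Vs)).
Qed.

Lemma normal_neq0 (c : chart A) V x s : param c V x -> V s ->
  lsubmx (eta c (x s)) = 0 -> rsubmx (eta c (x s)) = 0 -> False.
Proof.
move=> lp Vs xi0 ze0; have := un_unit (ps_normal hP) lp Vs.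
rewrite -[eta c (x s)]hsubmxK xi0 ze0 row_mx0 !mul0mx mxE => /eqP.
by rewrite eq_sym oner_eq0.
Qed.

(** A transition map carries the vanishing part over, and then both parts of one
unit normal vanish. *)
Lemma normal_type_agree (c c' : chart A) V V' x x' s s' :
  param c V x -> param c' V' x' -> V s -> V' s' ->
  par c (x s) = par c' (x' s') ->
  lsubmx (eta c (x s)) = 0 -> rsubmx (eta c' (x' s')) = 0 -> False.
Proof.
move=> lp lp' Vs Vs' e xi0 ze0; have [_ overlap] := adm.
have Ps := local_param_mem lp Vs; have Ps' := local_param_mem lp' Vs'.
have [Bs Ns] := lp_dom lp Vs; have [Bs' Ns'] := lp_dom lp' Vs'.
have [eN [tr|tr]] := overlap _ _ _ _ _ _ Bs Bs' e.
  have [H _] := normal_type_transition hN (ps_normal hP) tr Ns Ns' eN (local_param_mem lp Vs).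
  move: H; rewrite -[(c.1, c.2)]surjective_pairing -[(c'.1, c'.2)]surjective_pairing.
  by move/(_ xi0) => xi0'; exact: (normal_neq0 lp' Vs' xi0' ze0).
have [_ H] := normal_type_transition hN (ps_normal hP) tr Ns' Ns (esym eN)
  (local_param_mem lp' Vs').
move: H; rewrite -[(c.1, c.2)]surjective_pairing -[(c'.1, c'.2)]surjective_pairing.
by move/(_ ze0) => ze0'; exact: (normal_neq0 lp Vs xi0 ze0').
Qed.

Hypothesis dichotomy : forall (c : chart A) V x s, param c V x -> V s ->
  lsubmx (eta c (x s)) = 0 \/ rsubmx (eta c (x s)) = 0.

(** Parametrizations are homeomorphisms onto relatively open pieces, so a
condition that is open in the parameters is relatively open on the surface. *)
Lemma open_normal_type (Q : 'rV[R]_(2 + d) -> Prop) :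
  (forall (c : chart A) V x s, param c V x -> V s -> Q (eta c (x s)) ->
     \forall t \near s, Q (eta c (x t))) ->
  exists2 W, open W & P `&` W =
    [set p | exists c V x s, [/\ param c V x, V s, par c (x s) = p & Q (eta c (x s))]].
Proof.
move=> Qopen.
pose W : set (carrier S) := \bigcup_(W in [set W : set (carrier S) | open W /\
  exists c V x V', [/\ param c V x, V' `<=` V,
    forall s, V' s -> Q (eta c (x s)) & [set par c (x s) | s in V'] = P `&` W]]) W.
exists W; first by apply: bigcup_open => W' [].
apply/seteqP; split=> p.
  move=> [Pp [W' [oW' [c [V [x [V' [lp sV hQ eW]]]]]] W'p]].
  have : (P `&` W') p by [].
  rewrite -eW => -[s Vs <-]; exists c, V, x, s; split=> //; first exact: sV.
  exact: hQ.
move=> [c [V [x [s [lp Vs <- Qs]]]]]; split; first exact: local_param_mem lp Vs.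
pose V' := [set t | V t /\ Q (eta c (x t))]°.
have oV' : open V' by exact: open_interior.
have sV : V' `<=` V by move=> t /interior_subset [].
have [W' oW' eW'] := lp_homeo lp oV' sV.
have Vs' : V' s.
  apply: filterI; last exact: Qopen lp Vs Qs.
  by apply: open_nbhs_nbhs; split=> //; exact: (lp_open lp).
have [Ps Ws] : (P `&` W') (par c (x s)) by rewrite -eW'; exists s.
exists W' => //; split=> //; exists c, V, x, V'; split=> // t.
by case/interior_subset.
Qed.

(** The two types of points form disjoint relatively open sets that cover the
surface. *)
Lemma connected_normal_type : connected P ->
  (forall (c : chart A) V x s, param c V x -> V s -> lsubmx (eta c (x s)) = 0) \/
  (forall (c : chart A) V x s, param c V x -> V s -> rsubmx (eta c (x s)) = 0).
Proof.
move=> conn.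
have diffE (c : chart A) V x s : param c V x -> V s ->
    differentiable (fun t => eta c (x t)) s.
  by move=> lp Vs; exact: smooth_on_differentiable (un_smooth (ps_normal hP) lp) Vs.
have nearV (c : chart A) V x s : param c V x -> V s -> nbhs s V.
  by move=> lp Vs; apply: open_nbhs_nbhs; split=> //; exact: (lp_open lp).
have openL (c : chart A) V x s : param c V x -> V s -> lsubmx (eta c (x s)) = 0 ->
    \forall t \near s, lsubmx (eta c (x t)) = 0.
  move=> lp Vs xi0.
  have /eqP ze0 : rsubmx (eta c (x s)) <> 0 by move/(normal_neq0 lp Vs xi0).
  have dr : differentiable (fun t => rsubmx (eta c (x t))) s.
    exact: differentiable_comp (diffE _ _ _ _ lp Vs) (differentiable_rsubmx _).
  have nz : \forall t \near s, rsubmx (eta c (x t)) != 0.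
    exact: cvgr_neq0 (differentiable_continuous dr) ze0.
  apply: filterS2 (nearV _ _ _ _ lp Vs) nz => t Vt /eqP n.
  by case: (dichotomy lp Vt).
have openR (c : chart A) V x s : param c V x -> V s -> rsubmx (eta c (x s)) = 0 ->
    \forall t \near s, rsubmx (eta c (x t)) = 0.
  move=> lp Vs ze0.
  have /eqP xi0 : lsubmx (eta c (x s)) <> 0.
    by move=> xi0; exact: normal_neq0 lp Vs xi0 ze0.
  have dl : differentiable (fun t => lsubmx (eta c (x t))) s.
    exact: differentiable_comp (diffE _ _ _ _ lp Vs) (differentiable_lsubmx _).
  have nz : \forall t \near s, lsubmx (eta c (x t)) != 0.
    exact: cvgr_neq0 (differentiable_continuous dl) xi0.
  apply: filterS2 (nearV _ _ _ _ lp Vs) nz => t Vt /eqP n.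
  by case: (dichotomy lp Vt).
have [WL oWL eL] := open_normal_type (Q := fun v => lsubmx v = 0) openL.
have [WR oWR eR] := open_normal_type (Q := fun v => rsubmx v = 0) openR.
have memL (c : chart A) V x s : param c V x -> V s -> lsubmx (eta c (x s)) = 0 ->
    (P `&` WL) (par c (x s)) by move=> lp Vs xi0; rewrite eL; exists c, V, x, s.
have memR (c : chart A) V x s : param c V x -> V s -> rsubmx (eta c (x s)) = 0 ->
    (P `&` WR) (par c (x s)) by move=> lp Vs ze0; rewrite eR; exists c, V, x, s.
have disj p : (P `&` WL) p -> (P `&` WR) p -> False.
  rewrite eL eR => -[c [V [x [s [lp Vs <- xi0]]]]] [c' [V' [x' [s' [lp' Vs' e ze0]]]]].
  exact: normal_type_agree lp lp' Vs Vs' (esym e) xi0 ze0.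
have [ne|emp] := pselect ((P `&` WL) !=set0); last first.
  right=> c V x s lp Vs; case: (dichotomy lp Vs) => // xi0.
  by case: emp; exists (par c (x s)); exact: memL lp Vs xi0.
left=> c V x s lp Vs; case: (dichotomy lp Vs) => // ze0; exfalso.
have PL : P `&` WL = P.
  apply: conn => //; first by exists WL.
  exists (~` WR); first exact: open_closedC.
  apply/seteqP; split=> p [Pp Wp]; split=> //.
    by move=> Rp; exact: (disj p).
  have [c1 [V1 [x1 [lp1 [s1 Vs1 e1]]]]] := ps_submanifold hP Pp.
  case: (dichotomy lp1 Vs1) => t0; first by have [] := memL _ _ _ _ lp1 Vs1 t0; rewrite e1.
  by have [_] := memR _ _ _ _ lp1 Vs1 t0; rewrite e1.
have Ps := local_param_mem lp Vs.
by apply: (disj (par c (x s))); [rewrite PL|exact: memR lp Vs ze0].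
Qed.

End PhotonSurface.

(** * The dichotomy *)

Unset Implicit Arguments.
Set Strict Implicit.
Set Printing Implicit Defensive.

Theorem theorem5p1 (R : realType) (n : nat) (hn : (3 <= n)%N)
  (N : topologicalType) (gN : atlas R N n.-1) (hN : compact_riemannian gN)
  (h : R -> R) (rH : R) (hh : class_H_coefficient h rH)
  (S : warped R N) (hS : class_H_or_extension h rH S)
  (P : set (carrier S)) (eta : vfield (warped_atlas gN S))
  (lambda : carrier S -> R)
  (hP : photon_surface n P eta lambda) (hconn : connected P)
  (hconst : exists l0 : R, forall p, P p -> lambda p = l0)
  (hdense : [set r : R | 0 < r] `<=` closure [set r : R | 0 < r /\
     forall (c : chart gN) (y X : 'rV[R]_n.-1), dom c y ->
       (X *m met c y *m X^T) 0 0 = 1 ->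
       2^-1 * derive1n 2 h r + (n - 3)%N%:R / (2 * r) * derive1 h r
         - (n - 2)%N%:R / r ^+ 2 * h r
         + r ^- 2 * (X *m ricci (met c) y *m X^T) 0 0 != 0]) :
  rotationally_symmetric n P eta \/
  [/\ totally_geodesic n P eta, parallel n P eta & tangent_to_fibre n P eta].
Proof.
case: n hn gN hN eta hP hdense => [//|d] hn gN hN eta hP hdense.
have adm := class_H_admissible hh hS; have [base _] := adm.
have [l0 lamE] := hconst.
have patch := photon_patch hN adm hP lamE.
have domB (c : chart (warped_atlas gN S)) V x (lp : local_param (n := d.+1) P c V x) s :
    V s -> bdom c.1 (lsubmx (x s)).
  by move=> /(lp_dom lp) [].
have domN (c : chart (warped_atlas gN S)) V x (lp : local_param (n := d.+1) P c V x) s :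
    V s -> dom c.2 (rsubmx (x s)).
  by move=> /(lp_dom lp) [].
have dichotomy (c : chart (warped_atlas gN S)) V x s :
    local_param (n := d.+1) P c V x -> V s ->
    lsubmx (eta c (x s)) = 0 \/ rsubmx (eta c (x s)) = 0.
  move=> lp Vs.
  apply: (patch_dichotomy (base c.1) (fibre_chart_riemannian c.2 hN) (patch _ _ _ lp)
    (domB _ _ _ lp) (domN _ _ _ lp) (class_H_derivable hh) hdense _ Vs).
  move=> r w X [_ generic] Nw X1 r0 stat; apply/eqP => ric.
  have /eqP := generic c.2 w X Nw X1; apply.
  have d2 : (2 <= d)%N by [].
  have -> : (d.+1 - 3)%N%:R = d%:R - 2 :> R by rewrite subSS natrB.
  have -> : (d.+1 - 2)%N%:R = d%:R - 1 :> R by rewrite subSS natrB // ltnW.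
  have -> : derive1n 2 h r = derive1 h r / r.
    by rewrite -stat mulrAC divff ?mul1r // gt_eqF.
  by rewrite ric; field; rewrite gt_eqF.
have [fibre|base_normal] := connected_normal_type hN adm hP dichotomy hconn.
  right.
  have cov0 : parallel (d.+1) P eta.
    move=> c V x lp s Vs; have pt := patch _ _ _ lp.
    have l00 := fibre_normal_umbilicity (base c.1) (fibre_chart_riemannian c.2 hN) pt
      (domB _ _ _ lp) (domN _ _ _ lp) Vs (fun t Vt => fibre _ _ _ _ lp Vt).
    apply/matrixP => a k; rewrite !mxE; apply: etrans (up_cov pt a k Vs) _.
    by rewrite l00 mul0r.
  split=> // [c V x lp s Vs|c V x lp s Vs]; last exact: fibre lp Vs.
  by rewrite /second_fundamental_form (cov0 _ _ _ lp s Vs) !mul0mx.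
left=> c V x lp s Vs; have ze0 := base_normal _ _ _ _ lp Vs; split=> // w.
exact: (base_normal_contains_fibre (base c.1) (fibre_chart_riemannian c.2 hN)
  (patch _ _ _ lp) (domB _ _ _ lp) (domN _ _ _ lp)).
Qed.
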